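(* Let $k$ be a field and $B=k\langle x,y\rangle/(y^2)$ with $\deg x=\deg y=1$. If $z$ is a Penrose sequence, then $\mathcal{O}_z$ is a simple object in $\mathsf{QGr}\,B$. Moreover, for Penrose sequences $z$ and $z'$ the following are equivalent: (1) $\mathcal{O}_z\cong\mathcal{O}_{z'}$ in $\mathsf{QGr}\,B$; (2) $z\sim z'$; (3) there is an isometry $\sigma$ of $\mathbb{R}^2$ such that $\sigma(\mathcal{T}_z)=\mathcal{T}_{z'}$.
   Context: $\mathsf{QGr}\,B:=\mathsf{Gr}\,B/\mathsf{Fdim}\,B$, where $\mathsf{Gr}\,B$ is the category of $\mathbb{Z}$-graded left $B$-modules (degree-preserving maps) and $\mathsf{Fdim}\,B$ the Serre subcategory of modules that are unions of their finite dimensional submodules. A Penrose sequence is an infinite sequence $z=z_0z_1\ldots$ of 0s and 1s having no two consecutive 1s. $z\sim z'$ means there is $m$ with $z_n=z'_n$ for all $n\ge m$. For a Penrose sequence $z$, $M_z=ke_0\oplus ke_1\oplus\cdots$ is the graded left $B$-module with $\deg e_i=i$, $x.e_i=(1-z_i)e_{i+1}$, $y.e_i=z_ie_{i+1}$, and $\mathcal{O}_z$ is the image of $M_z$ in $\mathsf{QGr}\,B$. Penrose tilings. Let $\tau=\frac{1+\sqrt5}{2}$ and $\theta=\pi/5$. The kite is the quadrangle with sides $1,1,\tau,\tau$ and interior angles $2\theta,2\theta,2\theta,4\theta$; its vertex with angle $4\theta$ and the opposite vertex are black, the other two are white. The dart is the quadrangle with sides $1,1,\tau,\tau$ and angles $\theta,\theta,2\theta,6\theta$;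 its vertex with angle $6\theta$ and the opposite vertex are white, the other two are black. A Penrose tiling is an edge-to-edge tiling of $\mathbb{R}^2$ by congruent copies (reflections allowed) of the kite and dart such that whenever a point is a vertex of more than one tile it has the same color on each of those tiles. Triangles. Cutting the kite (resp. dart) along its axis of symmetry gives two congruent triangles, called $A$ (resp. $a$), with inherited vertex colors: $A$ has sides $1,\tau,\tau$, with angle $36^\circ$ at a black vertex and angles $72^\circ$ at one black and one white vertex; $a$ has sides $1,1,\tau$, with angle $108^\circ$ at a white vertex and angles $36^\circ$ at one white and one black vertex. Cutting all tiles of a Penrose tiling gives an $A$-tiling, by triangles $A$ (large) and $a$ (small); deleting all edges joining vertices of the same color recovers the kite-and-dart tiling. Composition. (i) In an $A$-tiling each $a$-tile has exactly one edge of length 1 with endpoints of different colors, and across it lies an $A$-tile; the union of the two is a triangle with sides $\tau,\tau,1+\tau$, called $B$, with inherited colors at its vertices. Deleting all such edges, and renaming the remaining $A$-tiles $b$, gives a $B$-tiling, by triangles $B$ (large) and $b$ (small). (ii) In a $B$-tiling each $b$-tile has exactly one edge with both endpoints black, and across it lies a $B$-tile; the union of the two is congruent to $\tau A$. Deleting all such edges gives a tiling by $\tau A$ (large) and the remaining $B$-tiles, which are congruent to $\tau a$ (small); after shrinking by the factor $\tau$ (and interchanging black and white) it is an $A$-tiling again. Steps (i) and (ii) are repeated alternately forever, producing a level-$n$ tiling for each $n\ge0$ (level 0 is the $A$-tiling). If $\mathcal{T}$ is a Penrose tiling and $p\in\mathbb{R}^2$ is not on an edge or axis of symmetry of any kite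 or dart of $\mathcal{T}$, the sequence of $(\mathcal{T},p)$ is $z_0z_1\ldots$ with $z_n=0$ if $p$ lies in a large tile of the level-$n$ tiling and $z_n=1$ if it lies in a small one; this is a Penrose sequence. The tiling $\mathcal{T}_z$. Given a Penrose sequence $z$, $\mathcal{T}_z$ is the Penrose tiling (with a point $p$) whose sequence is $z$, constructed as follows: start with a tile $t_0$ that is $A$ if $z_0=0$ and $a$ if $z_0=1$; inductively $t_{n+1}\supseteq t_n$ is the level-$(n+1)$ tile, large if $z_{n+1}=0$ and small if $z_{n+1}=1$, of which the level-$n$ tile $t_n$ is a part under the composition rules ($t_{n+1}=t_n$ if $z_n=0,z_{n+1}=1$; otherwise $t_{n+1}$ is $t_n$ together with an adjacent tile of the other size). Each $t_n$ is thereby tiled by $A$- and $a$-triangles compatibly, so $\bigcup_n t_n$ is tiled by them. This union is the plane, a half-plane, or a sector of angle $\pi/5$; in the latter two cases one fills the whole plane by reflection(s) in the boundary lines. Deleting the edges joining vertices of the same color gives $\mathcal{T}_z$. $\mathcal{T}_z$ is defined up to isometry. *)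

(* Defs.v *)
From HB Require Import structures.
From mathcomp Require Import all_boot all_order all_algebra finmap.
From mathcomp Require Import generic_quotient ring_quotient.
From mathcomp Require Import boolp classical_sets reals topology normedtype.
From mathcomp Require Import trigo.
From mathcomp Require Import -(notations) monalg.
From mathcomp Require Import ring.

Set Implicit Arguments.
Unset Strict Implicit.
Unset Printing Implicit Defensive.

Import Order.TTheory GRing.Theory Num.Theory.
Import numFieldNormedType.Exports.
Local Open Scope ring_scope.
Local Open Scope quotient_scope.
Local Open Scope classical_set_scope.

(* MathComp only provides ring quotients for commutative rings: A / (r), for a
   noncommutative ring A and the two-sided ideal (r) generated by r, is the
   additive quotient of the library with the induced product. *)
Section QuotientRing.
Variables (A : nzRingType) (r : A).

Definition in_ideal2 (f : A) : Prop :=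
  exists s : seq (A * A), f = \sum_(ab <- s) ab.1 * r * ab.2.

Definition ideal2 : {pred A} := fun f => `[< in_ideal2 f >].

Lemma ideal2P f : reflect (in_ideal2 f) (f \in ideal2).
Proof. exact: asboolP. Qed.

Lemma ideal2_zmod : zmod_closed ideal2.
Proof.
split; first by apply/ideal2P; exists [::]; rewrite big_nil.
move=> _ _ /ideal2P[s ->] /ideal2P[t ->]; apply/ideal2P.
exists (s ++ [seq (- ab.1, ab.2) | ab <- t]).
rewrite big_cat big_map /= -sumrN; congr (_ + _).
by apply: eq_bigr => ab _; rewrite !mulNr.
Qed.

HB.instance Definition _ := GRing.isZmodClosed.Build A ideal2 ideal2_zmod.

Lemma ideal2Ml g f : f \in ideal2 -> g * f \in ideal2.
Proof.
move=> /ideal2P[s ->]; apply/ideal2P.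
exists [seq (g * ab.1, ab.2) | ab <- s]; rewrite big_map mulr_sumr.
by apply: eq_bigr => ab _; rewrite /= !mulrA.
Qed.

Lemma ideal2Mr g f : f \in ideal2 -> f * g \in ideal2.
Proof.
move=> /ideal2P[s ->]; apply/ideal2P.
exists [seq (ab.1, ab.2 * g) | ab <- s]; rewrite big_map mulr_suml.
by apply: eq_bigr => ab _; rewrite /= !mulrA.
Qed.

Definition quot2 : Type := Quotient.quot ideal2.

HB.instance Definition _ := GRing.Zmodule.on quot2.

Definition pi2 (f : A) : quot2 := \pi_(Quotient.quot ideal2) f.

Definition repr2 (b : quot2) : A := repr (b : Quotient.quot ideal2).

Lemma repr2K : cancel repr2 pi2. Proof. exact: reprK. Qed.

Lemma pi2_eq f g : pi2 f = pi2 g <-> f - g \in ideal2.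
Proof. by rewrite Quotient.idealrBE; split=> [/eqP|/eqP]. Qed.

Lemma pi2B : {morph pi2 : f g / f - g}.
Proof. exact: (raddfB (\pi_(Quotient.quot ideal2))). Qed.

HB.instance Definition _ := GRing.isZmodMorphism.Build A quot2 pi2 pi2B.

Definition mul2 (b c : quot2) : quot2 := pi2 (repr2 b * repr2 c).

Lemma pi2M_def f g : mul2 (pi2 f) (pi2 g) = pi2 (f * g).
Proof.
apply/pi2_eq; set f' := repr2 _; set g' := repr2 _.
have hf : f' - f \in ideal2 by apply/pi2_eq; rewrite repr2K.
have hg : g' - g \in ideal2 by apply/pi2_eq; rewrite repr2K.
rewrite -[f' * g'](addrNK (f * g')) -addrA -mulrBl -mulrBr.
by apply: rpredD; [exact: ideal2Mr | exact: ideal2Ml].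
Qed.

Lemma mul2A : associative mul2.
Proof.
by move=> a b c; rewrite -[a]repr2K -[b]repr2K -[c]repr2K !pi2M_def mulrA.
Qed.

Lemma mul12 : left_id (pi2 1) mul2.
Proof. by move=> a; rewrite -[a]repr2K pi2M_def mul1r. Qed.

Lemma mul21 : right_id (pi2 1) mul2.
Proof. by move=> a; rewrite -[a]repr2K pi2M_def mulr1. Qed.

Lemma mul2Dl : left_distributive mul2 +%R.
Proof.
move=> a b c; rewrite -[a]repr2K -[b]repr2K -[c]repr2K.
by rewrite -raddfD !pi2M_def -raddfD mulrDl.
Qed.

Lemma mul2Dr : right_distributive mul2 +%R.
Proof.
move=> a b c; rewrite -[a]repr2K -[b]repr2K -[c]repr2K.
by rewrite -raddfD !pi2M_def -raddfD mulrDr.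
Qed.

HB.instance Definition _ :=
  GRing.Zmodule_isPzRing.Build quot2 mul2A mul12 mul21 mul2Dl mul2Dr.

Lemma pi2M : {morph pi2 : f g / f * g}.
Proof. by move=> f g; rewrite -pi2M_def. Qed.

End QuotientRing.

(* The free algebra k<x,y> is the monoid algebra of the free monoid on the
   letters false (for x) and true (for y). *)
Definition free_xy (k : fieldType) : nzRingType := malg (fmonom bool) k.

Definition free_term (k : fieldType) (a : k) (w : fmonom bool) : free_xy k :=
  mkmalgU w a.

Definition free_x (k : fieldType) : free_xy k := free_term 1 (fmu false).
Definition free_y (k : fieldType) : free_xy k := free_term 1 (fmu true).

Definition B (k : fieldType) : pzRingType := quot2 (free_y k * free_y k).

Definition piB (k : fieldType) (f : free_xy k) : B k :=
  @pi2 (free_xy k) (free_y k * free_y k) f.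

(* The scalars a, and the generators x and y, as elements of B *)
Definition scalB (k : fieldType) (a : k) : B k :=
  piB (free_term a (fmone bool)).
Definition xB (k : fieldType) : B k := piB (free_x k).
Definition yB (k : fieldType) : B k := piB (free_y k).

(* deg x = deg y = 1: the component of degree d of B is the image of the span
   of the words of length d. *)
Definition degB (k : fieldType) (d : nat) (b : B k) : Prop :=
  exists2 f : free_xy k, (forall w, mcoeff w f != 0 -> fdeg w = d) & b = piB f.

Section Representation.
(* A k-vector space with two endomorphisms X and Y such that Y^2 = 0 is a
   B-module. *)
Variables (k : fieldType) (V : lmodType k) (X Y : {linear V -> V}).
Hypothesis YY : forall v, Y (Y v) = 0.

Definition act_word (w : seq bool) (v : V) : V :=
  foldr (fun c : bool => if c then Y else X) v w.

Definition act_free (f : free_xy k) (v : V) : V :=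
  \sum_(w <- msupp f) mcoeff w f *: act_word w v.

Lemma act_word_linear w : linear (act_word w).
Proof.
by move=> a u v; elim: w => //= c w ->; case: c; rewrite linearP.
Qed.

Lemma act_wordZ w a v : act_word w (a *: v) = a *: act_word w v.
Proof. by elim: w => //= c w ->; case: c; rewrite linearZ. Qed.

HB.instance Definition _ w :=
  GRing.isLinear.Build k V V *:%R (act_word w) (act_word_linear w).

Lemma act_free_widen (E : {fset fmonom bool}) f v : (msupp f `<=` E)%fset ->
  act_free f v = \sum_(w <- E) mcoeff w f *: act_word w v.
Proof.
move=> le; rewrite /act_free (big_fset_incl _ le) //= => w _ /mcoeff_outdom ->.
by rewrite scale0r.
Qed.

Lemma act_free_linear f : linear (act_free f).
Proof.
move=> a u v; rewrite /act_free scaler_sumr -big_split /=.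
by apply: eq_bigr => w _; rewrite linearP scalerDr !scalerA mulrC.
Qed.

HB.instance Definition _ f :=
  GRing.isLinear.Build k V V *:%R (act_free f) (act_free_linear f).

Lemma act_freeB f g v : act_free (f - g) v = act_free f v - act_free g v.
Proof.
pose E := (msupp (f : malg (fmonom bool) k) `|`
           msupp (g : malg (fmonom bool) k))%fset.
rewrite (@act_free_widen E) ?msuppB_le // (@act_free_widen E) ?fsubsetUl //.
rewrite (@act_free_widen E g) ?fsubsetUr // -sumrB.
by apply: eq_bigr => w _; rewrite mcoeffB scalerBl.
Qed.

Definition act_at v f := act_free f v.

Lemma act_at_zmod v : zmod_morphism (act_at v).
Proof. by move=> f g; exact: act_freeB. Qed.

HB.instance Definition _ v := GRing.isZmodMorphism.Build (free_xy k) V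
  (act_at v) (act_at_zmod v).

Lemma act_freeU w a v :
  act_free (free_term a w) v = a *: act_word w v.
Proof.
by rewrite (@act_free_widen [fset w]%fset) ?msuppU_le // big_seq_fset1 mcoeffUU.
Qed.

Lemma act_freeM f g v : act_free (f * g) v = act_free f (act_free g v).
Proof.
rewrite -/(act_at v _) malgME (raddf_sum (act_at v)) [RHS]/act_free.
apply: eq_bigr => u _; rewrite (raddf_sum (act_at v)) /act_at.
rewrite [act_free g v]/act_free raddf_sum scaler_sumr.
apply: eq_bigr => w _.
rewrite [LHS](act_freeU (mmul u w) _ v) -scalerA; congr (_ *: _).
rewrite fmM /act_word foldr_cat.
exact/esym/act_wordZ.
Qed.

Lemma act_free1 v : act_free 1 v = v.
Proof. by rewrite [LHS](act_freeU (fmone bool) 1 v) scale1r fm1. Qed.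

Lemma act_free_y v : act_free (free_y k) v = Y v.
Proof. by rewrite [LHS](act_freeU (fmu true) 1 v) scale1r fmU. Qed.

Lemma act_free_x v : act_free (free_x k) v = X v.
Proof. by rewrite [LHS](act_freeU (fmu false) 1 v) scale1r fmU. Qed.

Lemma act_free_ideal f v :
  f \in @ideal2 (free_xy k) (free_y k * free_y k) -> act_free f v = 0.
Proof.
move=> /ideal2P[s ->]; rewrite -/(act_at v _) (raddf_sum (act_at v)).
apply: big1 => -[a b] _.
rewrite -[LHS]/(act_free (a * (free_y k * free_y k) * b) v) !act_freeM.
rewrite !act_free_y YY; exact: (raddf0 (act_free a)).
Qed.

Definition rep_mod : Type := let _ := X in let _ := YY in V.

HB.instance Definition _ := GRing.Zmodule.on rep_mod.

Definition rep_act (b : B k) (v : rep_mod) : rep_mod := act_free (repr2 b) v.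

Lemma rep_act_pi f v : rep_act (piB f) v = act_free f v.
Proof.
apply/eqP; rewrite -subr_eq0 /rep_act -act_freeB act_free_ideal //.
by apply/pi2_eq; rewrite repr2K.
Qed.

Lemma rep_actA a b v : rep_act a (rep_act b v) = rep_act (a * b) v.
Proof.
rewrite -[a]repr2K -[b]repr2K -pi2M.
by rewrite !rep_act_pi act_freeM.
Qed.

Lemma rep_act1 : left_id 1 rep_act.
Proof. by move=> v; rewrite (rep_act_pi 1) act_free1. Qed.

Lemma rep_actDr : right_distributive rep_act +%R.
Proof. by move=> a u v; rewrite /rep_act linearD. Qed.

Lemma rep_actDl v : {morph rep_act^~ v : a b / a + b}.
Proof.
move=> a b; rewrite -[a]repr2K -[b]repr2K -raddfD !rep_act_pi.
exact: (raddfD (act_at v)).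
Qed.

HB.instance Definition _ := GRing.Zmodule_isLmodule.Build (B k) rep_mod
  rep_actA rep_act1 rep_actDr rep_actDl.

Lemma rep_x (v : rep_mod) : xB k *: v = X v.
Proof. by rewrite -[LHS]/(rep_act _ v) rep_act_pi act_free_x. Qed.

Lemma rep_y (v : rep_mod) : yB k *: v = Y v.
Proof. by rewrite -[LHS]/(rep_act _ v) rep_act_pi act_free_y. Qed.

Lemma rep_scal a (v : rep_mod) : scalB a *: v = a *: (v : V).
Proof.
rewrite -[LHS]/(rep_act _ v) rep_act_pi [LHS](act_freeU (fmone bool) a v).
by rewrite fm1.
Qed.

End Representation.

(* A Z-graded left B-module: a B-module that is the internal direct sum of its
   homogeneous components hom i. Stability of hom i under k is the case d = 0
   of hom_act. *)
Record grmod (k : fieldType) := GrMod {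
  carrier :> lmodType (B k);
  hom : int -> set carrier;
  hom0 : forall i, hom i 0;
  homB : forall i u v, hom i u -> hom i v -> hom i (u - v);
  hom_act : forall (d : nat) i b v,
    degB d b -> hom i v -> hom (i + d%:Z) (b *: v);
  hom_gen : forall v, exists (s : seq int) (c : int -> carrier),
    (forall i, hom i (c i)) /\ v = \sum_(i <- s) c i;
  hom_free : forall (s : seq int) (c : int -> carrier), uniq s ->
    (forall i, hom i (c i)) -> \sum_(i <- s) c i = 0 ->
    forall i, i \in s -> c i = 0
}.

Section GradedModules.
Variable k : fieldType.

Record grhom (M N : grmod k) := GrHom {
  grhom_fun :> {linear M -> N};
  grhom_deg : forall i v, hom i v -> hom i (grhom_fun v)
}.

Definition grhom_id (M : grmod k) : grhom M M :=
  @GrHom M M (idfun : {linear M -> M}) (fun _ _ h => h).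

Definition grhom_comp (L M N : grmod k) (g : grhom M N) (f : grhom L M) :
    grhom L N :=
  @GrHom L N (g \o f : {linear L -> N})
    (fun i v h => grhom_deg g (grhom_deg f h)).

Definition grsubmod (M : grmod k) (N : set M) : Prop :=
  [/\ N 0,
      forall u v, N u -> N v -> N (u - v),
      forall (b : B k) v, N v -> N (b *: v) &
      forall v, N v -> exists (s : seq int) (c : int -> M),
        (forall i, hom i (c i) /\ N (c i)) /\ v = \sum_(i <- s) c i].

(* The k-vector space L / Q is finite dimensional. *)
Definition findim_quot (M : grmod k) (Q L : set M) : Prop :=
  exists s : seq M, {in s, forall u, L u} /\
    forall v, L v -> exists a : M -> k,
      Q (v - \sum_(u <- s) scalB (a u) *: u).

(* For graded submodules Q <= P of M, the subquotient P / Q is in Fdim B: it is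
   the union of its finite dimensional graded submodules, which are the L / Q
   with Q <= L <= P. *)
Definition fdim_quot (M : grmod k) (Q P : set M) : Prop :=
  forall v, P v -> exists L : set M,
    [/\ grsubmod L, Q `<=` L, L `<=` P, L v & findim_quot Q L].

(* The morphisms inverted in QGr B = Gr B / Fdim B: those with kernel and
   cokernel in Fdim B. *)
Definition fdim_iso (M N : grmod k) (f : grhom M N) : Prop :=
  fdim_quot [set 0] [set v | f v = 0] /\ fdim_quot (range f) [set: N].

Lemma grsubmod0 (M : grmod k) : grsubmod [set (0 : M)].
Proof.
split=> //= [u v -> ->|b v ->|v ->]; rewrite ?subr0 ?scaler0 //.
exists [::], (fun=> 0); rewrite big_nil; split=> // i; split=> //.
exact: hom0.
Qed.

Lemma grsubmodT (M : grmod k) : grsubmod [set: M].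
Proof.
split=> // v _; have [s [c [hc ->]]] := hom_gen v.
by exists s, c; split=> // i; split.
Qed.

Lemma fdim_iso_id (M : grmod k) : fdim_iso (grhom_id M).
Proof.
split=> [v /= v0|v _]; [exists [set 0]|exists [set: M]]; split=> //.
- exact: grsubmod0.
- by exists [::]; split=> // w /= ->; exists (fun=> 0); rewrite big_nil subr0.
- exact: grsubmodT.
- exists [::]; split=> // w _; exists (fun=> 0); rewrite big_nil subr0 /=.
  by exists w.
Qed.

(* QGr B has the objects of Gr B, and is the localization of Gr B at fdim_iso,
   which admits a calculus of fractions: a morphism M -> N is represented by a
   roof M <- top -> N whose left leg is inverted. *)
Record qhom (M N : grmod k) := QHom {
  top : grmod k;
  left_leg : grhom top M;
  right_leg : grhom top N;
  left_legP : fdim_iso left_leg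
}.

Definition qhom_eq (M N : grmod k) (F G : qhom M N) : Prop :=
  exists (T : grmod k) (u : grhom T (top F)) (v : grhom T (top G)),
    [/\ fdim_iso (grhom_comp (left_leg F) u),
        left_leg F \o u =1 left_leg G \o v &
        right_leg F \o u =1 right_leg G \o v].

Definition qhom_id (M : grmod k) : qhom M M :=
  QHom (grhom_id M) (fdim_iso_id M).

(* H is the composite of F followed by G, computed with any Ore square. *)
Definition qcomp (L M N : grmod k) (F : qhom L M) (G : qhom M N)
    (H : qhom L N) : Prop :=
  exists (T : grmod k) (u : grhom T (top F)) (v : grhom T (top G))
      (uP : fdim_iso (grhom_comp (left_leg F) u)),
    right_leg F \o u =1 left_leg G \o v /\
    qhom_eq H (QHom (grhom_comp (right_leg G) v) uP).

Definition qisomorphism (M N : grmod k) (F : qhom M N) : Prop :=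
  exists G : qhom N M, qcomp F G (qhom_id M) /\ qcomp G F (qhom_id N).

Definition qisomorphic (M N : grmod k) : Prop :=
  exists F : qhom M N, qisomorphism F.

Definition qmono (M N : grmod k) (F : qhom M N) : Prop :=
  forall (L : grmod k) (G G' : qhom L M) (H : qhom L N),
    qcomp G F H -> qcomp G' F H -> qhom_eq G G'.

Definition qzero (M : grmod k) : Prop :=
  forall N : grmod k,
    (exists F : qhom M N, forall G, qhom_eq F G) /\
    (exists F : qhom N M, forall G, qhom_eq F G).

(* A simple object of the abelian category QGr B: it is nonzero and its only
   subobjects are zero and itself. *)
Definition qsimple (M : grmod k) : Prop :=
  ~ qzero M /\
  forall (N : grmod k) (F : qhom N M), qmono F -> qzero N \/ qisomorphism F.

End GradedModules.
(* The bits 0 and 1 of a sequence are false and true. *)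
Record penrose_seq := PenroseSeq {
  bit :> nat -> bool;
  no_11 : forall n, ~~ (bit n && bit n.+1)
}.

Definition tail_eq (z z' : penrose_seq) : Prop :=
  exists m : nat, forall n, (m <= n)%N -> z n = z' n.

(* M_z is carried by {poly k}, with e_i = 'X^i. *)
Section Mz.
Variables (k : fieldType) (z : penrose_seq).

(* The endomorphism e_i |-> a i *: e_(i+1) *)
Definition shift (a : nat -> k) (p : {poly k}) : {poly k} :=
  'X * \poly_(i < size p) (a i * p`_i).

Lemma coef_shift a p j :
  (shift a p)`_j = if j is i.+1 then a i * p`_i else 0.
Proof.
rewrite coefXM; case: j => //= i; rewrite coef_poly.
by case: ltnP => // /leq_sizeP ->; rewrite ?mulr0.
Qed.

Lemma shift_linear a : linear (shift a).
Proof.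
move=> c p q; apply/polyP => -[|i]; rewrite coefD coefZ !coef_shift.
  by rewrite mulr0 addr0.
by rewrite coefD coefZ mulrDr !mulrA [a i * c]mulrC.
Qed.

HB.instance Definition _ a :=
  GRing.isLinear.Build k {poly k} {poly k} *:%R (shift a) (shift_linear a).

Definition Mz_x : {linear {poly k} -> {poly k}} :=
  shift (fun i => 1 - (z i)%:R).
Definition Mz_y : {linear {poly k} -> {poly k}} :=
  shift (fun i => (z i)%:R).

Lemma Mz_yy p : Mz_y (Mz_y p) = 0.
Proof.
apply/polyP => -[|[|i]]; rewrite coef0 coef_shift ?coef_shift ?mulr0 //.
rewrite mulrA -natrM mulnb [z i.+1 && z i]andbC.
by rewrite (negbTE (no_11 z i)) mul0r.
Qed.

Definition Mz_hom (i : int) : set (rep_mod Mz_x Mz_yy) :=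
  [set p | forall j : nat, (p : {poly k})`_j != 0 -> j%:Z = i].

Lemma Mz_hom0 i : Mz_hom i 0.
Proof. by move=> j; rewrite coef0 eqxx. Qed.

Lemma Mz_homB i u v : Mz_hom i u -> Mz_hom i v -> Mz_hom i (u - v).
Proof.
move=> hu hv j; rewrite coefB => h.
have [u0|/hu//] := eqVneq (u : {poly k})`_j 0.
by apply: hv; apply: contraNneq h => ->; rewrite u0 subr0.
Qed.

Lemma Mz_hom_shift a i p : Mz_hom i p -> Mz_hom (i + 1) (shift a p).
Proof.
move=> hp [|j]; rewrite coef_shift ?eqxx // mulf_eq0 negb_or => /andP[_ /hp <-].
by rewrite -addn1 PoszD.
Qed.

Lemma Mz_hom_word (w : seq bool) i p :
  Mz_hom i p -> Mz_hom (i + (size w)%:Z) (act_word Mz_x Mz_y w p).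
Proof.
move=> hp; elim: w => [|c w IH] /=; first by rewrite addr0.
by rewrite -addn1 PoszD addrA; case: c; apply: Mz_hom_shift.
Qed.

Lemma Mz_hom_act (d : nat) i b v :
  degB d b -> Mz_hom i v -> Mz_hom (i + d%:Z) (b *: v).
Proof.
move=> [f hf ->] hv j.
rewrite -[_ *: _]/(rep_act (piB f) v) rep_act_pi /act_free coef_sum => h.
have [//|ne] := eqVneq j%:Z (i + d%:Z); case/negP: h; apply/eqP.
apply: big1 => w _; rewrite coefZ.
have [->|/hf wd] := eqVneq (mcoeff w f) 0; first by rewrite mul0r.
have [->|hw] := eqVneq (act_word Mz_x Mz_y w v)`_j 0; first by rewrite mulr0.
by case/eqP: ne; rewrite (Mz_hom_word hv hw) -fdegE wd.
Qed.

Lemma Mz_hom_gen (v : rep_mod Mz_x Mz_yy) :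
  exists (s : seq int) (c : int -> rep_mod Mz_x Mz_yy),
    (forall i, Mz_hom i (c i)) /\ v = \sum_(i <- s) c i.
Proof.
pose c (i : int) : {poly k} :=
  if i is Posz j then (v : {poly k})`_j *: 'X^j else 0.
exists [seq Posz j | j <- iota 0 (size (v : {poly k}))], c; split.
  case=> i j; rewrite /c ?coef0 ?eqxx // coefZ coefXn.
  by have [->|] := eqVneq j i; rewrite // mulr0 eqxx.
rewrite big_map -[X in iota _ X]subn0 -/(index_iota 0 _) big_mkord /c.
by rewrite -[LHS](@coefK k v) poly_def.
Qed.

Lemma Mz_hom_free (s : seq int) (c : int -> rep_mod Mz_x Mz_yy) : uniq s ->
  (forall i, Mz_hom i (c i)) -> \sum_(i <- s) c i = 0 ->
  forall i, i \in s -> c i = 0.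
Proof.
move=> us hc s0 i si; apply/polyP => j; rewrite coef0.
have [//|cij] := eqVneq (c i : {poly k})`_j 0.
have /(congr1 (fun p : {poly k} => p`_j)) := s0.
rewrite coef0 (coef_sum) (bigD1_seq i) //= big1 ?addr0 // => i' ne.
have [//|ci'j] := eqVneq (c i' : {poly k})`_j 0.
by case/eqP: ne; rewrite -(hc _ _ cij) -(hc _ _ ci'j).
Qed.

Definition Mz : grmod k := @GrMod k (rep_mod Mz_x Mz_yy) Mz_hom
  Mz_hom0 Mz_homB Mz_hom_act Mz_hom_gen Mz_hom_free.

Lemma Mz_xE i : xB k *: ('X^i : Mz) = (1 - (z i)%:R) *: 'X^(i.+1) :> {poly k}.
Proof.
rewrite [LHS]rep_x; apply/polyP => -[|j]; rewrite coef_shift coefZ !coefXn.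
  by rewrite mulr0.
by rewrite eqSS; have [->|] := eqVneq j i; rewrite ?mulr0.
Qed.

Lemma Mz_yE i : yB k *: ('X^i : Mz) = (z i)%:R *: 'X^(i.+1) :> {poly k}.
Proof.
rewrite [LHS]rep_y; apply/polyP => -[|j]; rewrite coef_shift coefZ !coefXn.
  by rewrite mulr0.
by rewrite eqSS; have [->|] := eqVneq j i; rewrite ?mulr0.
Qed.

(* The object O_z of QGr B is the image of M_z under the quotient functor
   Gr B -> QGr B, which is the identity on objects. *)
Definition Oz : grmod k := Mz.

End Mz.

Section Plane.
Variable R : realType.
Local Notation point := (R * R)%type.
Implicit Types (p q x : point).

(* The norm of the library on R * R is the sup norm. *)
Definition edist p q : R := Num.sqrt ((p.1 - q.1) ^+ 2 + (p.2 - q.2) ^+ 2).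

Definition plane_isometry (sigma : point -> point) : Prop :=
  forall p q, edist (sigma p) (sigma q) = edist p q.

Definition segment p q : set point :=
  [set p + a *: (q - p) | a in [set a : R | 0 <= a <= 1]].

Definition dot p q : R := p.1 * q.1 + p.2 * q.2.

(* The reflection in the line through p and q, for p <> q. *)
Definition reflect_line p q x : point :=
  (p + (dot (x - p) (q - p) / dot (q - p) (q - p)) *: (q - p)) *+ 2 - x.

Definition frontier (U : set point) : set point := closure U `\` interior U.

Definition tau : R := (1 + Num.sqrt 5) / 2.

Inductive color := Black | White.

Definition swap (c : color) : color := if c is Black then White else Black.

(* The triangles A, a, B, b are all isosceles, and in each of them exactly one
   base vertex has the color of the apex (the vertex between the equal sides).
   A tile of any level is thus recorded by its apex, the base vertex of the same
   color, the base vertex of the different color, and its size. Up to scaling,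
   with apex angles 36, 108, 108 and 36 degrees, the side lengths are
                     apex-same   apex-diff   same-diff
      A                 tau         tau          1
      a                  1           1          tau
      B                 tau         tau       1 + tau
      b = A             tau         tau          1
   Swapping black and white does not change this data, so neither the color
   exchange nor the shrinking after step (ii) needs to be performed: the level
   2j tiles are tau^j A and tau^j a, the level 2j+1 tiles tau^j B and tau^j b. *)
Record tile := Tile { small : bool; apex : point; same : point; diff : point }.

Definition hull (t : tile) : set point :=
  [set x | exists a b c : R, [/\ 0 <= a, 0 <= b, 0 <= c, a + b + c = 1 &
     x = a *: apex t + b *: same t + c *: diff t]].

Definition map_tile (f : point -> point) (t : tile) : tile :=
  Tile (small t) (f (apex t)) (f (same t)) (f (diff t)).

Definition resize (s : bool) (t : tile) : tile :=
  Tile s (apex t) (same t) (diff t).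

(* The tile of the other size with which a level n tile t is composed.
   If n is even (step (i)), an a-tile S and an A-tile L are glued along the edge
   with vertices apex S = diff L and diff S = same L.
   If n is odd (step (ii)), a b-tile S and a B-tile L are glued along the edge
   with vertices apex S = same L and same S = apex L.
   The points apex L, diff L = apex S, same S for step (i), and the points
   diff L, apex L = same S, diff S for step (ii), are collinear, since the
   angles of L and S at the middle one are 72 + 108 and 108 + 72 degrees. *)
Definition partner (n : nat) (t : tile) : tile :=
  if odd n then
    if small t then Tile false (same t) (apex t)
                      (same t + tau *: (same t - diff t))
    else Tile true (same t) (apex t) (apex t + tau^-1 *: (apex t - diff t))
  else
    if small t then Tile false (apex t + tau *: (apex t - same t))
                      (diff t) (apex t)
    else Tile true (diff t) (diff t + tau^-1 *: (diff t - apex t)) (same t).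

(* The level n+1 tile that is the union of the level n tiles L and S. *)
Definition glue (n : nat) (L S : tile) : tile :=
  if odd n then Tile false (diff L) (diff S) (apex S)
  else Tile false (same L) (apex L) (same S).

(* The level n+1 tile of size s of which the level n tile t is a part. *)
Definition compose (n : nat) (s : bool) (t : tile) : tile :=
  if s then resize true t
  else if small t then glue n (partner n t) t else glue n t (partner n t).

(* The large level n tile contained in a level n+1 tile; for a large tile,
   this inverts L |-> glue n L (partner n L). *)
Definition large_part (n : nat) (t : tile) : tile :=
  if small t then resize false t
  else if odd n then Tile false (apex t + tau^-1 *: (same t - apex t))
                       (diff t) (apex t)
  else Tile false (same t) (apex t) (same t + tau^-1 *: (diff t - same t)).

(* The level n tiles contained in a level n+1 tile *)
Definition parts (n : nat) (t : tile) : set tile :=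
  if small t then [set large_part n t]
  else [set large_part n t; partner n (large_part n t)].

Lemma tauV : tau^-1 = tau - 1.
Proof.
have s5 : Num.sqrt (5 : R) ^+ 2 = 5 by rewrite sqr_sqrtr.
have tau_gt0 : 0 < tau by rewrite divr_gt0 // ltr_pwDl // sqrtr_ge0.
apply: (mulfI (lt0r_neq0 tau_gt0)); rewrite divff ?lt0r_neq0 // /tau.
by field: s5.
Qed.

Lemma tau2 : tau ^+ 2 = tau + 1.
Proof.
have s5 : Num.sqrt (5 : R) ^+ 2 = 5 by rewrite sqr_sqrtr.
by rewrite /tau; field: s5.
Qed.

Lemma parts_compose n (s : bool) t :
  ~~ (small t && s) -> parts n (compose n s t) t.
Proof.
case: t => [b [p1 p2] [q1 q2] [r1 r2]]; rewrite /compose /=.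
case: s b => [] [] // _; rewrite /parts /large_part /glue /partner;
  case: (odd n) => /=; try (by []); [right|right|left|left];
  congr Tile; congr pair; rewrite /= ?tauV; rewrite /GRing.scale /=; ring: tau2.
Qed.

(* The level 0 tiles contained in a level n tile *)
Fixpoint level0_parts (n : nat) (t : tile) : set tile :=
  if n is m.+1 then \bigcup_(u in parts m t) level0_parts m u else [set t].

Definition t0 (s : bool) : tile :=
  if s then Tile true (0, 0) (1, 0) (cos (pi * 3 / 5), sin (pi * 3 / 5))
  else Tile false (0, 0) (tau, 0) (tau * cos (pi / 5), tau * sin (pi / 5)).

Section Tiling.
Variable z : penrose_seq.

Fixpoint tz (n : nat) : tile :=
  if n is m.+1 then compose m (z n) (tz m) else t0 (z 0%N).

Definition Uz : set point := \bigcup_n hull (tz n).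

(* The A-tiling of the plane: the level 0 tiles in the union Uz of the tz n,
   completed by reflections in the boundary lines of Uz, which are the lines
   through a nondegenerate segment contained in its frontier. (The frontier is
   empty if Uz is the plane; if Uz is a sector of angle pi/5, the two
   reflections generate a group of order 10.) *)
Inductive A_tiling : tile -> Prop :=
| A_tiling_inside n t : level0_parts n (tz n) t -> A_tiling t
| A_tiling_reflect p q t : p <> q -> segment p q `<=` frontier Uz ->
    A_tiling t -> A_tiling (map_tile (reflect_line p q) t).

Definition colored_vertices (t : tile) : set (point * color) :=
  let c := if small t then White else Black in
  [set (apex t, c); (same t, c); (diff t, swap c)].

Definition same_color_edge (p q : point) (t : tile) : Prop :=
  p <> q /\ exists c : color,
    colored_vertices t (p, c) /\ colored_vertices t (q, c).

(* The Penrose tiling T_z, as the set of its kites and darts. Since each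
   triangle has exactly one edge joining vertices of the same color, deleting
   these edges merges the triangles in pairs. *)
Definition Tz : set (set point) :=
  [set K | exists t t' : tile, [/\ A_tiling t, A_tiling t', t <> t',
     exists p q, same_color_edge p q t /\ same_color_edge p q t' &
     K = hull t `|` hull t']].

End Tiling.
End Plane.

Arguments Tz R z : clear implicits.

(* Main.v *)
From HB Require Import structures.
Require Import Defs.
From mathcomp Require Import all_boot all_order all_algebra finmap.
From mathcomp Require Import boolp classical_sets reals topology normedtype.
From mathcomp Require Import trigo ring lra.
From mathcomp Require Import -(notations) monalg.

(** The algebra. A subquotient of a graded B-module lies in Fdim B if and only
    if each of its elements is killed by all sufficiently long monomials
    ([fdim_quotP]), because B has finitely many monomials of each length and a
    finite dimensional module vanishes in high degrees. In M_z exactly one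
    monomial of each length does not kill e_i, and it sends e_i to a later basis
    vector; it spells the bits of z from z_i on ([word_basis_vector]). Hence a
    nonzero graded submodule of M_z contains all but finitely many of the e_j,
    so that its cokernel is torsion ([submodule_cofinite]), which makes O_z
    simple ([Oz_simple]). An isomorphism from O_z to O_z', given by a fraction,
    sends some e_n to a nonzero multiple of e_n, and the monomials that do not
    kill these two vectors coincide ([qisomorphic_tail_eq]). Conversely, if z and
    z' agree from m on, then M_z and M_z' have the span of the e_j with j >= m
    as a common submodule ([tail_eq_qisomorphic]).

    The geometry. If z and z' agree from m on, the level m tiles of the two
    constructions have the same size, an isometry maps one to the other, and
    everything that is built from them corresponds ([tail_eq_isometric]). For the
    converse, the sequence of bits is read off from the tiling.

    The kites and darts determine the triangles up to the mirror symmetry of each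
    quadrangle, under which the set of triangles is invariant ([mirror_tiling],
    [mate_mirror], [kite_eq]): the vertices are found as extreme points and told
    apart by their distances. Next, the level n tiling determines the level n+1
    tiling, since a large tile is composed with its partner exactly when that
    partner is in the tiling ([tilingS]). So an isometry between the tilings of
    level 0 is one between the tilings of each level ([map_tiling]). The image of
    tz n for z and, up to the reflections, tz n for z' overlap when n is large;
    then they are equal, and their sizes are the bits z_n and z'_n
    ([tail_eq_isometry]).

    All this needs that the tiles of one level do not overlap
    ([tiling_disjoint]). Inside U_z this holds by construction, and for the
    reflected copies it follows from the existence of a folding, a function that
    is invariant under the reflections and injective on U_z. To find one, the
    region U_z has to be known. Its frontier lies on supporting lines in one of
    ten directions ([supporting_line]), and a line that contains a segment of the
    frontier contains an edge of tz n for all large n ([two_on_line]). Two such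
    lines meet in a vertex of all large tiles. Following the role of such a
    vertex through the compositions shows that it is unique and repeatedly the
    apex of an acute tile ([common_apex], [common_unique]), so that there are at
    most two lines, and two of them bound a sector of angle 36 degrees. A
    half-plane is folded by squaring the distance to its boundary. In a sector,
    with complex coordinates w at its vertex, the norm of w and the real part of
    w ^ 5 are invariant under the reflections in both sides and determine w
    ([sector_inj], [folding_exists]). *)

Set Implicit Arguments.
Unset Strict Implicit.
Unset Printing Implicit Defensive.
Import Order.TTheory GRing.Theory Num.Theory.
Import numFieldNormedType.Exports.
Local Open Scope ring_scope.
Local Open Scope classical_set_scope.

Local Notation hom := Defs.hom.

(** * The monomials of B *)

Section Words.
Variable k : fieldType.
Implicit Types (w : seq bool) (a c : k) (b : B k).

(** These span [B]; those with two adjacent letters y are zero. *)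
Definition word w : B k := piB (free_term 1 (FMonom w)).

Lemma free_termM a c (u v : fmonom bool) :
  free_term a u * free_term c v = free_term (a * c) (fmmul u v).
Proof. exact: fgmulUU. Qed.

Lemma piBM (f g : free_xy k) : piB (f * g) = piB f * piB g.
Proof. exact: pi2M. Qed.

Lemma piB_sum (I : Type) (r : seq I) (F : I -> free_xy k) :
  piB (\sum_(i <- r) F i) = \sum_(i <- r) piB (F i).
Proof. exact: (raddf_sum (@pi2 (free_xy k) (free_y k * free_y k))). Qed.

Lemma word_cat u w : word (u ++ w) = word u * word w.
Proof. by rewrite -piBM free_termM mulr1 fmmulE. Qed.

Lemma word0 : word [::] = 1.
Proof. by rewrite /word -fmoneE. Qed.

Lemma scalB_word a w : scalB a * word w = piB (free_term a (FMonom w)).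
Proof. by rewrite -piBM free_termM mulr1 fmmulE fmoneE. Qed.

Lemma scalB_word_comm a w : scalB a * word w = word w * scalB a.
Proof. by rewrite scalB_word -piBM free_termM mul1r fmmulE fmoneE cats0. Qed.

Lemma scalBD a c : scalB (a + c) = scalB a + scalB c.
Proof.
rewrite /scalB /free_term monalgUD.
exact: (raddfD (@pi2 (free_xy k) (free_y k * free_y k))).
Qed.

Lemma scalB0 : scalB (0 : k) = 0.
Proof.
rewrite /scalB /free_term monalgU0.
exact: (raddf0 (@pi2 (free_xy k) (free_y k * free_y k))).
Qed.

Lemma scalB1 : scalB (1 : k) = 1.
Proof. by rewrite -word0 /word -fmoneE. Qed.

Lemma scalBM a c : scalB (a * c) = scalB a * scalB c.
Proof. by rewrite -piBM free_termM fmmulE fmoneE /scalB fmoneE. Qed.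

Lemma piBE (f : free_xy k) :
  piB f = \sum_(u <- msupp f) scalB (mcoeff u f) * word u.
Proof.
rewrite {1}[f]monalgE piB_sum; apply: eq_bigr => u _.
by rewrite scalB_word; congr (piB (free_term _ _)); case: u.
Qed.

Lemma degB_word w : degB (size w) (word w).
Proof.
exists (free_term 1 (FMonom w)) => // u; rewrite mcoeffU.
by have [<-|] := eqVneq (FMonom w) u; rewrite ?mulr0n ?eqxx // fdegE.
Qed.

Lemma degB_scalB a : degB 0 (scalB a).
Proof.
exists (free_term a (fmone bool)) => // u; rewrite mcoeffU.
by have [<-|] := eqVneq (fmone bool) u; rewrite ?mulr0n ?eqxx // fdegE fmoneE.
Qed.

Lemma degB_scalB_word a w : degB (size w) (scalB a * word w).
Proof.
rewrite scalB_word; exists (free_term a (FMonom w)) => // u; rewrite mcoeffU.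
by have [<-|] := eqVneq (FMonom w) u; rewrite ?mulr0n ?eqxx // fdegE.
Qed.

Lemma B_span b : exists (s : seq (seq bool)) (c : seq bool -> k),
  b = \sum_(w <- s) scalB (c w) * word w.
Proof.
exists [seq fmonom_val u | u <- enum_fset (msupp (repr2 b : free_xy k))],
  (fun w => mcoeff (FMonom w) (repr2 b : free_xy k)).
rewrite -[LHS]repr2K -[LHS]/(piB _) piBE big_map; apply: eq_bigr => u _.
by have -> : FMonom (fmonom_val u) = u by case: u.
Qed.

End Words.

(** * Graded modules and torsion *)

Section Components.
Variables (k : fieldType) (M : grmod k).
Implicit Types (u v x : M) (i j d : int) (w : seq bool) (a : k) (b : B k).

Lemma hom_scal i a v : hom i v -> hom i (scalB a *: v).
Proof. by move=> h; rewrite -[i]addr0; exact: hom_act (degB_scalB a) h. Qed.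

Lemma hom_word i w v : hom i v -> hom (i + (size w)%:Z) (word k w *: v).
Proof. exact: hom_act (degB_word k w). Qed.

Definition decomposition v (s : seq int) (c : int -> M) :=
  [/\ uniq s, forall i, hom i (c i), forall i, i \notin s -> c i = 0 &
      v = \sum_(i <- s) c i].

Lemma decomposition_widen v s c s' : decomposition v s c -> uniq s' ->
  {subset s <= s'} -> decomposition v s' c.
Proof.
move=> [us hc c0 ->] us' sub; split=> //.
  by move=> i hi; apply: c0; apply: contra hi => /sub.
rewrite [RHS](bigID (mem s)) /= [X in _ + X]big1 ?addr0; last first.
  by move=> i; exact: c0.
rewrite -[RHS]big_filter; apply: perm_big; apply: uniq_perm => //.
  exact: filter_uniq.
by move=> i; rewrite mem_filter; apply/idP/andP => [hi|[]//]; split=> //; exact: sub.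
Qed.

Lemma decompositionB u v s c s' c' : decomposition u s c -> decomposition v s' c' ->
  exists s'', decomposition (u - v) s'' (fun i => c i - c' i).
Proof.
move=> du dv; exists (undup (s ++ s')).
have us := undup_uniq (s ++ s').
have [_ h1 z1 ->] := decomposition_widen du us
  (fun i hi => etrans (mem_undup _ _) (etrans (mem_cat _ _ _) (introT orP (or_introl hi)))).
have [_ h2 z2 ->] := decomposition_widen dv us
  (fun i hi => etrans (mem_undup _ _) (etrans (mem_cat _ _ _) (introT orP (or_intror hi)))).
split=> //; first by move=> i; exact: homB.
  by move=> i hi; rewrite z1 ?z2 ?subr0.
by rewrite sumrB.
Qed.

Lemma decomposition_hom i v : hom i v ->
  decomposition v [:: i] (fun j => if j == i then v else 0).
Proof.
move=> hv; split=> //.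
- by move=> j; case: eqP => [->|_] //; exact: hom0.
- by move=> j; rewrite inE => /negbTE ->.
by rewrite big_seq1 eqxx.
Qed.

Lemma decomposition0 : decomposition 0 [::] (fun=> 0).
Proof. by split=> //; [move=> i; exact: hom0|rewrite big_nil]. Qed.

Lemma decomposition_exists v : exists s c, decomposition v s c.
Proof.
have [s [c [hc ->]]] := hom_gen v.
elim: s => [|i s [s' [c' IH]]].
  by exists [::], (fun=> 0); rewrite big_nil; exact: decomposition0.
have [s1 d1] := decompositionB decomposition0 (decomposition_hom (hc i)).
have [s2 d2] := decompositionB IH d1.
exists s2, (fun j => c' j - (0 - (if j == i then c i else 0))).
suff -> : \sum_(j <- i :: s) c j = \sum_(j <- s) c j - (0 - c i) by [].
by rewrite big_cons sub0r opprK addrC.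
Qed.

Lemma decomposition_unique v s c s' c' :
  decomposition v s c -> decomposition v s' c' -> c =1 c'.
Proof.
move=> d1 d2 i; have [s'' [us h z e]] := decompositionB d1 d2.
apply/eqP; rewrite -subr_eq0; apply/eqP.
have [hi|/z//] := boolP (i \in s''); apply: (hom_free us h _ hi).
by rewrite -e subrr.
Qed.

Definition component i v : M := projT1 (cid (projT2 (cid (decomposition_exists v)))) i.

Lemma componentP v : exists s, decomposition v s (fun i => component i v).
Proof.
exists (projT1 (cid (decomposition_exists v))).
exact: projT2 (cid (projT2 (cid (decomposition_exists v)))).
Qed.

Lemma componentE v s c i : decomposition v s c -> component i v = c i.
Proof. by move=> d; have [s' d'] := componentP v; exact: (decomposition_unique d' d i). Qed.

Lemma component_hom i v : hom i (component i v).
Proof. by have [s []] := componentP v. Qed.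

Lemma componentB i u v : component i (u - v) = component i u - component i v.
Proof.
have [s d1] := componentP u; have [s' d2] := componentP v.
by have [s'' d] := decompositionB d1 d2; rewrite (componentE i d).
Qed.

Lemma component0 i : component i 0 = 0.
Proof. by rewrite (componentE i decomposition0). Qed.

Lemma componentD i u v : component i (u + v) = component i u + component i v.
Proof.
have -> : u + v = u - (0 - v) by rewrite sub0r opprK.
by rewrite !componentB component0 sub0r opprK.
Qed.

Lemma component_sum i (I : Type) (r : seq I) (F : I -> M) :
  component i (\sum_(j <- r) F j) = \sum_(j <- r) component i (F j).
Proof.
elim: r => [|j r IH]; first by rewrite !big_nil component0.
by rewrite !big_cons componentD IH.
Qed.

Lemma component_homE i j v : hom i v -> component j v = if j == i then v else 0.
Proof. by move=> /decomposition_hom/(componentE j). Qed.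

Lemma component_scal i a v : component i (scalB a *: v) = scalB a *: component i v.
Proof.
have [s [us h z e]] := componentP v.
have d : decomposition (scalB a *: v) s (fun i => scalB a *: component i v).
  split=> //; first by move=> j; exact: hom_scal.
    by move=> j /z ->; rewrite scaler0.
  by rewrite {1}e scaler_sumr.
exact: componentE d.
Qed.

Lemma component_sumE v : exists2 s, uniq s &
  v = \sum_(i <- s) component i v /\ forall i, i \notin s -> component i v = 0.
Proof. by have [s [us h z e]] := componentP v; exists s. Qed.

Lemma grsubmodD (N : set M) u v : grsubmod N -> N u -> N v -> N (u + v).
Proof.
move=> [n0 nB _ _] hu hv; have -> : u + v = u - (0 - v) by rewrite sub0r opprK.
by apply: (nB) => //; apply: nB.
Qed.

Lemma grsubmod_sum (N : set M) (I : eqType) (r : seq I) (F : I -> M) : grsubmod N ->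
  (forall e, e \in r -> N (F e)) -> N (\sum_(e <- r) F e).
Proof.
move=> hN; elim: r => [|e r IH] h; first by rewrite big_nil; case: hN.
rewrite big_cons; apply: grsubmodD => //; first by apply: h; rewrite inE eqxx.
by apply: IH => e' he'; apply: h; rewrite inE he' orbT.
Qed.

Lemma grsubmod_component (N : set M) i v : grsubmod N -> N v -> N (component i v).
Proof.
move=> hN; have [n0 _ _ ng] := hN => /ng[s [c [hc ->]]].
rewrite component_sum; apply: grsubmod_sum => // j _.
by rewrite (component_homE _ (hc j).1); case: eqP => // _; case: (hc j).
Qed.

Lemma grsubmodP (N : set M) : N 0 -> (forall u v, N u -> N v -> N (u - v)) ->
  (forall b v, N v -> N (b *: v)) -> (forall i v, N v -> N (component i v)) ->
  grsubmod N.
Proof.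
move=> n0 nB nZ nc; split=> // v hv; have [s [us h z e]] := componentP v.
by exists s, (component^~ v); split=> // i; split; [exact: component_hom|exact: nc].
Qed.

(** The criterion for the class of [v] modulo [Q] to lie in a finite dimensional
    submodule; see [fdim_quotP]. *)
Definition word_torsion (Q : set M) v :=
  exists n : nat, forall w, (n <= size w)%N -> Q (word k w *: v).

(** There are finitely many monomials of length [n], so that a common bound
    exists. *)
Lemma word_torsion_uniform (Q : set M) v n :
  (forall w, size w = n -> word_torsion Q (word k w *: v)) -> word_torsion Q v.
Proof.
move=> h; have [m hm] : exists m, forall w, size w = n ->
    forall w', (m <= size w')%N -> Q (word k w' *: (word k w *: v)).
  elim: n v h => [|n IH] v h.
    have [m hm] := h [::] erefl; exists m => w /size0nil ->; exact: hm.
  have step c : exists m, forall w, size w = n -> forall w', (m <= size w')%N ->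
      Q (word k w' *: (word k w *: (word k [:: c] *: v))).
    by apply: IH => w sw; rewrite scalerA -word_cat; apply: h; rewrite size_cat sw addn1.
  have [m1 h1] := step false; have [m2 h2] := step true.
  exists (maxn m1 m2) => w; case/lastP: w => // w c; rewrite size_rcons => -[sw] w'.
  rewrite geq_max -cats1 word_cat -[_ * _ *: v]scalerA => /andP[g1 g2].
  by case: c; [apply: h2|apply: h1].
exists (m + n)%N => w hw.
rewrite -(cat_take_drop (size w - n) w) word_cat -scalerA; apply: hm.
  by rewrite size_drop subKn // (leq_trans _ hw) // leq_addl.
by rewrite size_takel ?leq_subr // leq_subRL ?(leq_trans _ hw) ?leq_addl // addnC.
Qed.

End Components.

Section Torsion.
Variables (k : fieldType) (M : grmod k).
Implicit Types (u v x : M) (i j d : int) (w : seq bool) (a : k) (b : B k).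
Implicit Types (P Q L : set M).

(** The components of finitely many generators have finitely many degrees. *)
Lemma findim_quot_bounded Q L : grsubmod Q -> findim_quot Q L ->
  exists d, forall i v, d <= i -> L v -> hom i v -> Q v.
Proof.
move=> hQ [s [sL hs]].
have [d hd] : exists d, forall u, u \in s -> forall i, d <= i -> component i u = 0.
  elim: s {sL hs} => [|u s [d hd]]; first by exists 0.
  have [r ur [_ r0]] := component_sumE u.
  have [d' hd'] : exists d', forall i, i \in r -> i < d'.
    elim: r {ur r0} => [|i r [d' hd']]; first by exists 0.
    exists (Num.max d' (i + 1)) => j; rewrite inE lt_max => /predU1P[->|/hd' ->] //.
    by rewrite ltrDl ltr01 orbT.
  exists (Num.max d d') => u'; rewrite inE => /predU1P[-> i|hu' i]; rewrite ge_max => /andP[h1 h2].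
    by apply: r0; apply/negP => /hd'; rewrite ltNge h2.
  exact: hd.
exists d => i v di Lv hv; have [a ha] := hs v Lv.
have := grsubmod_component i hQ ha; rewrite componentB (component_homE _ hv) eqxx.
rewrite component_sum big1_seq ?subr0 // => u /andP[_ us].
by rewrite component_scal hd ?scaler0.
Qed.

(** Long monomials send an element of a finite dimensional quotient to degrees
    where this quotient vanishes. Conversely, if all monomials of length at least
    [n] kill an element, its images under the finitely many shorter ones span
    the submodule that it generates. *)
Lemma fdim_quotP Q P : grsubmod Q -> grsubmod P -> Q `<=` P ->
  fdim_quot Q P <-> forall v, P v -> word_torsion Q v.
Proof.
move=> hQ hP QP; have [Q0 QB QZ _] := hQ; split=> H v Pv.
  have [L [hL QL LP Lv fin]] := H v Pv.
  have [d hd] := findim_quot_bounded hQ fin.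
  have [r ur [ev r0]] := component_sumE v.
  have [n hn] : exists n : nat, forall i, i \in r -> d <= i + n%:Z.
    elim: r {ur ev r0} => [|i r [n hn]]; first by exists 0%N.
    exists (maxn n `|d - i|%N) => j; rewrite inE => /predU1P[->|/hn h].
      rewrite -lerBlDl (le_trans (ler_norm _)) // -abszE lez_nat leq_maxr //.
    by rewrite (le_trans h) // lerD2l lez_nat leq_maxl.
  exists n => w hw; rewrite ev scaler_sumr; apply: grsubmod_sum => // i ir.
  have [_ _ LZ _] := hL.
  apply: (hd (i + (size w)%:Z)).
  - by rewrite (le_trans (hn i ir)) // lerD2l lez_nat.
  - by apply: LZ; exact: grsubmod_component.
  - by apply: hom_word; exact: component_hom.
have [r ur [ev r0]] := component_sumE v.
have [n hn] : exists n, forall i, i \in r -> forall w, (n <= size w)%N ->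
    Q (word k w *: component i v).
  elim: r {ur ev r0} => [|i r [n hn]]; first by exists 0%N.
  have [m hm] := H _ (grsubmod_component i hP Pv).
  exists (maxn n m) => j; rewrite inE => /predU1P[->|/hn h] w; rewrite geq_max => /andP[h1 h2].
    exact: hm.
  exact: h.
pose L : set M := [set x | exists2 q, Q q & exists b : int -> B k,
  x = q + \sum_(i <- r) b i *: component i v].
have LD u x : L u -> L x -> L (u - x).
  move=> [q hq [b ->]] [q' hq' [b' ->]]; exists (q - q'); first exact: QB.
  exists (fun i => b i - b' i); rewrite opprD addrACA; congr (_ + _).
  by rewrite -sumrB; apply: eq_bigr => i _; rewrite scalerBl.
have QL : Q `<=` L.
  by move=> q hq; exists q => //; exists (fun=> 0); rewrite big1 ?addr0 // => i _; rewrite scale0r.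
have L0 : L 0 by exact: QL.
have LA u x : L u -> L x -> L (u + x).
  move=> hu hx; have -> : u + x = u - (0 - x) by rewrite sub0r opprK.
  by apply: (LD) => //; apply: LD.
have Lsum (I : eqType) (s : seq I) (F : I -> M) : (forall e, e \in s -> L (F e)) ->
    L (\sum_(e <- s) F e).
  elim: s => [|e s IH] h; first by rewrite big_nil.
  rewrite big_cons; apply: LA; first by apply: h; rewrite inE eqxx.
  by apply: IH => e' he'; apply: h; rewrite inE he' orbT.
have Lgen i b : i \in r -> L (b *: component i v).
  move=> ir; exists 0 => //; exists (fun j => if j == i then b else 0).
  rewrite add0r (bigD1_seq i) //= eqxx big1 ?addr0 // => j /negbTE ->.
  by rewrite scale0r.
have hL : grsubmod L.
  apply: grsubmodP => //.
    move=> b _ [q hq [b' ->]]; exists (b *: q); first exact: QZ.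
    exists (fun i => b * b' i); rewrite scalerDr scaler_sumr; congr (_ + _).
    by apply: eq_bigr => i _; rewrite scalerA.
  move=> j _ [q hq [b ->]]; rewrite componentD component_sum; apply: LA.
    by apply: QL; exact: grsubmod_component.
  apply: (Lsum) => i ir; have [s [c ->]] := B_span (b i).
  rewrite scaler_suml component_sum; apply: Lsum => w _.
  rewrite (component_homE _ (hom_act (degB_scalB_word (c w) w) (component_hom i v))).
  by case: eqP => // _; exact: Lgen.
exists L; split=> //.
- move=> _ [q hq [b ->]]; apply: grsubmodD => //; first exact: QP.
  apply: grsubmod_sum => // i _; have [_ _ PZ _] := hP; apply: PZ.
  exact: grsubmod_component.
- by rewrite ev; apply: Lsum => i ir; rewrite -[component i v]scale1r; exact: Lgen.
pose words := flatten [seq [seq tval t | t <- enum {: m.-tuple bool}] | m <- iota 0 n].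
have wordsP w : (size w < n)%N -> w \in words.
  move=> hw; apply/flatten_mapP; exists (size w); first by rewrite mem_iota.
  by apply/mapP; exists (in_tuple w); rewrite ?mem_enum.
pose S := undup [seq word k w *: component i v | w <- words, i <- r].
exists S; split.
  move=> u; rewrite mem_undup => /allpairsP[[w i] /= [_ ir ->]].
  exact: Lgen.
pose span x := exists a : M -> k, Q (x - \sum_(u <- S) scalB (a u) *: u).
have spanD x y : span x -> span y -> span (x + y).
  move=> [a ha] [a' ha']; exists (fun u => a u + a' u).
  have -> : \sum_(u <- S) scalB (a u + a' u) *: u =
      \sum_(u <- S) scalB (a u) *: u + \sum_(u <- S) scalB (a' u) *: u.
    by rewrite -big_split /=; apply: eq_bigr => u _; rewrite scalBD scalerDl.
  have -> (s t : M) : x + y - (s + t) = (x - s) + (y - t) by rewrite opprD addrACA.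
  exact: grsubmodD.
have spanQ x : Q x -> span x.
  by move=> hx; exists (fun=> 0); rewrite big1 ?subr0 // => u _; rewrite scalB0 scale0r.
have spanS a u : u \in S -> span (scalB a *: u).
  move=> uS; exists (fun u' => if u' == u then a else 0).
  rewrite (bigD1_seq u) ?undup_uniq //= eqxx big1 ?addr0 ?subrr // => u' /negbTE ->.
  by rewrite scalB0 scale0r.
have spansum (I : eqType) (s : seq I) (F : I -> M) : (forall e, e \in s -> span (F e)) ->
    span (\sum_(e <- s) F e).
  elim: s => [|e s IH] h; first by rewrite big_nil; exact: spanQ.
  rewrite big_cons; apply: spanD; first by apply: h; rewrite inE eqxx.
  by apply: IH => e' he'; apply: h; rewrite inE he' orbT.
move=> _ [q hq [b ->]]; apply: spanD; first exact: spanQ.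
apply: (spansum) => i ir; have [s [c ->]] := B_span (b i).
rewrite scaler_suml; apply: spansum => w _; rewrite -scalerA.
have [hw|hw] := ltnP (size w) n; last by apply: spanQ; apply: QZ; exact: hn.
by apply: spanS; rewrite mem_undup; apply: allpairs_f => //; exact: wordsP.
Qed.

End Torsion.

Section Homs.
Variable k : fieldType.
Implicit Types M N : grmod k.

Lemma grhom0 M N (f : grhom M N) : f 0 = 0.
Proof. exact: raddf0. Qed.
Lemma grhomB M N (f : grhom M N) u v : f (u - v) = f u - f v.
Proof. exact: raddfB. Qed.
Lemma grhomZ M N (f : grhom M N) b v : f (b *: v) = b *: f v.
Proof. exact: linearZ. Qed.
Lemma grhom_sum M N (f : grhom M N) (I : Type) (r : seq I) (F : I -> M) :
  f (\sum_(i <- r) F i) = \sum_(i <- r) f (F i).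
Proof. exact: raddf_sum. Qed.

Lemma component_grhom M N (f : grhom M N) i v :
  component i (f v) = f (component i v).
Proof.
have [s us [ev z]] := component_sumE v.
rewrite {1}ev grhom_sum component_sum.
rewrite (eq_bigr (fun j => if i == j then f (component i v) else 0)); last first.
  move=> j _; rewrite (component_homE _ (grhom_deg f (component_hom j v))).
  by case: eqP => [->|].
have [is_|nis] := boolP (i \in s).
  by rewrite (bigD1_seq i) //= eqxx big1 ?addr0 // => j /negbTE; rewrite eq_sym => ->.
by rewrite z // grhom0 big1 // => j _; case: ifP.
Qed.

Lemma grsubmod_kernel M N (f : grhom M N) : grsubmod [set v | f v = 0].
Proof.
apply: grsubmodP => /=; first exact: grhom0.
- by move=> u v /= hu hv; rewrite grhomB hu hv subrr.
- by move=> b v /= hv; rewrite grhomZ hv scaler0.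
- by move=> i v /= hv; rewrite -component_grhom hv component0.
Qed.

Lemma grsubmod_range M N (f : grhom M N) : grsubmod (range f).
Proof.
apply: grsubmodP => /=; first by exists 0 => //; exact: grhom0.
- by move=> _ _ [u _ <-] [v _ <-]; exists (u - v) => //; exact: grhomB.
- by move=> b _ [v _ <-]; exists (b *: v) => //; exact: grhomZ.
- by move=> i _ [v _ <-]; exists (component i v) => //; rewrite component_grhom.
Qed.

Lemma fdim_isoP M N (f : grhom M N) : fdim_iso f <->
  (forall v, f v = 0 -> word_torsion [set 0] v) /\
  (forall v, word_torsion (range f) v).
Proof.
have s0 : [set (0 : M)] `<=` [set v | f v = 0].
  by move=> _ ->; exact: grhom0.
have E1 := fdim_quotP (grsubmod0 M) (grsubmod_kernel f) s0.
have sT : range f `<=` [set: N] by [].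
have E2 := fdim_quotP (grsubmod_range f) (grsubmodT N) sT.
split=> [[/E1 h1 /E2 h2]|[h1 h2]]; split=> //; first by move=> v; exact: h2.
  exact/E1.
by apply/E2 => v _; exact: h2.
Qed.

Lemma word_torsionS M (P Q : set M) v : P `<=` Q -> word_torsion P v -> word_torsion Q v.
Proof. by move=> PQ [n h]; exists n => w /h/PQ. Qed.

Lemma fdim_iso_comp L M N (g : grhom M N) (f : grhom L M) :
  fdim_iso g -> fdim_iso f -> fdim_iso (grhom_comp g f).
Proof.
move=> /fdim_isoP[kg cg] /fdim_isoP[kf cf]; apply/fdim_isoP; split=> v.
  move=> /= /kg[n hn]; apply: (@word_torsion_uniform _ _ _ _ n) => w sw.
  by apply: kf; rewrite grhomZ hn ?sw.
have [n hn] := cg v; apply: (@word_torsion_uniform _ _ _ _ n) => w sw.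
have [u _ <-] := hn w (eq_leq (esym sw)); have [m hm] := cf u.
exists m => w' /hm[x _ e]; exists x => //=.
by rewrite e grhomZ.
Qed.

End Homs.

(** * Graded submodules and fractions *)

Section Submodule.
Variables (k : fieldType) (M : grmod k) (N : set M).
Hypothesis hN : grsubmod N.

Definition submodule_pred : {pred M} := let _ := hN in fun v => `[< N v >].

Lemma submodule_predP v : reflect (N v) (v \in submodule_pred).
Proof. exact: asboolP. Qed.

Lemma submodule_closed : submod_closed submodule_pred.
Proof.
have [n0 nB nZ _] := hN; split; first exact/submodule_predP.
move=> b u v /submodule_predP hu /submodule_predP hv; apply/submodule_predP.
by apply: grsubmodD => //; exact: nZ.
Qed.

HB.instance Definition _ :=
  GRing.isSubmodClosed.Build (B k) M submodule_pred submodule_closed.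

Record submodule := Submodule {
  submodule_val :> M; _ : submodule_val \in submodule_pred }.

HB.instance Definition _ := [isSub for submodule_val].
HB.instance Definition _ := [Choice of submodule by <:].
HB.instance Definition _ := [SubChoice_isSubLmodule of submodule by <:].

End Submodule.

Section SubmoduleGraded.
Variables (k : fieldType) (M : grmod k) (N : set M).
Hypothesis hN : grsubmod N.
Local Notation sub := (submodule hN).

Definition submodule_hom (i : int) : set sub := [set v | hom i (submodule_val v)].

Lemma submodule_hom0 i : submodule_hom i 0.
Proof. exact: hom0. Qed.

Lemma submodule_homB i u v :
  submodule_hom i u -> submodule_hom i v -> submodule_hom i (u - v).
Proof. exact: homB. Qed.

Lemma submodule_hom_act (d : nat) i b v :
  degB d b -> submodule_hom i v -> submodule_hom (i + d%:Z) (b *: v).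
Proof. exact: hom_act. Qed.

Lemma submodule_valN (v : sub) : N (submodule_val v).
Proof. by case: v => v /= /submodule_predP. Qed.

Definition in_submodule v (hv : N v) : sub := Submodule (introT (submodule_predP hN v) hv).

Lemma submodule_val_sum (I : Type) (r : seq I) (F : I -> sub) :
  submodule_val (\sum_(i <- r) F i) = \sum_(i <- r) submodule_val (F i).
Proof.
elim: r => [|i r IH]; first by rewrite !big_nil.
by rewrite !big_cons -IH.
Qed.

Lemma submodule_val_inj : injective (@submodule_val k M N hN).
Proof. exact: val_inj. Qed.

Lemma submodule_hom_gen v : exists (s : seq int) (c : int -> sub),
  (forall i, submodule_hom i (c i)) /\ v = \sum_(i <- s) c i.
Proof.
have [s us [ev _]] := component_sumE (submodule_val v).
exists s, (fun i => in_submodule (grsubmod_component i hN (submodule_valN v))).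
split; first by move=> i; exact: component_hom.
by apply: submodule_val_inj; rewrite submodule_val_sum.
Qed.

Lemma submodule_hom_free (s : seq int) (c : int -> sub) : uniq s ->
  (forall i, submodule_hom i (c i)) -> \sum_(i <- s) c i = 0 ->
  forall i, i \in s -> c i = 0.
Proof.
move=> us hc s0 i si; apply: submodule_val_inj.
apply: (@hom_free _ M s (fun i => submodule_val (c i)) us hc _ i si).
by rewrite -submodule_val_sum s0.
Qed.

Definition graded_submodule : grmod k := GrMod submodule_hom0 submodule_homB
  submodule_hom_act submodule_hom_gen submodule_hom_free.

Lemma submodule_val_linear : linear (@submodule_val k M N hN).
Proof. by []. Qed.

HB.instance Definition _ := GRing.isLinear.Build (B k) sub M *:%R
  (@submodule_val k M N hN) submodule_val_linear.

Definition submodule_inclusion : grhom graded_submodule M :=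
  @GrHom k graded_submodule M (@submodule_val k M N hN : {linear sub -> M}) (fun _ _ h => h).

Lemma submodule_inclusion_iso : (forall v, word_torsion N v) ->
  fdim_iso submodule_inclusion.
Proof.
move=> tor; apply/fdim_isoP; split=> v.
  move=> v0; exists 0%N => w _; have -> : v = 0 by exact: submodule_val_inj.
  by rewrite /= scaler0.
have [n hn] := tor v; exists n => w /hn hw.
by exists (in_submodule hw).
Qed.

End SubmoduleGraded.

Section Roofs.
Variable k : fieldType.
Implicit Types M N : grmod k.

Definition grhom_zero M N : grhom M N :=
  @GrHom k M N (\0 : {linear M -> N}) (fun i _ _ => hom0 N i).

Definition qhom_zero M N : qhom M N := QHom (grhom_zero M N) (fdim_iso_id M).

(** The inverse is the transposed fraction. *)
Lemma roof_isomorphism M N T (l : grhom T M) (r : grhom T N) (lP : fdim_iso l) :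
  fdim_iso r -> qisomorphism (QHom r lP).
Proof.
move=> rP; exists (QHom l rP); split.
  exists T, (grhom_id T), (grhom_id T), lP; split=> //.
  by exists T, l, (grhom_id T); split.
exists T, (grhom_id T), (grhom_id T), rP; split=> //.
by exists T, r, (grhom_id T); split.
Qed.

Definition torsion N := forall v : N, word_torsion [set 0] v.

Lemma torsion_zero_iso M N : torsion M -> torsion N -> fdim_iso (grhom_zero M N).
Proof.
move=> tM tN; apply/fdim_isoP; split=> v; first by move=> _; exact: tM.
by apply: word_torsionS (tN v) => _ ->; exists 0.
Qed.

(** Every fraction that starts or ends at [N] is equal to the zero fraction: in
    the second case, restrict it to the kernel of its right leg. *)
Lemma torsion_qzero N : torsion N -> qzero N.
Proof.
move=> tN N'; split.
  exists (qhom_zero N N') => G; exists N, (grhom_zero N N), (grhom_zero N (top G)).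
  split; first exact: (torsion_zero_iso tN tN).
  - by move=> x /=; rewrite grhom0.
  - by move=> x /=; rewrite grhom0.
exists (qhom_zero N' N) => G; pose K := graded_submodule (grsubmod_kernel (right_leg G)).
pose i : grhom K (top G) := submodule_inclusion (grsubmod_kernel (right_leg G)).
exists K, (grhom_comp (left_leg G) i), i; split=> //.
  apply: (fdim_iso_comp (left_legP G)); apply: submodule_inclusion_iso => v.
  have [n hn] := tN (right_leg G v); exists n => w /hn.
  by rewrite -grhomZ.
by move=> x /=; rewrite (submodule_valN x).
Qed.

(** The identity and the zero endomorphism of [N] have the same composite with
    [F], so that they are equal. *)
Lemma qmono_zero N M (F : qhom N M) : qmono F ->
  (forall t, right_leg F t = 0) -> torsion N.
Proof.
move=> mono r0.
have lP := left_legP F.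
have c1 : qcomp (qhom_id N) F F.
  exists (top F), (left_leg F), (grhom_id (top F)), lP; split=> //.
  by exists (top F), (grhom_id _), (grhom_id _).
have c2 : qcomp (qhom_zero N N) F F.
  exists N, (grhom_id N), (grhom_zero N (top F)), (fdim_iso_id N); split.
    by move=> x /=; rewrite grhom0.
  exists (top F), (grhom_id _), (left_leg F); split=> // x /=.
  by rewrite r0 grhom0.
have [T [u [v [uP e1 e2]]]] := mono _ _ _ _ c1 c2.
have [_ cu] := (fdim_isoP _).1 uP.
by move=> x; apply: word_torsionS (cu x) => _ [t _ <-]; exact: e2.
Qed.

(** The inclusion of the kernel and the zero map have the same composite with
    [F], so that they are equal. *)
Lemma qmono_kernel N M (F : qhom N M) : qmono F ->
  forall t, right_leg F t = 0 -> word_torsion [set 0] t.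
Proof.
move=> mono t rt; have hK := grsubmod_kernel (right_leg F).
pose K := graded_submodule hK; pose i : grhom K (top F) := submodule_inclusion hK.
pose G := QHom (grhom_comp (left_leg F) i) (fdim_iso_id K).
pose H := qhom_zero K M.
have c1 : qcomp G F H.
  exists K, (grhom_id K), i, (fdim_iso_id K); split=> //.
  exists K, (grhom_id K), (grhom_id K); split=> //; first exact: fdim_iso_id.
  by move=> x /=; rewrite (submodule_valN x).
have c2 : qcomp (qhom_zero K N) F H.
  exists K, (grhom_id K), (grhom_zero K (top F)), (fdim_iso_id K); split.
    by move=> x /=; rewrite grhom0.
  exists K, (grhom_id K), (grhom_id K); split=> //; first exact: fdim_iso_id.
  by move=> x /=; rewrite grhom0.
have [T [u [v [uP e1 e2]]]] := mono _ _ _ _ c1 c2.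
have [_ cu] := (fdim_isoP _).1 uP.
have [kl _] := (fdim_isoP _).1 (left_legP F).
have [n hn] := cu (in_submodule hK rt).
apply: (@word_torsion_uniform _ _ _ _ n) => w sw.
have [x _ ex] := hn w (eq_leq (esym sw)).
apply: kl; have := e2 x; rewrite /= => <-.
congr (left_leg F _).
exact: (esym (congr1 (@submodule_val _ _ _ hK) ex)).
Qed.

End Roofs.

(** * The objects O_z *)

Section Monomials.
Variables (k : fieldType) (z : penrose_seq).
Local Notation M := (Mz k z).

(** The vector [e_i] of [M_z] *)
Definition basis_vector (i : nat) : M := 'X^i : {poly k}.

(** The only monomial of length [n] that does not kill [e_i]: its letters, read
    from right to left, are the bits of [z] from [z_i] on. *)
Fixpoint spell (i n : nat) : seq bool :=
  if n is m.+1 then z (i + m)%N :: spell i m else [::].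

Lemma size_spell i n : size (spell i n) = n.
Proof. by elim: n => //= n ->. Qed.

Lemma word_cons c w : word k (c :: w) = (if c then yB k else xB k) * word k w.
Proof.
rewrite -cat1s word_cat; congr (_ * _).
by rewrite /word -fmuE; case: c.
Qed.

(** The bit [z_i] tells which of x and y sends [e_i] to [e_(i+1)]; the other one
    kills it. *)
Lemma letter_basis_vector c i : (if c then yB k else xB k) *: basis_vector i =
  if c == z i then basis_vector i.+1 else 0.
Proof.
rewrite /basis_vector; case: c; [rewrite [LHS]Mz_yE|rewrite [LHS]Mz_xE]; case: (z i) => /=.
- by rewrite scale1r.
- by rewrite scale0r.
- by rewrite subrr scale0r.
- by rewrite subr0 scale1r.
Qed.

Lemma word_basis_vector w i : word k w *: basis_vector i =
  if w == spell i (size w) then basis_vector (i + size w)%N else 0.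
Proof.
elim: w => [|c w IH] /=; first by rewrite word0 scale1r addn0.
rewrite word_cons -scalerA IH eqseq_cons.
case: (w == _); last by rewrite scaler0 andbF.
by rewrite letter_basis_vector addnS andbT.
Qed.

Lemma word_spell i n : word k (spell i n) *: basis_vector i = basis_vector (i + n).
Proof. by rewrite word_basis_vector size_spell eqxx. Qed.

Lemma basis_vector_neq0 i : basis_vector i <> 0.
Proof.
by move=> /(congr1 (fun p : {poly k} => p`_i))/eqP; rewrite coefXn eqxx coef0 oner_eq0.
Qed.

Lemma hom_basis_vector i : hom i%:Z (basis_vector i).
Proof.
move=> j; rewrite coefXn; have [->//|] := eqVneq j i.
by rewrite eqxx.
Qed.

(** The [e_i] have distinct degrees. *)
Lemma homogeneous_basis_vector (j : int) (v : M) : hom j v -> v <> 0 ->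
  exists i (c : k), [/\ c != 0, j = i%:Z & v = scalB c *: basis_vector i].
Proof.
move=> hv v0; pose p : {poly k} := v.
have p0 : p != 0 by apply/eqP.
exists (size p).-1, (lead_coef p); split; first by rewrite lead_coef_eq0.
  by apply/esym/hv; rewrite -/(lead_coef _) lead_coef_eq0.
rewrite [RHS]rep_scal; apply/polyP => n; rewrite coefZ coefXn.
have [->|ne] := eqVneq n; first by rewrite mulr1.
rewrite mulr0; apply/eqP/negPn/negP => /hv nj; case/eqP: ne.
have /hv : p`_(size p).-1 != 0 by rewrite -/(lead_coef _) lead_coef_eq0.
by rewrite -nj => -[].
Qed.

Lemma not_torsion_basis_vector i : ~ word_torsion [set 0] (basis_vector i).
Proof.
move=> [n /(_ (spell i n))]; rewrite size_spell leqnn => /(_ isT).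
by rewrite /= word_spell; exact: basis_vector_neq0.
Qed.

(** A nonzero graded submodule of [M_z] contains all [e_i] with [i] large, hence
    all [word w *: v] with [w] long. *)
Lemma submodule_cofinite (N : set M) i : grsubmod N -> N (basis_vector i) ->
  forall v, word_torsion N v.
Proof.
move=> hN Ni v; have [n0 _ nZ _] := hN.
have Nj j : (i <= j)%N -> N (basis_vector j).
  by move=> /subnKC <-; rewrite -word_spell; exact: nZ.
have [s us [-> _]] := component_sumE v; exists i => w sw.
rewrite scaler_sumr; apply: grsubmod_sum => // j _.
have [->|/eqP cj] := eqVneq (component j v) 0; first by rewrite scaler0.
have [m [c [_ _ ->]]] := homogeneous_basis_vector (component_hom j v) cj.
rewrite scalerA -scalB_word_comm -scalerA word_basis_vector; apply: nZ.
case: ifP => // _; apply: Nj; exact: leq_trans sw (leq_addl _ _).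
Qed.

End Monomials.

Section SimpleObjects.
Variable k : fieldType.
Implicit Types z : penrose_seq.

(** The cokernel is torsion, and [e_n] is the image of [e_0] under a monomial of
    length [n]. *)
Lemma fdim_iso_basis_vector z T (f : grhom T (Mz k z)) : fdim_iso f ->
  exists n0 : nat, forall n, (n0 <= n)%N ->
    exists2 y, hom n%:Z y & f y = basis_vector k z n.
Proof.
move=> /fdim_isoP[_ /(_ (basis_vector k z 0))[n0 hn0]]; exists n0 => n hn.
have := hn0 (spell z 0 n); rewrite size_spell word_spell => /(_ hn)[y _ ey].
exists (component n%:Z y); first exact: component_hom.
by rewrite -component_grhom ey add0n (component_homE _ (@hom_basis_vector k z n)) eqxx.
Qed.

(** If the identity of [O_z] were zero, then some [e_n] would be both the image
    and zero, up to torsion, under one fraction. *)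
Lemma Oz_nonzero z : ~ qzero (Oz k z).
Proof.
move=> /(_ (Oz k z))[[F hF] _].
have [T [u [v [uP e1 e2]]]] := hF (qhom_id _).
have [T' [u' [v' [uP' _ e2']]]] := hF (qhom_zero _ _).
have [n hn] := fdim_iso_basis_vector uP; have [n' hn'] := fdim_iso_basis_vector uP'.
have [y _ ey] := hn (maxn n n') (leq_maxl _ _).
have [y' _ ey'] := hn' (maxn n n') (leq_maxr _ _).
have [kl _] := (fdim_isoP _).1 (left_legP F).
have [m hm] : word_torsion [set 0] (u y - u' y').
  apply: kl; rewrite grhomB.
  by move: ey ey' => /= -> ->; rewrite subrr.
apply: (@not_torsion_basis_vector k z (maxn n n')); exists m => w /hm h0.
have -> : basis_vector k z (maxn n n') = right_leg F (u y - u' y').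
  rewrite grhomB; have /= -> := e2' y'; rewrite subr0.
  by rewrite -ey; have /= -> := e1 y; have /= -> := e2 y.
by rewrite -grhomZ h0 grhom0.
Qed.

(** The image of a monomorphism to [O_z] is zero, or it contains some [e_j] and
    hence is everything up to torsion. *)
Theorem Oz_simple z : qsimple (Oz k z).
Proof.
split; first exact: Oz_nonzero.
move=> N F mono; have [r0|] := pselect (forall t, right_leg F t = 0).
  by left; apply: torsion_qzero; exact: qmono_zero mono r0.
move=> /existsNP[t rt]; right.
have [i ci] : exists i, component i (right_leg F t) <> 0.
  apply: contrapT => /forallNP c0; case: rt.
  have [s _ [-> _]] := component_sumE (right_leg F t).
  by apply: big1 => i _; apply: contrapT; exact: c0.
have [j [c [c0 _ ej]]] := homogeneous_basis_vector (component_hom i _) ci.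
have rj : range (right_leg F) (basis_vector k z j).
  exists (scalB c^-1 *: component i t) => //.
  rewrite grhomZ -component_grhom ej scalerA -scalBM (mulVf c0) scalB1.
  exact: scale1r.
have rP : fdim_iso (right_leg F).
  apply/fdim_isoP; split; first exact: qmono_kernel.
  exact: submodule_cofinite (grsubmod_range _) rj.
by clear -rP; case: F rP => T l r lP /=; exact: roof_isomorphism.
Qed.

(** A fraction from [O_z] to [O_z'] that is not zero up to torsion sends some
    [e_n] to a multiple of [e_n]; the monomials that do not kill these vectors
    spell the two sequences. *)
Lemma qisomorphic_tail_eq z z' : qisomorphic (Oz k z) (Oz k z') -> tail_eq z z'.
Proof.
move=> [F [G [[T [u [v [uP [_ [T2 [u2 [v2 [u2P e1 e2]]]]]]]]] _]]].
have [n hn] := fdim_iso_basis_vector u2P.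
have [y hy ey] := hn n (leqnn n).
pose f := grhom_comp (left_leg G) (grhom_comp v v2).
have nz m : word k (spell z n m) *: f y <> 0.
  rewrite -grhomZ => /= f0.
  have [kl _] := (fdim_isoP _).1 (left_legP G).
  have [d hd] := kl _ f0.
  apply: (@not_torsion_basis_vector k z (n + m)); exists d => w /hd /= h0.
  have e : u2 (word k w *: (word k (spell z n m) *: y)) =
      word k w *: basis_vector k z (n + m).
    by rewrite !grhomZ -word_spell -ey.
  rewrite -e; have /= -> := e2 (word k w *: (word k (spell z n m) *: y)).
  by rewrite (grhomZ v2) (grhomZ v) h0 grhom0.
have fy0 : f y <> 0 by move=> f0; apply: (nz 0%N); rewrite f0 scaler0.
have [j [c [c0 [jn] fy]]] := homogeneous_basis_vector (grhom_deg f hy) fy0.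
exists n => i hi; have := nz (i - n).+1.
rewrite fy scalerA -scalB_word_comm -scalerA word_basis_vector size_spell -jn.
case: eqP => [[]|]; last by rewrite scaler0.
by rewrite subnKC.
Qed.

Section Truncation.
Variables (z z' : penrose_seq) (m : nat).
Hypothesis zz' : forall n, (m <= n)%N -> z n = z' n.

(** The span of the [e_j] with [j >= m], on which the actions of [B] for [z] and
    [z'] coincide *)
Definition truncated : set (Mz k z) :=
  [set p | forall j, (j < m)%N -> (p : {poly k})`_j = 0].

Lemma truncatedB p q : truncated p -> truncated q -> truncated (p - q).
Proof. by move=> hp hq j hj; rewrite coefB hp ?hq ?subr0. Qed.

Lemma truncatedD p q : truncated p -> truncated q -> truncated (p + q).
Proof. by move=> hp hq j hj; rewrite coefD hp ?hq ?addr0. Qed.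

Lemma truncated_shift (a a' : nat -> k) (p : Mz k z) :
  (forall n, (m <= n)%N -> a n = a' n) -> truncated p ->
  truncated (Defs.shift a p) /\ Defs.shift a p = Defs.shift a' p.
Proof.
move=> aa' hp; split=> [[|j] hj|]; rewrite ?coef_shift ?hp ?mulr0 //.
  exact: ltnW.
apply/polyP => -[|j]; rewrite !coef_shift //.
by have [/aa' ->//|/hp ->] := leqP m j; rewrite !mulr0.
Qed.

Lemma truncated_act b (p : Mz k z) : truncated p ->
  truncated (b *: p) /\ b *: p = b *: (p : Mz k z') :> {poly k}.
Proof.
have letter (c : bool) (q : Mz k z) : truncated q ->
    let d := if c then yB k else xB k in
    truncated (d *: q) /\ d *: q = d *: (q : Mz k z') :> {poly k}.
  case: c => hq /=; [rewrite !rep_y|rewrite !rep_x]; apply: truncated_shift hq => n hn.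
    by rewrite (zz' hn).
  by rewrite (zz' hn).
have [s [c ->]] := B_span b; move=> hp; elim: s => [|w s [IH1 IH2]].
  by rewrite !big_nil !scale0r; split=> // j _; rewrite coef0.
rewrite !big_cons !scalerDl.
suff [h1 h2] : truncated (scalB (c w) * word k w *: p) /\
    scalB (c w) * word k w *: p = scalB (c w) * word k w *: (p : Mz k z') :> {poly k}.
  by split; [exact: truncatedD|congr (_ + _)].
rewrite -!scalerA !rep_scal.
suff [h1 h2] : truncated (word k w *: p) /\
    word k w *: p = word k w *: (p : Mz k z') :> {poly k}.
  split; first by move=> j hj; rewrite coefZ h1 ?mulr0.
  exact: (congr1 (fun q : {poly k} => c w *: q) h2).
elim: w => [|l w [h1 h2]]; first by rewrite word0 !scale1r.
rewrite !word_cons -!scalerA; have [h3 h4] := letter l _ h1.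
split=> //; rewrite h4.
exact: (congr1 (fun q : Mz k z' => (if l then yB k else xB k) *: q) h2).
Qed.

Lemma grsubmod_truncated : grsubmod truncated.
Proof.
apply: grsubmodP.
- by move=> j _; rewrite coef0.
- exact: truncatedB.
- by move=> b p /(truncated_act b)[].
move=> i p hp j hj; have [s us [ep z0]] := component_sumE p.
have [//|cj] := eqVneq (component i p : {poly k})`_j 0.
have ji := component_hom i p j cj.
have is_ : i \in s by apply: contraNT cj => /z0 ->; rewrite coef0.
have := congr1 (fun q : {poly k} => q`_j) ep.
rewrite /= (hp j hj) (bigD1_seq i) //= coefD => /esym/eqP.
rewrite (_ : (\sum_(i' <- s | _) _ : {poly k})`_j = 0) ?addr0; first by move/eqP.
rewrite coef_sum big1 // => i' ne; apply: contraNeq ne => /(component_hom i' p j) <-.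
by rewrite ji.
Qed.

Definition truncation_map (t : graded_submodule grsubmod_truncated) : Mz k z' :=
  submodule_val t : {poly k}.

Lemma truncation_map_linear : linear truncation_map.
Proof.
move=> b s t; have [_ e] := truncated_act b (submodule_valN s).
by congr (_ + _); exact: e.
Qed.

HB.instance Definition _ := GRing.isLinear.Build (B k)
  (graded_submodule grsubmod_truncated) (Mz k z') *:%R
  truncation_map truncation_map_linear.

Definition truncation_grhom : grhom (graded_submodule grsubmod_truncated) (Mz k z') :=
  @GrHom k _ _ (truncation_map : {linear _ -> _}) (fun _ _ h => h).

(** [M_z] and [M_z'] have a common submodule with torsion quotients. *)
Lemma tail_eq_qisomorphic : qisomorphic (Oz k z) (Oz k z').
Proof.
have hm : truncated (basis_vector k z m).
  by move=> j; rewrite coefXn ltn_neqAle => /andP[/negbTE ->].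
exists (QHom truncation_grhom
  (@submodule_inclusion_iso _ _ _ grsubmod_truncated
    (submodule_cofinite grsubmod_truncated hm))).
apply: roof_isomorphism; apply/fdim_isoP; split=> v.
  move=> v0; exists 0%N => w _; have -> : v = 0 by exact: submodule_val_inj.
  by rewrite /= scaler0.
apply: submodule_cofinite (grsubmod_range _) _ v.
by exists (in_submodule grsubmod_truncated hm).
Qed.

End Truncation.

End SimpleObjects.

(** * Isometries and tiles *)

Section Vectors.
Variable R : realType.
Local Notation point := (R * R)%type.
Local Notation tau := (tau R).
Implicit Types (p q x u v w : point) (a b c : R) (f g : point -> point).

Lemma point_ext p q : p.1 = q.1 -> p.2 = q.2 -> p = q.
Proof. by case: p q => [? ?] [? ?] /= -> ->. Qed.

Lemma addp1 p q : (p + q).1 = p.1 + q.1. Proof. by []. Qed.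
Lemma addp2 p q : (p + q).2 = p.2 + q.2. Proof. by []. Qed.
Lemma oppp1 p : (- p).1 = - p.1. Proof. by []. Qed.
Lemma oppp2 p : (- p).2 = - p.2. Proof. by []. Qed.
Lemma scalep1 a p : (a *: p).1 = a * p.1. Proof. by []. Qed.
Lemma scalep2 a p : (a *: p).2 = a * p.2. Proof. by []. Qed.
Lemma zerop1 : (0 : point).1 = 0. Proof. by []. Qed.
Lemma zerop2 : (0 : point).2 = 0. Proof. by []. Qed.
Definition coordE :=
  (addp1, addp2, oppp1, oppp2, scalep1, scalep2, zerop1, zerop2).

Definition cross u w : R := u.1 * w.2 - u.2 * w.1.

Lemma tau_gt1 : 1 < tau.
Proof.
have s : 1 < Num.sqrt (5 : R).
  by rewrite -[ltLHS]sqrtr1 ltr_sqrt // ltr1n.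
rewrite /Defs.tau ltr_pdivlMr //; lra.
Qed.

Lemma tau_lt2 : tau < 2.
Proof. have := tau2 R; have := tau_gt1; nra. Qed.

Definition affine (f : point -> point) := forall a b c p q x, a + b + c = 1 ->
  f (a *: p + b *: q + c *: x) = a *: f p + b *: f q + c *: f x.

Lemma affine2 f a p q : affine f ->
  f (p + a *: (q - p)) = f p + a *: (f q - f p).
Proof.
move=> af; have -> : p + a *: (q - p) = (1 - a) *: p + a *: q + 0 *: q.
  by apply: point_ext; rewrite !coordE; ring.
by rewrite af; [apply: point_ext; rewrite !coordE; ring | ring].
Qed.

Lemma affine2' f a p q : affine f ->
  f (p + a *: (p - q)) = f p + a *: (f p - f q).
Proof.
move=> af; rewrite -opprB scalerN -scaleNr affine2 //.
by rewrite scaleNr -scalerN opprB.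
Qed.

Lemma dot0 p : dot p p = 0 -> p = 0.
Proof.
rewrite /dot => h; apply: point_ext => /=; apply/eqP; rewrite -sqrf_eq0;
  apply/eqP; nra.
Qed.

Lemma isometryP (f : point -> point) : plane_isometry f <->
  forall p q, dot (f p - f q) (f p - f q) = dot (p - q) (p - q).
Proof.
have E p q : Defs.edist p q = Num.sqrt (dot (p - q) (p - q)).
  by rewrite /Defs.edist /dot !coordE !expr2.
have ge0 p : 0 <= dot p p by rewrite /dot; nra.
split=> h p q; last by rewrite !E h.
have := h p q; rewrite !E => /(congr1 (fun r : R => r ^+ 2)).
by rewrite !sqr_sqrtr.
Qed.

(** Leibniz' formula for the distance to a barycenter: since only squared
    distances enter, isometries preserve barycenters. *)
Lemma leibniz a b c p q x y : a + b + c = 1 ->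
  let z := a *: p + b *: q + c *: x in
  let d u v := dot (u - v) (u - v) in
  d y z = a * d y p + b * d y q + c * d y x
          - (a * b * d p q + b * c * d q x + a * c * d p x).
Proof.
move=> abc /=; have -> : a = 1 - b - c by rewrite -abc; ring.
by rewrite /dot !coordE; ring.
Qed.

Lemma isometry_affine f : plane_isometry f -> affine f.
Proof.
move=> /isometryP fi a b c p q x abc; apply/eqP; rewrite -subr_eq0; apply/eqP.
apply: dot0; rewrite (leibniz _ _ _ _ abc) /= !fi.
by rewrite -(leibniz _ _ _ _ abc) /= subrr /dot /= mulr0 addr0.
Qed.

Lemma isometry_inj f : plane_isometry f -> injective f.
Proof.
move=> /isometryP fi p q e; apply/eqP; rewrite -subr_eq0; apply/eqP.
by apply: dot0; rewrite -fi e subrr /dot /= mulr0 addr0.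
Qed.

Lemma isometry_id : @plane_isometry R id.
Proof. by []. Qed.

Lemma isometry_comp f g : plane_isometry f -> plane_isometry g ->
  plane_isometry (f \o g).
Proof. by move=> hf hg p q; rewrite /= hf hg. Qed.

Lemma dot_gt0 p : p != 0 -> 0 < dot p p.
Proof.
move=> p0; rewrite lt_def; apply/andP; split; last by rewrite /dot; nra.
by apply: contra_neq p0 => /dot0.
Qed.

Lemma isometry_reflect p q : p <> q -> plane_isometry (reflect_line p q).
Proof.
move=> pq; apply/isometryP => x y.
have d0 : dot (q - p) (q - p) != 0.
  by rewrite gt_eqF // dot_gt0 // subr_eq0; apply/eqP => /esym.
rewrite /reflect_line; set d := dot (q - p) (q - p) in d0 *.
move: d0; rewrite /d /dot !mulr2n !coordE => d0; field.
by [].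
Qed.
End Vectors.

Section Tiles.
Variable R : realType.
Local Notation point := (R * R)%type.
Local Notation tau := (tau R).
Local Notation tile := (tile R).
Implicit Types (p q x u v w : point) (a b c : R) (f g : point -> point).
Implicit Types (t T L S : tile) (n : nat).

Lemma tile_eta t : t = Tile (small t) (apex t) (same t) (diff t).
Proof. by case: t. Qed.

Lemma map_tile_id t : map_tile id t = t.
Proof. by case: t. Qed.

Lemma map_tile_comp f g t : map_tile (f \o g) t = map_tile f (map_tile g t).
Proof. by []. Qed.

Lemma map_tile_inj f : injective f -> injective (map_tile f).
Proof.
by move=> fi [s1 a1 b1 c1] [s2 a2 b2 c2] [-> /fi-> /fi-> /fi->].
Qed.

Lemma map_partner f n t : affine f ->
  map_tile f (partner n t) = partner n (map_tile f t).
Proof.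
move=> af; rewrite /partner /=.
by case: (odd n) (small t) => [] [] /=; rewrite /map_tile /= affine2'.
Qed.

Lemma map_glue f n L S :
  map_tile f (glue n L S) = glue n (map_tile f L) (map_tile f S).
Proof. by rewrite /glue; case: (odd n). Qed.

Lemma map_compose f n s t : affine f ->
  map_tile f (compose n s t) = compose n s (map_tile f t).
Proof.
move=> af; rewrite /compose /=; case: s => //.
by case: (small t); rewrite map_glue map_partner.
Qed.

Lemma map_large_part f n t : affine f ->
  map_tile f (large_part n t) = large_part n (map_tile f t).
Proof.
move=> af; rewrite /large_part /=.
by case: (small t) (odd n) => [] [] //=; rewrite /map_tile /= affine2.
Qed.

Lemma map_parts f n T t : affine f -> parts n T t ->
  parts n (map_tile f T) (map_tile f t).
Proof.
move=> af; rewrite /parts /=; case: (small T) => [->|[]->].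
- by rewrite /= map_large_part.
- by left; rewrite /= map_large_part.
- by right; rewrite /= map_partner // map_large_part.
Qed.

Lemma map_hull f t : affine f -> f @` hull t = hull (map_tile f t).
Proof.
move=> af; apply/seteqP; split => [_ [_ [a [b [c [a0 b0 c0 s ->]]]] <-]|x].
  by exists a, b, c; split; rewrite ?af.
move=> [a [b [c [a0 b0 c0 s ->]]]]; rewrite /= -af //.
by exists (a *: apex t + b *: same t + c *: diff t) => //; exists a, b, c.
Qed.

(** The interior of a nondegenerate tile: the points with positive barycentric
    coordinates. *)
Definition intr t : set point := [set x | exists a b c : R,
  [/\ 0 < a, 0 < b, 0 < c, a + b + c = 1 &
     x = a *: apex t + b *: same t + c *: diff t]].

Lemma intr_hull t : intr t `<=` hull t.
Proof.
by move=> x [a [b [c [a0 b0 c0 s ->]]]]; exists a, b, c; split=> //; exact: ltW.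
Qed.

Lemma map_intr f t x : affine f -> intr t x -> intr (map_tile f t) (f x).
Proof.
move=> af [a [b [c [a0 b0 c0 s ->]]]]; exists a, b, c; split=> //=.
by rewrite af.
Qed.

Definition area t := cross (same t - apex t) (diff t - apex t).

Definition bary_apex t x := cross (same t - x) (diff t - x) / area t.
Definition bary_same t x := cross (diff t - x) (apex t - x) / area t.
Definition bary_diff t x := cross (apex t - x) (same t - x) / area t.
Local Notation ba := bary_apex.
Local Notation bs := bary_same.
Local Notation bd := bary_diff.

Lemma bary_sum t x : area t != 0 -> ba t x + bs t x + bd t x = 1.
Proof.
rewrite /ba /bs /bd /area /cross !coordE => h; by field.
Qed.

Lemma bary_point t x : area t != 0 ->
  x = ba t x *: apex t + bs t x *: same t + bd t x *: diff t.
Proof.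
rewrite /ba /bs /bd /area /cross => h.
by apply: point_ext; rewrite !coordE in h *; field.
Qed.

Lemma baryE t a b c x : area t != 0 -> a + b + c = 1 ->
  x = a *: apex t + b *: same t + c *: diff t ->
  [/\ ba t x = a, bs t x = b & bd t x = c].
Proof.
move=> h s ->; have -> : a = 1 - b - c by rewrite -s; ring.
rewrite /ba /bs /bd /area /cross in h *.
by split; rewrite !coordE in h *; field.
Qed.

Lemma hullP t x : area t != 0 ->
  hull t x <-> [/\ 0 <= ba t x, 0 <= bs t x & 0 <= bd t x].
Proof.
move=> h; split=> [[a [b [c [a0 b0 c0 s e]]]]|[a0 b0 c0]].
  by have [-> -> ->] := baryE h s e.
exists (ba t x), (bs t x), (bd t x); split=> //; first exact: bary_sum.
exact: bary_point.
Qed.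

Lemma intrP t x : area t != 0 ->
  intr t x <-> [/\ 0 < ba t x, 0 < bs t x & 0 < bd t x].
Proof.
move=> h; split=> [[a [b [c [a0 b0 c0 s e]]]]|[a0 b0 c0]].
  by have [-> -> ->] := baryE h s e.
exists (ba t x), (bs t x), (bd t x); split=> //; first exact: bary_sum.
exact: bary_point.
Qed.

Lemma tileE s (p q x p' q' x' : point) : p = p' -> q = q' -> x = x' ->
  Tile s p q x = Tile s p' q' x'.
Proof. by move=> -> -> ->. Qed.

Lemma partnerK n t : partner n (partner n t) = t.
Proof.
case: t => s p q x; rewrite /partner; case: (odd n) s => [] [] /=;
  apply: tileE => //; apply: point_ext; rewrite !coordE tauV; ring: (tau2 R).
Qed.

Lemma small_partner n t : small (partner n t) = ~~ small t.
Proof. by rewrite /partner; case: (odd n) (small t) => [] []. Qed.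

Lemma large_partK n T : ~~ small T ->
  glue n (large_part n T) (partner n (large_part n T)) = T.
Proof.
case: T => [] [] // p q x _; rewrite /partner /glue /large_part.
by case: (odd n) => /=;
  apply: tileE => //; apply: point_ext; rewrite !coordE tauV; ring: (tau2 R).
Qed.

Lemma small_partE n T : ~~ small T -> partner n (large_part n T) =
  if odd n then Tile true (diff T) (apex T + tau^-1 *: (same T - apex T)) (same T)
  else Tile true (same T + tau^-1 *: (diff T - same T)) (diff T) (apex T).
Proof.
case: T => [] [] // p q x _; rewrite /partner /large_part.
by case: (odd n) => /=;
  apply: tileE => //; apply: point_ext; rewrite !coordE tauV; ring: (tau2 R).
Qed.

Lemma small_large_part n T : small (large_part n T) = false.
Proof. by rewrite /large_part; case: (small T) (odd n) => [] []. Qed.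

Lemma small_compose n s t : small (compose n s t) = s.
Proof.
by rewrite /compose /glue; case: s => //; case: (small t) (odd n) => [] [].
Qed.

(** Given the size of the level n+1 tile, decomposition can be undone. *)
Lemma parts_inv n T t : parts n T t -> T = compose n (small T) t.
Proof.
rewrite /parts /compose; case: T => [] [] p q x /=; first by move=> ->.
move=> [] ->; first by rewrite small_large_part large_partK.
by rewrite small_partner small_large_part /= partnerK large_partK.
Qed.

Lemma parts_small n T t : parts n T t -> small t -> small T = false.
Proof.
rewrite /parts; case: ifP => // sT -> /=.
by rewrite small_large_part.
Qed.

Lemma parts_partner n T t : parts n T t -> small T = false ->
  parts n T (partner n t).
Proof.
rewrite /parts => + sT; rewrite sT => -[]->; first by right.
by left; rewrite partnerK.
Qed.

Lemma tauV_gt0 : 0 < tau^-1.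
Proof. by rewrite tauV subr_gt0 tau_gt1. Qed.
Lemma tauV_lt1 : tau^-1 < 1.
Proof. by rewrite tauV; have := tau_lt2 R; lra. Qed.

Ltac bary_witness abc :=
  split; [by nra | by nra | by nra | by rewrite -[RHS]abc; ring
         | by apply: point_ext; rewrite !coordE /=; ring].

(* In each case the witnesses express the barycentric coordinates in the larger
   tile by those in its part. *)
Lemma parts_hull n T t : parts n T t -> hull t `<=` hull T.
Proof.
have := tauV_gt0; have := tauV_lt1; set r := tau^-1 => r1 r0.
rewrite /parts; case: T => [] [] p q x /=; first by move=> ->.
move=> [] -> y; rewrite ?small_partE // /large_part /= -/r;
  case: (odd n) => -[a [b [c /= [a0 b0 c0 abc ->]]]].
- exists (a * (1 - r) + c), (a * r), b; bary_witness abc.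
- exists b, (a + c * (1 - r)), (c * r); bary_witness abc.
- exists (b * (1 - r)), (b * r + c), a; bary_witness abc.
- exists c, (a * (1 - r)), (a * r + b); bary_witness abc.
Qed.

Lemma parts_intr n T t : parts n T t -> intr t `<=` intr T.
Proof.
have := tauV_gt0; have := tauV_lt1; set r := tau^-1 => r1 r0.
rewrite /parts; case: T => [] [] p q x /=; first by move=> ->.
move=> [] -> y; rewrite ?small_partE // /large_part /= -/r;
  case: (odd n) => -[a [b [c /= [a0 b0 c0 abc ->]]]].
- exists (a * (1 - r) + c), (a * r), b; bary_witness abc.
- exists b, (a + c * (1 - r)), (c * r); bary_witness abc.
- exists (b * (1 - r)), (b * r + c), a; bary_witness abc.
- exists c, (a * (1 - r)), (a * r + b); bary_witness abc.
Qed.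

Lemma area_parts n T t : parts n T t -> (area t != 0) = (area T != 0).
Proof.
have := tauV_gt0; have := tauV_lt1; set r := tau^-1 => r1 r0.
have E k : k != 0 -> area t = k * area T -> (area t != 0) = (area T != 0).
  by move=> k0 ->; rewrite mulf_eq0 (negbTE k0).
rewrite /parts; case: T E => [] [] p q x /= E; first by move=> ->.
case: t E => s p' q' x' E.
move=> [] e; move: E; rewrite e; rewrite ?small_partE // /large_part /=;
  rewrite /area /cross /=; case: (odd n) => /= E.
- by apply: (E (r)); [by rewrite gt_eqF | by rewrite -/r ?coordE /GRing.scale /=; ring].
- by apply: (E (- r)); [by rewrite oppr_eq0 gt_eqF | by rewrite -/r ?coordE /GRing.scale /=; ring].
- by apply: (E (1 - r)); [by rewrite gt_eqF // subr_gt0 | by rewrite -/r ?coordE /GRing.scale /=; ring].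
- by apply: (E (1 - r)); [by rewrite gt_eqF // subr_gt0 | by rewrite -/r ?coordE /GRing.scale /=; ring].
Qed.

Lemma intr_partner n t x : ~~ small t -> area t != 0 ->
  intr t x -> intr (partner n t) x -> False.
Proof.
move=> sm h /(intrP _ h)[a0 b0 c0]; have := tauV_gt0; set r := tau^-1 => r0.
rewrite /partner (negbTE sm); case: (odd n) => -[a [b [c /= [a1 b1 c1 abc e]]]].
- have := @baryE t (b + c * (1 + r)) a (- (c * r)) x h.
  case; [rewrite -[RHS]abc; ring|by rewrite e; apply: point_ext; rewrite !coordE -/r; ring|].
  by move=> _ _ E; move: c0; rewrite E oppr_gt0 ltNge mulr_ge0 // ltW.
- have := @baryE t (- (b * r)) c (a + b * (1 + r)) x h.
  case; [rewrite -[RHS]abc; ring|by rewrite e; apply: point_ext; rewrite !coordE -/r; ring|].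
  by move=> E _ _; move: a0; rewrite E oppr_gt0 ltNge mulr_ge0 // ltW.
Qed.

Lemma parts_disjoint n T t t' x : area T != 0 -> parts n T t -> parts n T t' ->
  intr t x -> intr t' x -> t = t'.
Proof.
move=> h pt pt'; have := pt; have := pt'; rewrite /parts.
case: ifP => [_ /= -> ->//|sT]; have hL : area (large_part n T) != 0.
  by rewrite (@area_parts n T) // /parts sT; left.
have sL := small_large_part n T.
move=> [] -> [] -> // i1 i2; exfalso.
  by apply: (@intr_partner n _ x _ hL i2 i1); rewrite sL.
by apply: (@intr_partner n _ x _ hL i1 i2); rewrite sL.
Qed.

End Tiles.

(** * The shapes of the tiles *)

Section Shapes.
Variable R : realType.
Local Notation point := (R * R)%type.
Local Notation tau := (tau R).
Local Notation tile := (tile R).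
Implicit Types (p q x u v w e : point) (a b c l : R) (f g : point -> point).
Implicit Types (t T L S : tile) (n : nat).

(** The cosine of 36 or of 108 degrees *)
Definition cos_apex (acute : bool) : R := if acute then tau / 2 else (1 - tau) / 2.

(** An isosceles triangle with legs of squared length [l] and apex angle 36 or
    108 degrees. *)
Definition isosceles (acute : bool) l t :=
  [/\ dot (same t - apex t) (same t - apex t) = l,
      dot (diff t - apex t) (diff t - apex t) = l &
      dot (same t - apex t) (diff t - apex t) = cos_apex acute * l].

(** The length of the legs of a level [n] tile of size [s] *)
Definition leg n (s : bool) : R :=
  tau ^+ n./2 * (if s && ~~ odd n then 1 else tau).

Arguments leg : simpl never.

(** The large tile is acute at even levels and obtuse at odd ones, and conversely
    for the small tile. *)
Definition shape n t := isosceles (small t == odd n) (leg n (small t) ^+ 2) t.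

Lemma tau_gt0 : 0 < tau. Proof. by rewrite (lt_trans _ (tau_gt1 R)). Qed.

Lemma leg_gt0 n s : 0 < leg n s.
Proof. by rewrite mulr_gt0 ?exprn_gt0 ?tau_gt0 //; case: ifP; rewrite ?tau_gt0. Qed.

Lemma leg_odd n s : odd n -> leg n s = tau ^+ n./2 * tau.
Proof. by rewrite /leg => ->; rewrite andbF. Qed.

Lemma leg_even n s : ~~ odd n -> leg n s = tau ^+ n./2 * (if s then 1 else tau).
Proof. by rewrite /leg => ->; rewrite andbT. Qed.

Lemma legS_odd n s : odd n ->
  leg n.+1 s = tau ^+ n./2 * tau * (if s then 1 else tau).
Proof.
by move=> on; rewrite leg_even /= ?on // uphalf_half on exprS [tau * _]mulrC.
Qed.

Lemma legS_even n s : ~~ odd n -> leg n.+1 s = tau ^+ n./2 * tau.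
Proof.
by move=> on; rewrite leg_odd /= ?on // uphalf_half (negbTE on).
Qed.

Lemma area_isosceles ac l t : 0 < l -> isosceles ac l t -> area t != 0.
Proof.
move=> l0 [h1 h2 h3]; rewrite -sqrf_eq0 gt_eqF //.
have -> : area t ^+ 2 = l ^+ 2 * (1 - cos_apex ac ^+ 2).
  transitivity (dot (same t - apex t) (same t - apex t)
      * dot (diff t - apex t) (diff t - apex t)
      - dot (same t - apex t) (diff t - apex t) ^+ 2).
    by rewrite /area /cross /dot; ring.
  by rewrite h1 h2 h3; ring.
apply: mulr_gt0; first exact: exprn_gt0.
have := tau_gt1 R; have := tau_lt2 R; rewrite /cos_apex; case: (ac); nra.
Qed.

Lemma area_shape n t : shape n t -> area t != 0.
Proof. by apply: area_isosceles; rewrite exprn_gt0 // leg_gt0. Qed.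

Lemma isometry_dot f p q x : plane_isometry f ->
  dot (f q - f p) (f x - f p) = dot (q - p) (x - p).
Proof.
have E (P Q X : point) : dot (Q - P) (X - P) =
    (dot (Q - P) (Q - P) + dot (X - P) (X - P) - dot (Q - X) (Q - X)) / 2.
  by rewrite /dot !coordE; field.
by move=> /isometryP h; rewrite E !h -E.
Qed.

Lemma isosceles_map f ac l t : plane_isometry f ->
  isosceles ac l (map_tile f t) <-> isosceles ac l t.
Proof. by move=> fi; rewrite /isosceles /= !isometry_dot. Qed.

Lemma shape_map f n t : plane_isometry f ->
  shape n (map_tile f t) <-> shape n t.
Proof. exact: isosceles_map. Qed.

(** The affine map that matches the vertices is an isometry, as the Gram matrix
    of the edges at the apex determines all distances. *)
Lemma congruent_tiles ac l t t' : 0 < l -> small t = small t' ->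
  isosceles ac l t -> isosceles ac l t' ->
  exists2 f, plane_isometry f & map_tile f t = t'.
Proof.
move=> l0 sm it it'; have h := area_isosceles l0 it.
case: it it' => h1 h2 h3 [h1' h2' h3'].
pose f x := bary_apex t x *: apex t' + bary_same t x *: same t'
            + bary_diff t x *: diff t'.
have fE a b c x : a + b + c = 1 ->
    x = a *: apex t + b *: same t + c *: diff t ->
    f x = a *: apex t' + b *: same t' + c *: diff t'.
  by move=> abc e; rewrite /f; have [-> -> ->] := baryE h abc e.
exists f; last first.
  rewrite [RHS]tile_eta /map_tile sm; apply: tileE.
  - rewrite (@fE 1 0 0) ?scale1r ?scale0r ?addr0 //; ring.
  - rewrite (@fE 0 1 0) ?scale1r ?scale0r ?addr0 ?add0r //; ring.
  - rewrite (@fE 0 0 1) ?scale1r ?scale0r ?addr0 ?add0r //; ring.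
apply/isometryP => x y; rewrite [in RHS](bary_point x h) [in RHS](bary_point y h).
rewrite /f; have := bary_sum x h; have := bary_sum y h.
set a := bary_apex t x; set b := bary_same t x; set c := bary_diff t x.
set a' := bary_apex t y; set b' := bary_same t y; set c' := bary_diff t y.
move=> s' s; have -> : a = 1 - b - c by rewrite -s; ring.
have -> : a' = 1 - b' - c' by rewrite -s'; ring.
have E (P Q X : point) :
    let Z := (1 - b - c) *: P + b *: Q + c *: X in
    let Z' := (1 - b' - c') *: P + b' *: Q + c' *: X in
    dot (Z - Z') (Z - Z') = (b - b') ^+ 2 * dot (Q - P) (Q - P)
      + (c - c') ^+ 2 * dot (X - P) (X - P)
      + 2 * (b - b') * (c - c') * dot (Q - P) (X - P).
  by cbv zeta; rewrite /dot !coordE; ring.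
by rewrite !E h1 h2 h3 h1' h2' h3'.
Qed.

Lemma dotC u v : dot u v = dot v u. Proof. by rewrite /dot; ring. Qed.
Lemma dotDl u v w : dot (u + v) w = dot u w + dot v w.
Proof. by rewrite /dot !coordE; ring. Qed.
Lemma dotZl a u w : dot (a *: u) w = a * dot u w.
Proof. by rewrite /dot !coordE; ring. Qed.
Lemma dotDr u v w : dot w (u + v) = dot w u + dot w v.
Proof. by rewrite /dot !coordE; ring. Qed.
Lemma dotZr a u w : dot w (a *: u) = a * dot w u.
Proof. by rewrite /dot !coordE; ring. Qed.
Definition dotE := (dotDl, dotDr, dotZl, dotZr).

(** The Gram matrix of a triangle whose edges at the apex are given linear
    combinations of the edges at the apex of an isosceles triangle. *)
Lemma isosceles_combo ac ac' l l' t t' (a b c d : R) :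
  isosceles ac l t ->
  same t' - apex t' = a *: (same t - apex t) + b *: (diff t - apex t) ->
  diff t' - apex t' = c *: (same t - apex t) + d *: (diff t - apex t) ->
  l' = (a ^+ 2 + b ^+ 2 + 2 * a * b * cos_apex ac) * l ->
  l' = (c ^+ 2 + d ^+ 2 + 2 * c * d * cos_apex ac) * l ->
  cos_apex ac' * l' = (a * c + b * d + (a * d + b * c) * cos_apex ac) * l ->
  isosceles ac' l' t'.
Proof.
rewrite /isosceles; move: (same t - _) (diff t - _) => u v.
move=> [h1 h2 h3] -> -> E1 E2 E3; have h4 := h3; rewrite dotC in h4; split.
- by rewrite !dotE h1 h2 h3 h4 E1; ring.
- by rewrite !dotE h1 h2 h3 h4 E2; ring.
- by rewrite !dotE h1 h2 h3 h4 E3; ring.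
Qed.

(** The coefficients of [isosceles_combo] come from the formulas for the vertices
    of the parts. *)
Lemma shape_parts n T t : shape n.+1 T -> parts n T t -> shape n t.
Proof.
rewrite /shape /parts => hT; case: ifP => sT.
  move=> ->; rewrite small_large_part /large_part sT; move: hT; rewrite sT /=.
  case on: (odd n) => /=.
    by rewrite (@leg_odd n) ?on // legS_odd ?on // mulr1.
  by rewrite (@leg_even n) ?on // legS_even ?on.
have t2 := tau2 R; move: hT; rewrite sT /= => hT.
move=> [] ->; rewrite ?small_partE ?sT // /large_part ?sT;
  move: hT; case on: (odd n) => /= hT.
- rewrite (@leg_odd n) ?on //; rewrite legS_odd ?on // in hT; set m := tau ^+ _ in hT *.
  by apply: (isosceles_combo (a := - tau^-1) (b := 1) (c := - tau^-1) (d := 0) hT);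
    first [by rewrite /=; apply: point_ext; rewrite !coordE ?tauV; ring
          |rewrite /cos_apex ?tauV /=; field: t2].
- rewrite (@leg_even n) ?on //; rewrite legS_even ?on // in hT; set m := tau ^+ _ in hT *.
  by apply: (isosceles_combo (a := -1) (b := 0) (c := - tau^-1) (d := tau^-1) hT);
    first [by rewrite /=; apply: point_ext; rewrite !coordE ?tauV; ring
          |rewrite /cos_apex ?tauV /=; field: t2].
- rewrite (@leg_odd n) ?on //; rewrite legS_odd ?on // in hT; set m := tau ^+ _ in hT *.
  by apply: (isosceles_combo (a := tau^-1) (b := -1) (c := 1) (d := -1) hT);
    first [by rewrite /=; apply: point_ext; rewrite !coordE ?tauV; ring
          |rewrite /cos_apex ?tauV /=; field: t2].
- rewrite (@leg_even n) ?on //; rewrite legS_even ?on // in hT; set m := tau ^+ _ in hT *.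
  by apply: (isosceles_combo (a := tau^-1 - 1) (b := 1 - tau^-1) (c := tau^-1 - 1) (d := - tau^-1) hT);
    first [by rewrite /=; apply: point_ext; rewrite !coordE ?tauV; ring
          |rewrite /cos_apex ?tauV /=; field: t2].
Qed.

End Shapes.

Section Frames.
Variable R : realType.
Local Notation point := (R * R)%type.
Local Notation tau := (tau R).
Local Notation tile := (tile R).
Implicit Types (p q x u v w e : point) (a b c l : R) (f g : point -> point).
Implicit Types (t T L S : tile) (n : nat) (h : bool).

(** By cos (3 pi / 5) = - cos (2 pi / 5), the number is a root of a cubic
    polynomial with the factor X + 1. *)
Lemma cos_pi5 : cos (pi / 5) = tau / 2 :> R.
Proof.
set c := cos (pi / 5).
have c0 : 0 < c by apply: cos_gt0_pihalf; have := @pi_gt0 R; lra.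
have : cos (pi / 5 *+ 2 + pi / 5) = - cos (pi / 5 *+ 2) :> R.
  rewrite -[in RHS]cosN -cosDpi; congr (cos _); rewrite !mulr2n; by field.
rewrite cosD cos_mulr2n sin_mulr2n -/c; set s := sin _ => e.
have s2 : s ^+ 2 = 1 - c ^+ 2 by rewrite /s sin2cos2.
have {}e : (c + 1) * (4 * c ^+ 2 - 2 * c - 1) = 0.
  move/eqP: e; rewrite -subr_eq0 => /eqP e; rewrite -[RHS]e !mulr2n.
  by ring: s2.
have {}e : 4 * c ^+ 2 - 2 * c - 1 = 0.
  by apply: (mulfI _ (etrans e (esym (mulr0 _)))); rewrite gt_eqF //; lra.
have t2 := tau2 R; have t0 := tau_gt0 R.
have : (c - tau / 2) * (c + tau / 2 - 1 / 2) = 0 by nra.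
move/eqP; rewrite mulf_eq0 => /orP[|] /eqP h; first lra.
by have := tau_gt1 R; lra.
Qed.

Lemma sin_pi5_gt0 : 0 < sin (pi / 5) :> R.
Proof. by apply: sin_gt0_pi; have := @pi_gt0 R; lra. Qed.

Lemma sin_pi5_sqr : sin (pi / 5) ^+ 2 = (3 - tau) / 4 :> R.
Proof. by rewrite sin2cos2 cos_pi5; field: (tau2 R). Qed.

(** Rotation by 36 degrees, counterclockwise if [h] is true. *)
Definition turn h w : point :=
  let s : R := if h then sin (pi / 5) else - sin (pi / 5) in
  (tau / 2 * w.1 - s * w.2, s * w.1 + tau / 2 * w.2).

Lemma turn_sqr h w : turn h (turn h w) = tau *: turn h w - w.
Proof.
have s2 := sin_pi5_sqr; have t2 := tau2 R.
have e a : sin (pi / 5) ^+ 2 * a = (3 - tau) / 4 * a by rewrite s2.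
have e' a : tau ^+ 2 * a = (tau + 1) * a by rewrite t2.
have := (e w.1, e w.2, e' w.1, e' w.2).
rewrite /turn; case: h => -[[[]]] *; apply: point_ext; rewrite !coordE /=; lra.
Qed.

Lemma turnD h u v : turn h (u + v) = turn h u + turn h v.
Proof. by apply: point_ext; rewrite !coordE /=; ring. Qed.
Lemma turnZ h a u : turn h (a *: u) = a *: turn h u.
Proof. by apply: point_ext; rewrite !coordE /turn !coordE /=; ring. Qed.
Lemma turnN h u : turn h (- u) = - turn h u.
Proof. by rewrite -scaleN1r turnZ scaleN1r. Qed.

Lemma turnNE h w : turn (~~ h) w = tau *: w - turn h w.
Proof. by case: h; apply: point_ext; rewrite !coordE /turn /=; field. Qed.

Lemma dot_turn h w : dot (turn h w) (turn h w) = dot w w.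
Proof.
have s2 := sin_pi5_sqr; have t2 := tau2 R.
have e a : sin (pi / 5) ^+ 2 * a = (3 - tau) / 4 * a by rewrite s2.
have e' a : tau ^+ 2 * a = (tau + 1) * a by rewrite t2.
have := (e (w.1 ^+ 2), e (w.2 ^+ 2), e' (w.1 ^+ 2), e' (w.2 ^+ 2)).
by case: h => -[[[]]] *; rewrite /dot /turn /=; lra.
Qed.

Lemma dot_turnl h w : dot w (turn h w) = tau / 2 * dot w w.
Proof. by case: h; rewrite /dot /turn /=; field. Qed.

Definition direction k : point := iter k (turn true) (1, 0).

Lemma turn_iter5 w : iter 5 (turn true) w = - w.
Proof.
have t2 := tau2 R.
rewrite /= !(turn_sqr, turnD, turnZ, turnN); set r := turn true w.
by apply: point_ext; rewrite !coordE; ring: t2.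
Qed.

Lemma direction_mod k : direction k = direction (k %% 10).
Proof.
rewrite {1}(divn_eq k 10) /direction; elim: (k %/ 10)%N => // m IH.
by rewrite mulSn -addnA (iterD 10) (iterD 5 5) !turn_iter5 opprK IH.
Qed.

Definition directions : seq point := [seq direction k | k <- iota 0 10].

Lemma mem_direction k : direction k \in directions.
Proof.
by rewrite direction_mod map_f // mem_iota /= ltn_mod.
Qed.

Lemma directionsP e : e \in directions -> exists k, e = direction k.
Proof. by case/mapP => k _ ->; exists k. Qed.

Lemma directions_turn h e : e \in directions -> turn h e \in directions.
Proof.
case/directionsP => k ->; case: h; first exact: (mem_direction k.+1).
have -> : turn false (direction k) = direction (9 + k).
  rewrite -[RHS]/(iter 4 _ (iter 5 _ (direction k))) turn_iter5.
  have t2 := tau2 R.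
  rewrite (turnNE true) /= !(turn_sqr, turnD, turnZ, turnN).
  by apply: point_ext; rewrite !coordE; ring: t2.
exact: mem_direction.
Qed.

Lemma directionsN e : e \in directions -> - e \in directions.
Proof.
case/directionsP => k ->; rewrite -turn_iter5.
exact: (mem_direction (5 + k)).
Qed.

Lemma dot_direction e : e \in directions -> dot e e = 1.
Proof.
case/directionsP => k ->; elim: k => [|k IH]; last by rewrite /= dot_turn.
by rewrite /dot /=; ring.
Qed.

(** In the tiles of the construction the edges take only the ten directions
    that are multiples of 36 degrees: [e] is the direction of the edge from the
    apex to the base vertex of the same color, and [h] the orientation of the
    tile. Three rotations by 36 degrees amount to [tau *: (turn h e - e)]. *)
Definition frame n h e t :=
  let l := leg R n (small t) in
  same t - apex t = l *: e /\
  diff t - apex t =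
    l *: (if small t == odd n then turn h e else tau *: (turn h e - e)).

Lemma frame_isosceles n h e t : dot e e = 1 -> frame n h e t -> shape n t.
Proof.
have t2 := tau2 R => e1 [e2 e3].
have e4 := dot_turnl h e; have e5 := e4; rewrite dotC in e5.
have e6 := dot_turn h e; rewrite e1 in e4 e5 e6.
rewrite /shape /isosceles e2 e3; set l := leg _ _ _; case: (_ == _).
  by split; rewrite /= !(dotZl, dotZr) ?e1 ?e4 ?e6 /cos_apex; ring.
have -> : l *: (tau *: (turn h e - e)) = (l * tau) *: turn h e + (- (l * tau)) *: e.
  by apply: point_ext; rewrite !coordE; ring.
move: (turn h e) e4 e5 e6 => w e4 e5 e6.
by split; rewrite /= !dotE ?e1 ?e4 ?e5 ?e6 /cos_apex; field: t2.
Qed.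

Lemma frame_compose n s h e t : ~~ (small t && s) -> e \in directions ->
  frame n h e t ->
  exists h' e', e' \in directions /\ frame n.+1 h' e' (compose n s t).
Proof.
have t2 := tau2 R => st dir; rewrite /frame small_compose.
set w := turn h e; have dw : w \in directions by exact: directions_turn.
have ww : turn h w = tau *: w - e by rewrite /w turn_sqr.
have d3 : tau *: (w - e) \in directions.
  have <- : turn h (turn h w) = tau *: (w - e).
    by rewrite ww turnD turnN turnZ ww -/w; apply: point_ext; rewrite !coordE; ring: t2.
  by do 2 apply: directions_turn.
case on: (odd n) => /=.
  rewrite !(@leg_odd _ n) ?on // !legS_odd ?on //; set m := tau ^+ _.
  case: t st => [] [] p q x /= st [e1 e2]; last first.
    case: s st => _ /=; first by exists h, e; split=> //; rewrite !mulr1.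
    exists h, (- (tau *: (w - e))); split; first exact: directionsN.
    rewrite /compose /glue /partner on /=.
    rewrite turnN turnZ turnD turnN ww -/w.
    have -> : q = p + (m * tau) *: e by rewrite -e1; apply: point_ext; rewrite !coordE; ring.
    have -> : x = p + (m * tau) *: (tau *: (w - e)) by rewrite -e2; apply: point_ext; rewrite !coordE; ring.
    by split; apply: point_ext; rewrite !coordE ?tauV; ring: t2.
  case: s st => // _; exists h, (tau *: (w - e)); split=> //.
  rewrite /compose /glue /partner on /=.
  rewrite turnZ turnD turnN ww -/w.
  have -> : q = p + (m * tau) *: e by rewrite -e1; apply: point_ext; rewrite !coordE; ring.
  have -> : x = p + (m * tau) *: w by rewrite -e2; apply: point_ext; rewrite !coordE; ring.
  by split; apply: point_ext; rewrite !coordE ?tauV; ring: t2.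
rewrite !(@leg_even _ n) ?on // !legS_even ?on //; set m := tau ^+ _.
case: t st => [] [] p q x /= st [e1 e2]; last first.
  case: s st => _ /=; first by exists h, e.
  exists (~~ h), (- e); split; first exact: directionsN.
  rewrite /compose /glue /partner on /= turnN turnNE -/w.
  have -> : q = p + (m * tau) *: e by rewrite -e1; apply: point_ext; rewrite !coordE; ring.
  have -> : x = p + (m * tau) *: w by rewrite -e2; apply: point_ext; rewrite !coordE; ring.
  by split; apply: point_ext; rewrite !coordE ?tauV; ring: t2.
case: s st => // _; exists h, (- w); split; first exact: directionsN.
rewrite /compose /glue /partner on /= turnN ww.
have -> : q = p + m *: e by rewrite -[m]mulr1 -e1; apply: point_ext; rewrite !coordE; ring.
have -> : x = p + m *: (tau *: (w - e)) by rewrite -[m]mulr1 -e2; apply: point_ext; rewrite !coordE; ring.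
by split; apply: point_ext; rewrite !coordE ?tauV; ring: t2.
Qed.

Section Tz.
Variable z : penrose_seq.
Local Notation tz := (tz R z).

Lemma small_tz n : small (tz n) = z n.
Proof. by case: n => [|n] /=; [case: (z 0) | rewrite small_compose]. Qed.

Lemma tz_frame n : exists h e, e \in directions /\ frame n h e (tz n).
Proof.
elim: n => [|n [h [e [de fe]]]]; last first.
  apply: frame_compose de fe; rewrite small_tz; exact: no_11.
exists true, (1, 0); split; first exact: (mem_direction 0).
have := (congr1 ( *%R tau) sin_pi5_sqr, congr1 ( *%R tau) (tau2 R),
  congr1 ( *%R (sin (pi / 5))) (tau2 R), tau2 R) => -[[[? ?] ?] ?].
rewrite /frame /= /leg /=; case: (z 0) => /=; rewrite /turn /=; split;
  apply: point_ext; rewrite !coordE /= ?cos_pi5; try by ring.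
- have -> : pi * 3 / 5 = pi / 5 *+ 2 + pi / 5 :> R by rewrite mulr2n; field.
  by rewrite cosD sin_mulr2n cos_mulr2n cos_pi5 !(mulr2n (_ * _)) ?(mulr2n (_ ^+ 2)); lra.
- have -> : pi * 3 / 5 = pi / 5 *+ 2 + pi / 5 :> R by rewrite mulr2n; field.
  by rewrite sinD sin_mulr2n cos_mulr2n cos_pi5 !(mulr2n (_ * _)) ?(mulr2n (_ ^+ 2)); lra.
Qed.

Lemma shape_tz n : shape n (tz n).
Proof.
have [h [e [/dot_direction de]]] := tz_frame n.
exact: frame_isosceles.
Qed.

Lemma parts_tz n : parts n (tz n.+1) (tz n).
Proof. by apply: parts_compose; rewrite small_tz no_11. Qed.

End Tz.
End Frames.

(** * The tilings of all levels *)

Section Tilings.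
Variable R : realType.
Local Notation point := (R * R)%type.
Local Notation tau := (tau R).
Local Notation tile := (tile R).
Implicit Types (p q x y w e : point) (a b c l : R) (f g : point -> point).
Implicit Types (t T L S : tile) (n : nat) (h : bool).

Lemma intr_map f t x : affine f -> intr (map_tile f t) x ->
  exists2 y, intr t y & x = f y.
Proof.
move=> af [a [b [c [a0 b0 c0 s /= ->]]]].
by exists (a *: apex t + b *: same t + c *: diff t); [exists a, b, c|rewrite af].
Qed.

Lemma intr_move t x v : area t != 0 -> intr t x ->
  exists2 a, 0 < a & forall b, 0 <= b <= a -> intr t (x + b *: v).
Proof.
move=> h0 /(intrP _ h0)[].
have E p q b : cross (p - (x + b *: v)) (q - (x + b *: v)) / area t =
    cross (p - x) (q - x) / area t + b * (cross v (p - q) / area t).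
  by rewrite mulrA -mulrDl /cross !coordE; congr (_ / _); ring.
have key (r k : R) : 0 < r -> exists2 a, 0 < a &
    forall b, 0 <= b <= a -> 0 < r + b * k.
  move=> r0; exists (r / (1 + `|k|)) => [|b /andP[b0]].
    by rewrite divr_gt0 // ltr_pwDl.
  have k1 : 0 < 1 + `|k| by rewrite ltr_pwDl.
  rewrite ler_pdivlMr // => hb.
  have [k0|k0] := lerP 0 k; first by apply: ltr_wpDr => //; apply: mulr_ge0.
  rewrite ltr0_norm // in hb.
  by move: b0; rewrite le_eqVlt => /predU1P[<-|]; [rewrite mul0r addr0|lra].
move=> /(key _ (cross v (same t - diff t) / area t))[a a0 ha].
move=> /(key _ (cross v (diff t - apex t) / area t))[b b0 hb].
move=> /(key _ (cross v (apex t - same t) / area t))[c c0 hc].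
exists (Num.min a (Num.min b c)); first by rewrite !lt_min a0 b0 c0.
move=> d; rewrite !le_min => /andP[d0 /and3P[da db dc]]; apply/intrP => //.
by rewrite /bary_apex /bary_same /bary_diff !E; split; [apply: ha|apply: hb|apply: hc]; rewrite d0.
Qed.

Definition center t : point :=
  3^-1 *: apex t + 3^-1 *: same t + 3^-1 *: diff t.

Lemma intr_center t : intr t (center t).
Proof. by exists 3^-1, 3^-1, 3^-1; split; rewrite ?invr_gt0 //; field. Qed.

Section Inside.
Variable z : penrose_seq.
Local Notation tz := (tz R z).
Local Notation Uz := (@Uz R z).

(** The level [n] tiles contained in [tz (n + j)] *)
Fixpoint subtiles j n : set tile :=
  if j is i.+1 then [set t | exists2 T, subtiles i n.+1 T & parts n T t]
  else [set tz n].

Lemma subtiles_hull j n t : subtiles j n t -> hull t `<=` Uz.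
Proof.
elim: j n t => [|j IH] n t /=; first by move=> -> x hx; exists n.
by move=> [T /IH hT /parts_hull hp]; exact: subset_trans hT.
Qed.

Lemma subtiles_shape j n t : subtiles j n t -> shape n t.
Proof.
elim: j n t => [|j IH] n t /=; first by move=> ->; exact: (shape_tz R z).
by move=> [T /IH]; exact: shape_parts.
Qed.

Lemma subtilesS j n t : subtiles j n t -> subtiles j.+1 n t.
Proof.
elim: j n t => [|j IH] n t.
  by move=> ->; exists (tz n.+1) => //; exact: parts_tz.
by move=> [T /IH hT pt]; exists T.
Qed.

Lemma subtiles_mono j i n t : subtiles j n t -> subtiles (j + i) n t.
Proof. by elim: i => [|i IH]; rewrite ?addn0 // addnS => /IH /subtilesS. Qed.

Lemma subtiles_disjoint j n t t' x : subtiles j n t -> subtiles j n t' ->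
  intr t x -> intr t' x -> t = t'.
Proof.
elim: j n t t' => [|j IH] n t t'; first by move=> -> ->.
move=> [T hT pt] [T' hT' pt'] it it'.
have eT : T = T' by apply: IH hT hT' _ _; [exact: (parts_intr pt it)|exact: (parts_intr pt' it')].
rewrite -eT in pt'; apply: parts_disjoint pt pt' it it'.
exact: area_shape (subtiles_shape hT).
Qed.

Definition inside n : set tile := [set t | exists j, subtiles j n t].

Lemma inside_tz n : inside n (tz n).
Proof. by exists 0. Qed.

Lemma inside_parts n T t : inside n.+1 T -> parts n T t -> inside n t.
Proof. by move=> [j hj] pt; exists j.+1, T. Qed.

Lemma inside_parent n t : inside n t -> exists2 T, inside n.+1 T & parts n T t.
Proof.
move=> [j /(subtiles_mono 1)]; rewrite addn1 => -[T hT pt].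
by exists T => //; exists j.
Qed.

Lemma inside_hull n t : inside n t -> hull t `<=` Uz.
Proof. by move=> [j]; exact: subtiles_hull. Qed.

Lemma inside_shape n t : inside n t -> shape n t.
Proof. by move=> [j]; exact: subtiles_shape. Qed.

Lemma inside_subtiles n t t' : inside n t -> inside n t' ->
  exists2 j, subtiles j n t & subtiles j n t'.
Proof.
move=> [j hj] [i hi]; exists (j + i)%N; first exact: subtiles_mono.
by rewrite addnC; exact: subtiles_mono.
Qed.

Lemma inside_disjoint n t t' x : inside n t -> inside n t' ->
  intr t x -> intr t' x -> t = t'.
Proof.
move=> ht ht'; have [j] := inside_subtiles ht ht'; exact: subtiles_disjoint.
Qed.

Lemma inside0P t : inside 0 t <-> exists n, level0_parts n (tz n) t.
Proof.
split=> [[j hj]|[n]].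
  have [n] : exists n, level0_parts 0 t `<=` level0_parts n (tz n); last first.
    by move=> h0; exists n; apply: h0.
  elim: j (0%N) t hj => [|j IH] n t; first by move=> ->; exists n.
  move=> [T /IH[m hm] pt]; exists m => u hu; apply: hm.
  by exists t.
have : inside n (tz n) by exact: inside_tz.
elim: n (tz n) => [|n IH] T hT; first by move=> ->.
by move=> [u pu]; apply: IH; exact: inside_parts hT pu.
Qed.

Definition wall p q := p <> q /\ segment p q `<=` Defs.frontier Uz.

Inductive refl_group : (point -> point) -> Prop :=
| refl_group_id : refl_group id
| refl_group_comp p q g : wall p q -> refl_group g ->
    refl_group (reflect_line p q \o g).

Lemma refl_group_isometry g : refl_group g -> plane_isometry g.
Proof.
elim=> [|p q {}g [pq _] _ ig]; first exact: isometry_id.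
by apply: isometry_comp => //; exact: isometry_reflect.
Qed.

Lemma refl_group_affine g : refl_group g -> affine g.
Proof. by move/refl_group_isometry/isometry_affine. Qed.

Definition tiling n : set tile :=
  [set t | exists g u, [/\ refl_group g, inside n u & t = map_tile g u]].

Lemma A_tilingE : A_tiling z = tiling 0.
Proof.
apply/seteqP; split=> t.
  elim=> [n {}t ht|p q {}t pq seg _ [g [u [hg hu ->]]]].
    exists id, t; split; [exact: refl_group_id| |by rewrite map_tile_id].
    by apply/inside0P; exists n.
  by exists (reflect_line p q \o g), u; split=> //; apply: refl_group_comp.
move=> [g [u [hg hu ->]]].
elim: hg => [|p q {}g [pq seg] _ IH].
  rewrite map_tile_id; have /inside0P[n hn] := hu.
  exact: A_tiling_inside hn.
by rewrite map_tile_comp; apply: A_tiling_reflect.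
Qed.

Lemma tiling_inside n t : inside n t -> tiling n t.
Proof.
by move=> h; exists id, t; split; rewrite ?map_tile_id //; exact: refl_group_id.
Qed.

Lemma tiling_parts n T t : tiling n.+1 T -> parts n T t -> tiling n t.
Proof.
move=> [g [u [hg hu ->]]] pt; have ag := refl_group_affine hg.
have : exists2 v, parts n u v & t = map_tile g v.
  move: pt; rewrite /parts /=; case: ifP => su.
    by move=> ->; exists (large_part n u); rewrite ?map_large_part.
  move=> [] ->; first by exists (large_part n u); [left|rewrite map_large_part].
  exists (partner n (large_part n u)); first by right.
  by rewrite map_partner // map_large_part.
move=> [v pv ->]; exists g, v; split=> //.
exact: inside_parts pv.
Qed.

Lemma tiling_parent n t : tiling n t -> exists2 T, tiling n.+1 T & parts n T t.
Proof.
move=> [g [u [hg /inside_parent[U hU pU] ->]]].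
exists (map_tile g U); first by exists g, U.
by apply: map_parts => //; exact: refl_group_affine.
Qed.

Lemma tiling_shape n t : tiling n t -> shape n t.
Proof.
move=> [g [u [/refl_group_isometry hg /inside_shape hu ->]]].
exact/shape_map.
Qed.

(** Such an [F] exists if and only if no two points of [Uz] are exchanged by the
    group of the walls; it shows that the copies of [Uz] do not overlap without
    a description of this group. *)
Definition folding (F : point -> point) :=
  (forall p q x, wall p q -> F (reflect_line p q x) = F x) /\
  (forall x y, Uz x -> Uz y -> F x = F y -> x = y).

End Inside.
End Tilings.

Section Composition.
Variable R : realType.
Local Notation point := (R * R)%type.
Local Notation tau := (tau R).
Local Notation tile := (tile R).
Implicit Types (p q x y w e : point) (a b c l : R) (f g : point -> point).
Implicit Types (t T L S : tile) (n : nat) (h : bool).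

Section Folding.
Variables (z : penrose_seq) (F : point -> point).
Hypothesis hF : folding z F.

Lemma folding_group g x : refl_group z g -> F (g x) = F x.
Proof.
by move=> hg; elim: hg x => // p q {}g hw _ IH x; rewrite /= hF.1 //.
Qed.

Lemma intr_toward t x w : intr t x -> hull t w ->
  forall a, 0 <= a < 1 -> intr t (x + a *: (w - x)).
Proof.
move=> [a [b [c [a0 b0 c0 s ->]]]] [a' [b' [c' [a0' b0' c0' s' ->]]]] d.
move=> /andP[d0 d1].
have d1' : 0 < 1 - d by rewrite subr_gt0.
have key (r r' : R) : 0 < r -> 0 <= r' -> 0 < (1 - d) * r + d * r'.
  by move=> r0 r0'; rewrite ltr_wpDr ?mulr_gt0 // mulr_ge0.
exists ((1 - d) * a + d * a'), ((1 - d) * b + d * b'), ((1 - d) * c + d * c').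
split; [exact: key|exact: key|exact: key| |].
  transitivity ((1 - d) * (a + b + c) + d * (a' + b' + c')); first by ring.
  by rewrite s s'; ring.
by apply: point_ext; rewrite !coordE; ring.
Qed.

Lemma vertices_hull t : [/\ hull t (apex t), hull t (same t) & hull t (diff t)].
Proof.
split; [exists 1, 0, 0|exists 0, 1, 0|exists 0, 0, 1]; split=> //;
  rewrite ?addr0 ?add0r //; apply: point_ext; rewrite !coordE; ring.
Qed.

(** The folding sends both tiles back to [Uz], where they come from tiles that
    overlap and hence are equal. The two symmetries that were used agree near
    the common point, hence at the vertices. *)
Lemma tiling_disjoint n t t' x : tiling z n t -> tiling z n t' ->
  intr t x -> intr t' x -> t = t'.
Proof.
move=> ht [g' [u' [hg' hu' et']]] it it'; case: (ht) => g [u [hg hu et]].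
have [ag ag'] := (refl_group_affine hg, refl_group_affine hg').
have t'0 : area t' != 0.
  by apply: (@area_shape _ n); apply: (@tiling_shape _ z); exists g', u'.
have Fu y y' : intr u y -> intr u' y' -> g y = g' y' -> y = y'.
  move=> iy iy' e; apply: hF.2.
  - by apply: (inside_hull hu); exact: intr_hull.
  - by apply: (inside_hull hu'); exact: intr_hull.
  by rewrite -(folding_group y hg) -(folding_group y' hg') e.
have [y iy ey] : exists2 y, intr u y & x = g y by apply: intr_map; rewrite -?et.
have [y' iy' ey'] : exists2 y, intr u' y & x = g' y.
  by apply: intr_map; rewrite -?et'.
have uu' : u = u'.
  apply: (inside_disjoint (x := y) hu hu') => //.
  by rewrite (Fu y y') // -ey -ey'.
have eyy : y = y' by apply: Fu; rewrite // -ey -ey'.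
have vert w : hull u w -> g w = g' w.
  move=> hw; have u0 : area u != 0 by apply: (@area_shape _ n); exact: inside_shape hu.
  have [a a0 ha] := intr_move (g w - g y) t'0 it'.
  pose b := Num.min a (1 / 2).
  have b0 : 0 < b by rewrite lt_min a0 divr_gt0.
  have b1 : b < 1 by rewrite gt_min; apply/orP; right; lra.
  have : intr t' (x + b *: (g w - g y)) by apply: ha; rewrite ltW //= ge_min lexx.
  rewrite ey -affine2 // et' => /(intr_map ag')[y2 iy2 e2].
  have e3 : y + b *: (w - y) = y2.
    by apply: Fu => //; apply: intr_toward => //; rewrite ltW.
  move: e2; rewrite -e3 !affine2 // -ey eyy -ey' => /addrI.
  move/(scalerI (lt0r_neq0 b0)) => /eqP.
  by rewrite (inj_eq (addIr _)) => /eqP.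
have [h1 h2 h3] := vertices_hull u.
by rewrite et et' -uu' /map_tile !vert.
Qed.

(** Hence the level [n] tiling determines the next one: a large tile forms a
    large tile with its partner when that partner belongs to the tiling, and
    otherwise is a small tile of the next level. *)
Lemma tilingS n T : tiling z n.+1 T <->
  (exists t, [/\ tiling z n t, small t & T = compose n false t]) \/
  (exists t, [/\ tiling z n t, ~~ small t, ~ tiling z n (partner n t) &
     T = compose n true t]).
Proof.
split=> [hT|[[t [ht st ->]]|[t [ht st nt ->]]]].
- case sT: (small T); [right|left].
    have pT : parts n T (large_part n T) by rewrite /parts sT.
    exists (large_part n T); rewrite small_large_part; split=> //.
    + exact: tiling_parts pT.
    + move=> hp; have [T' hT' pT'] := tiling_parent hp.
      have sT' : small T' = false.
        by apply: parts_small pT' _; rewrite small_partner small_large_part.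
      have := parts_partner pT' sT'; rewrite partnerK => pT2.
      have := intr_center (large_part n T); set x := center _ => ix.
      have eT : T = T'.
        apply: (tiling_disjoint (x := x) hT hT').
          exact: (parts_intr pT ix).
        exact: (parts_intr pT2 ix).
      by rewrite eT sT' in sT.
    + by rewrite (parts_inv pT) sT.
  have pT : parts n T (partner n (large_part n T)) by rewrite /parts sT; right.
  exists (partner n (large_part n T)); split=> //.
  + exact: tiling_parts pT.
  + by rewrite small_partner small_large_part.
  + by rewrite -[in compose _ _]sT; exact: parts_inv pT.
- have [T' hT' pT'] := tiling_parent ht.
  by rewrite -(parts_small pT' st) -(parts_inv pT').
- have [T' hT' pT'] := tiling_parent ht.
  have sT' : small T' = true.
    apply: contra_notT nt => /negbTE sT'; apply: tiling_parts hT' _.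
    exact: parts_partner.
  by rewrite -sT' -(parts_inv pT').
Qed.

End Folding.

Section Isometry.
Variables (z z' : penrose_seq) (F F' : point -> point) (sigma : point -> point).
Hypotheses (hF : folding z F) (hF' : folding z' F').
Hypothesis si : plane_isometry sigma.
Hypothesis s0 : map_tile sigma @` tiling z 0 = tiling z' 0.

Lemma map_tiling n : map_tile sigma @` tiling z n = tiling z' n.
Proof.
have as_ := isometry_affine si.
have inj := map_tile_inj (isometry_inj si).
elim: n => // n IH; have E t : tiling z' n (map_tile sigma t) <-> tiling z n t.
  by rewrite -IH; split=> [[u hu /inj <-]|ht] //; exists t.
apply/seteqP; split=> [_ [T /(tilingS hF) hT <-]|T /(tilingS hF') hT].
  apply/(tilingS hF'); case: hT => -[t []].
    move=> ht st ->; left; exists (map_tile sigma t); split=> //.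
      exact/E.
    exact: map_compose.
  move=> ht st nt ->; right; exists (map_tile sigma t); split=> //.
  - exact/E.
  - by rewrite -map_partner // => /E.
case: hT => -[t' []]; rewrite -IH => -[t ht <-] /=.
  move=> st ->; exists (compose n false t); last exact: map_compose.
  by apply/(tilingS hF); left; exists t.
move=> st nt ->; exists (compose n true t); last exact: map_compose.
apply/(tilingS hF); right; exists t; split=> // hp; apply: nt.
by exists (partner n t); rewrite ?map_partner.
Qed.

(** The tile of the first tiling around a point and that of the second one
    around its image agree from some level on, up to a symmetry of the second
    tiling. *)
Lemma tail_eq_isometry : tail_eq z z'.
Proof.
have as_ := isometry_affine si.
have : tiling z' 0 (map_tile sigma (tz R z 0)).
  by rewrite -s0; exists (tz R z 0) => //; apply/tiling_inside/inside_tz.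
move=> [g [u [hg [j hu] e0]]]; exists j => n jn.
have tz_mono m k : intr (tz R z m) `<=` intr (tz R z (m + k)).
  elim: k => [|k IH]; rewrite ?addn0 // addnS.
  exact: subset_trans IH (parts_intr (parts_tz R z _)).
have sub m i t : subtiles z' i m t -> intr t `<=` intr (tz R z' (m + i)).
  elim: i m t => [|i IH] m t /=; first by move=> ->; rewrite addn0.
  move=> [T /IH hT pt]; rewrite addnS -addSn.
  exact: subset_trans (parts_intr pt) hT.
have ag := refl_group_affine hg.
have e : map_tile sigma (tz R z n) = map_tile g (tz R z' n).
  pose x := center (map_tile sigma (tz R z 0)).
  have ix : intr (map_tile sigma (tz R z 0)) x by exact: intr_center.
  apply: (tiling_disjoint hF' (n := n) (x := x)).
  - by rewrite -map_tiling; exists (tz R z n) => //; apply/tiling_inside/inside_tz.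
  - by exists g, (tz R z' n); split=> //; exact: inside_tz.
  - have [y iy ->] := intr_map as_ ix; apply: map_intr => //.
    exact: (@tz_mono 0%N n).
  - move: ix; rewrite e0 => /(intr_map ag)[y iy ->]; apply: map_intr => //.
    by apply: (sub 0%N n u _ y iy); rewrite -(subnKC jn); exact: subtiles_mono.
by rewrite -(small_tz R z n) -(small_tz R z' n); exact: (congr1 (@small R) e).
Qed.

End Isometry.
End Composition.

(** * Edges shared by two tiles *)

Section Edges.
Variable R : realType.
Local Notation point := (R * R)%type.
Local Notation tau := (tau R).
Local Notation tile := (tile R).
Implicit Types (p q x y w : point) (a b c l : R) (f g : point -> point).
Implicit Types (t T L S : tile) (n : nat) (h : bool).

Local Notation edge := (nat * point * point)%type.
Implicit Types (e E : edge).

(** The edges of a tile, each with a kind from 1 to 4 and an orientation. At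
    level 0 the kinds 1 and 2 are the edges with endpoints of the same color of
    the large and of the small tile, and the kinds 3 and 4 are the edges of
    length tau and 1 from black to white. The kinds at the other levels are
    chosen so that the kind and the orientation of an edge determine how it is
    divided at the previous level; see [subedges]. *)
Definition edges n t : seq edge :=
  if odd n then
    if small t then
      [:: (1, same t, apex t); (2, apex t, diff t); (4, same t, diff t)]
    else [:: (1, apex t, same t); (2, apex t, diff t); (3, same t, diff t)]
  else
    if small t then
      [:: (2, apex t, same t); (3, diff t, same t); (4, diff t, apex t)]
    else [:: (1, apex t, same t); (3, apex t, diff t); (4, same t, diff t)].

Definition subedges n e : seq edge :=
  let: (i, p, q) := e in
  let m := p + tau^-1 *: (q - p) in
  if odd n then
    match i with
    | 1 => [:: (2, m, p); (4, m, q)]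
    | 2 => [:: (1, p, q)]
    | 3 => [:: (3, q, p)]
    | _ => [:: (2, q, p)]
    end
  else
    match i with
    | 1 => [:: (1, q, p)]
    | 2 => [:: (3, p, q)]
    | 3 => [:: (3, p, m); (2, m, q)]
    | _ => [:: (4, p, q)]
    end.

Ltac subedge_of on e :=
  solve [right; exists e; [by rewrite ?inE ?eqxx ?orbT
    | by rewrite /subedges ?on ?inE ?eqxx ?orbT]].

(** An edge of a part either separates it from the other part or lies on an edge
    of the larger tile. *)
Lemma edges_parts n T t e : parts n T t -> e \in edges n t ->
  (parts n T (partner n t) /\ e \in edges n (partner n t)) \/
  exists2 E, E \in edges n.+1 T & e \in subedges n E.
Proof.
move=> pt; have pt' := parts_partner pt.
case: T pt pt' => [] [] p q x; rewrite /parts /=.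
  move=> -> _; rewrite /large_part /edges /=; case on: (odd n) => /=;
  rewrite !inE => /or3P[] /eqP ->;
  first [subedge_of on (1%N, q, p) | subedge_of on (2%N, p, x)
        |subedge_of on (2%N, p, q) | subedge_of on (3%N, x, q)
        |subedge_of on (4%N, q, x) | subedge_of on (4%N, x, p)].
move=> [] -> /(_ erefl) pt; rewrite ?partnerK ?small_partE // in pt *;
  rewrite /large_part /edges /= in pt *; case on: (odd n) pt => /= pt;
  rewrite !inE => /or3P[] /eqP ->;
  first [by left; split=> //; rewrite ?inE ?eqxx ?orbT
        |subedge_of on (1%N, p, q) | subedge_of on (2%N, p, x)
        |subedge_of on (3%N, q, x) | subedge_of on (3%N, p, x)
        |subedge_of on (4%N, q, x)].
Qed.

Lemma subedges_parts n T E e : E \in edges n.+1 T -> e \in subedges n E ->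
  exists2 t, parts n T t & e \in edges n t.
Proof.
case: T => [] [] p q x; rewrite /edges /= /parts /=.
  move=> h1 h2; exists (large_part n (Tile true p q x)) => //=.
  rewrite ?small_large_part ?/large_part /=; move: h1 h2.
  by case on: (odd n) => /=; rewrite !inE => /or3P[] /eqP ->;
    rewrite /subedges on !inE => /eqP ->; rewrite eqxx ?orbT.
move=> h1 h2.
have [el|el] := boolP (e \in edges n (large_part n (Tile false p q x))).
  by exists (large_part n (Tile false p q x)) => //; left.
exists (partner n (large_part n (Tile false p q x))); first by right.
move: h1 h2 el; rewrite /edges small_partner small_large_part small_partE //=.
rewrite /large_part /=.
by case on: (odd n) => /=; rewrite !inE => /or3P[] /eqP ->;
    rewrite /subedges on !inE; first [move/eqP=> -> | case/orP=> /eqP ->];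
    rewrite ?eqxx ?orbT.
Qed.

End Edges.

Section Matching.
Variable R : realType.
Local Notation point := (R * R)%type.
Local Notation tau := (tau R).
Local Notation tile := (tile R).
Implicit Types (p q x y w v : point) (a b c l : R) (f g : point -> point).
Implicit Types (t T L S : tile) (n : nat) (h : bool).
Local Notation edge := (nat * point * point)%type.
Implicit Types (e E : edge).

Lemma bary_move t x y :
  [/\ bary_apex t y = bary_apex t x + cross (y - x) (same t - diff t) / area t,
      bary_same t y = bary_same t x + cross (y - x) (diff t - apex t) / area t &
      bary_diff t y = bary_diff t x + cross (y - x) (apex t - same t) / area t].
Proof.
by split; rewrite /bary_apex /bary_same /bary_diff -mulrDl /cross !coordE;
  congr (_ / _); ring.
Qed.

(** [p] and [q] are on the line through one edge of [T]. *)
Definition on_edge T p q :=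
  [\/ bary_apex T p = 0 /\ bary_apex T q = 0,
      bary_same T p = 0 /\ bary_same T q = 0 |
      bary_diff T p = 0 /\ bary_diff T q = 0].

Lemma on_edge_edges n T e : area T != 0 -> e \in edges n T -> on_edge T e.1.2 e.2.
Proof.
move=> T0; have [a1 s1 d1] : [/\ bary_apex T (apex T) = 1,
    bary_same T (apex T) = 0 & bary_diff T (apex T) = 0].
  by apply: baryE => //; [ring|apply: point_ext; rewrite !coordE; ring].
have [a2 s2 d2] : [/\ bary_apex T (same T) = 0,
    bary_same T (same T) = 1 & bary_diff T (same T) = 0].
  by apply: baryE => //; [ring|apply: point_ext; rewrite !coordE; ring].
have [a3 s3 d3] : [/\ bary_apex T (diff T) = 0,
    bary_same T (diff T) = 0 & bary_diff T (diff T) = 1].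
  by apply: baryE => //; [ring|apply: point_ext; rewrite !coordE; ring].
rewrite /edges; case: (odd n); case: (small T); rewrite !inE => /or3P[] /eqP -> /=;
  first [by constructor 1 | by constructor 2 | by constructor 3].
Qed.

Lemma on_edge_subedges n T E e : e \in subedges n E ->
  on_edge T E.1.2 E.2 -> on_edge T e.1.2 e.2.
Proof.
case: E => [[i p] q] /=; set m := p + _ => he h.
have hm : [/\ bary_apex T p = 0 -> bary_apex T q = 0 -> bary_apex T m = 0,
    bary_same T p = 0 -> bary_same T q = 0 -> bary_same T m = 0 &
    bary_diff T p = 0 -> bary_diff T q = 0 -> bary_diff T m = 0].
  have crossZ v (w : point) a : cross (a *: v) w / area T = a * (cross v w / area T).
    by rewrite mulrA /cross !coordE; congr (_ / _); ring.
  have [-> -> ->] := bary_move T p q; have [-> -> ->] := bary_move T p m.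
  have -> : m - p = tau^-1 *: (q - p) by rewrite /m addrAC subrr add0r.
  rewrite !crossZ.
  by split=> ->; rewrite !add0r => ->; rewrite mulr0.
have [h1 h2 h3] : [/\ on_edge T p m, on_edge T m p & on_edge T m q].
  by case: hm h => h1 h2 h3 [] [e1 e2]; split;
    first [constructor 1; split; solve [done | exact: h1]
          |constructor 2; split; solve [done | exact: h2]
          |constructor 3; split; solve [done | exact: h3]].
have h4 : on_edge T q p by case: h => -[? ?]; [constructor 1|constructor 2|constructor 3].
move: he; case: (odd n); case: i => [|[|[|[|i]]]]; rewrite !inE;
  first [move/eqP=> -> | case/orP=> /eqP ->]; by [].
Qed.

Section Inside.
Variable z : penrose_seq.
Local Notation tz := (tz R z).
Local Notation Uz := (@Uz R z).

(** An edge in the interior of [tz (n + j)] belongs to two of its tiles: two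
    tiles with a common edge divide it in the same way. *)
Lemma subtiles_edge j n t e : subtiles z j n t -> e \in edges n t ->
  (exists t', [/\ subtiles z j n t', t' <> t & e \in edges n t']) \/
  on_edge (tz (n + j)) e.1.2 e.2.
Proof.
elim: j n t e => [|j IH] n t e.
  move=> -> he; right; rewrite addn0; apply: on_edge_edges he.
  exact: area_shape (shape_tz R z n).
move=> [T hT pt] he.
have [[pt' he']|[E hE eE]] := edges_parts pt he.
  left; exists (partner n t); split=> //; first by exists T.
  by move=> e'; have := small_partner n t; rewrite e'; case: (small t).
have [[T' [hT' TT' hE']]|oE] := IH _ _ _ hT hE; last first.
  by right; rewrite addnS -addSn; exact: on_edge_subedges eE oE.
have [t' pt' he'] := subedges_parts hE' eE.
left; exists t'; split=> //; first by exists T'.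
move=> tt'; apply: TT'; apply: (subtiles_disjoint (x := center t) hT' hT).
  by rewrite -tt'; exact: (parts_intr pt' (intr_center _)).
exact: (parts_intr pt (intr_center _)).
Qed.

Lemma edge_center n t e : e \in edges n t ->
  cross (e.2 - e.1.2) (center t - e.1.2) ^+ 2 = (area t / 3) ^+ 2.
Proof.
rewrite /edges; case: (odd n); case: (small t); rewrite !inE => /or3P[] /eqP -> /=;
  rewrite /cross /area /center /cross !coordE; by field.
Qed.

Lemma interior_move (U : set point) x v : interior U x ->
  exists2 a, 0 < a & U (x + a *: v).
Proof.
rewrite /interior /= => /nbhs_ballP[r /= r0 hU].
exists (r / 2 / (1 + `|v.1| + `|v.2|)); last apply: hU.
  by rewrite !divr_gt0 // -addrA ltr_pwDl // addr_ge0.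
set a := _ / _; have a0 : 0 <= a.
  by rewrite !divr_ge0 ?addr_ge0 // ltW.
have k (u : R) : `|u| <= 1 + `|v.1| + `|v.2| -> `|a * u| < r.
  move=> hu; rewrite normrM ger0_norm //.
  apply: (@le_lt_trans _ _ (r / 2)); last lra.
  have K0 : 0 < 1 + `|v.1| + `|v.2| by rewrite -addrA ltr_pwDl // addr_ge0.
  by rewrite /a mulrAC ler_pdivrMr // ler_wpM2l // divr_ge0 // ltW.
split; rewrite -ball_normE /= opprD addrA subrr sub0r normrN /GRing.scale /=;
  apply: k; have := normr_ge0 v.1; have := normr_ge0 v.2; lra.
Qed.

(** If no other tile has this edge, it stays on the boundary of all large
    [tz N], so that the region [Uz] lies on one side of the line through it. *)
Lemma inside_edge n t e : inside z n t -> e \in edges n t ->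
  (exists t', [/\ inside z n t', t' <> t & e \in edges n t']) \/
  wall z e.1.2 e.2.
Proof.
move=> ht he; case: (pselect (exists t', [/\ inside z n t', t' <> t & e \in edges n t'])).
  by left.
move=> none; right; have [j0 hj0] := ht.
have t0 : area t != 0 := area_shape (inside_shape ht).
have onN j : (j0 <= j)%N -> on_edge (tz (n + j)) e.1.2 e.2.
  move=> jj; have hj : subtiles z j n t by rewrite -(subnKC jj); exact: subtiles_mono.
  have [[t' [ht' tt' he']]|//] := subtiles_edge hj he.
  by case: none; exists t'; split=> //; exists j.
set p := e.1.2 in onN *; set q := e.2 in onN *; set c := center t.
have c2 : cross (q - p) (c - p) ^+ 2 = (area t / 3) ^+ 2 := edge_center he.
have c0 : cross (q - p) (c - p) != 0.
  by rewrite -sqrf_eq0 c2 sqrf_eq0 mulf_neq0 ?invr_eq0 ?pnatr_eq0.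
have side y : Uz y -> 0 <= cross (q - p) (c - p) * cross (q - p) (y - p).
  move=> [m _ hy]; pose j := (j0 + m)%N.
  have hy' : hull (tz (n + j)) y.
    have hmono k : hull (tz m) `<=` hull (tz (m + k)).
      elim: k => [|k IH]; rewrite ?addn0 // addnS.
      exact: subset_trans IH (parts_hull (parts_tz R z _)).
    by rewrite /j addnA addnC; exact: hmono hy.
  have hc : intr (tz (n + j)) c.
    have sub i k u : subtiles z i k u -> intr u `<=` intr (tz (k + i)).
      elim: i k u => [|i IH] k u /=; first by move=> ->; rewrite addn0.
      move=> [T /IH hT pt]; rewrite addnS -addSn.
      exact: subset_trans (parts_intr pt) hT.
    apply: (sub j n t); last exact: intr_center.
    exact: subtiles_mono.
  have T0 : area (tz (n + j)) != 0 := area_shape (shape_tz R z _).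
  move: hy' hc => /(hullP _ T0)[ya ys yd] /(intrP _ T0)[ca cs cd].
  have key (F : point -> R) w : (forall y, F y = F p + cross (y - p) w / area (tz (n + j))) ->
      F p = 0 -> F q = 0 -> 0 <= F y -> 0 < F c ->
      0 <= cross (q - p) (c - p) * cross (q - p) (y - p).
    move=> FE Fp Fq Fy Fc; have e1 : cross (q - p) w / area (tz (n + j)) = 0.
      by move: Fq; rewrite FE Fp add0r.
    have e2 : F c * cross (q - p) (y - p) = F y * cross (q - p) (c - p).
      apply/eqP; rewrite -subr_eq0; apply/eqP.
      rewrite (FE c) (FE y) Fp !add0r; transitivity (cross (c - p) (y - p) * (cross (q - p) w / area (tz (n + j)))).
        by rewrite /cross !coordE; field.
      by rewrite e1 mulr0.
    rewrite -(pmulr_rge0 _ Fc) mulrCA e2 mulrCA mulr_ge0 //.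
    by rewrite -expr2 sqr_ge0.
  have Ea y' := let: And3 h _ _ := bary_move (tz (n + j)) p y' in h.
  have Es y' := let: And3 _ h _ := bary_move (tz (n + j)) p y' in h.
  have Ed y' := let: And3 _ _ h := bary_move (tz (n + j)) p y' in h.
  have [] := onN j (leq_addr _ _) => -[e1 e2].
  - exact: (key _ _ Ea).
  - exact: (key _ _ Es).
  - exact: (key _ _ Ed).
have pq : p <> q.
  by move=> e'; case/eqP: c0; rewrite -e' subrr /cross !coordE; ring.
have inU x : segment p q x -> Uz x.
  move=> hx; apply: (inside_hull ht).
  have [va vs vd] := vertices_hull t.
  have conv u v : hull t u -> hull t v -> segment u v x -> hull t x.
    move=> /(hullP _ t0)[u1 u2 u3] /(hullP _ t0)[v1 v2 v3] [a /= /andP[a0 a1] <-].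
    have cr w : cross (u + a *: (v - u) - u) w / area t = a * (cross (v - u) w / area t).
      by rewrite mulrA /cross !coordE; congr (_ / _); ring.
    have [ea es ed] := bary_move t u (u + a *: (v - u)).
    have [ea' es' ed'] := bary_move t u v.
    apply/hullP => //; rewrite ea es ed !cr; split; nra.
  by apply: conv hx; move: he; rewrite /p /q /edges; case: (odd n); case: (small t);
    rewrite !inE => /or3P[] /eqP ->.
split=> // x hx; split; first by apply: subset_closure; exact: inU.
move=> /(interior_move (x - c))[a a0 /side].
have -> : cross (q - p) (x + a *: (x - c) - p) = - a * cross (q - p) (c - p).
  by case: hx => b _ <-; rewrite /cross !coordE; ring.
rewrite mulrCA -expr2 mulNr oppr_ge0 leNgt mulr_gt0 //.
by rewrite lt_def sqrf_eq0 c0 sqr_ge0.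
Qed.

End Inside.
End Matching.

(** * Recovery of the tiles from the kites and darts *)

Section Mirror.
Variable R : realType.
Local Notation point := (R * R)%type.
Local Notation tau := (tau R).
Local Notation tile := (tile R).
Implicit Types (p q x y w v : point) (a b c l : R) (f g : point -> point).
Implicit Types (t T L S s : tile) (n : nat) (h : bool).

Lemma dot_neq0 p q : p <> q -> dot (q - p) (q - p) != 0.
Proof. by move=> pq; rewrite gt_eqF // dot_gt0 // subr_eq0; apply/eqP => /esym. Qed.

Lemma reflect_map g p q x : plane_isometry g -> p <> q ->
  reflect_line (g p) (g q) (g x) = g (reflect_line p q x).
Proof.
move=> ig pq; have ag := isometry_affine ig.
rewrite /reflect_line !isometry_dot //; set k := _ / _.
have -> : (p + k *: (q - p)) *+ 2 - x = (2 * (1 - k)) *: p + (2 * k) *: q + (-1) *: x.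
  by apply: point_ext; rewrite mulr2n !coordE; ring.
rewrite ag; last by ring.
by apply: point_ext; rewrite mulr2n !coordE; ring.
Qed.

Lemma reflect_fix p q : p <> q ->
  reflect_line p q p = p /\ reflect_line p q q = q.
Proof.
move=> pq; have d0 := dot_neq0 pq; rewrite /reflect_line.
have -> : dot (p - p) (q - p) = 0 by rewrite subrr /dot !coordE; ring.
by rewrite divff // mul0r; split; apply: point_ext; rewrite mulr2n !coordE; ring.
Qed.

(** Two circles meet in at most two points, symmetric in the line through the
    centers. *)
Lemma circles_meet p q x y : p <> q ->
  dot (x - p) (x - p) = dot (y - p) (y - p) ->
  dot (x - q) (x - q) = dot (y - q) (y - q) ->
  x = y \/ x = reflect_line p q y.
Proof.
move=> pq h1 h2; have d0 := dot_neq0 pq.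
have [r1 r2] := reflect_fix pq.
have e1 : dot (x - p) (q - p) = dot (y - p) (q - p).
  have E w : dot (w - q) (w - q) = dot (w - p) (w - p) + dot (q - p) (q - p)
      - 2 * dot (w - p) (q - p) by rewrite /dot !coordE; ring.
  by move: h2; rewrite !E h1; lra.
have e2 : cross (q - p) (x - p) ^+ 2 = cross (q - p) (y - p) ^+ 2.
  have E w : cross (q - p) (w - p) ^+ 2 = dot (w - p) (w - p) * dot (q - p) (q - p)
      - dot (w - p) (q - p) ^+ 2 by rewrite /dot /cross !coordE; ring.
  by rewrite !E h1 e1.
have D w : w = p + (dot (w - p) (q - p) / dot (q - p) (q - p)) *: (q - p)
    + (cross (q - p) (w - p) / dot (q - p) (q - p)) *: (- (q - p).2, (q - p).1).
  move: d0; rewrite /dot /cross => d0.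
  by apply: point_ext; rewrite !coordE /= in d0 *; field.
move/eqP: e2; rewrite eqf_sqr => /orP[] /eqP e2; [left|right].
  by rewrite (D x) (D y) e1 e2.
rewrite [LHS]D e1 e2 /reflect_line [X in _ = _ - X]D.
by apply: point_ext; rewrite mulr2n !coordE /=; ring.
Qed.

Definition mirror t := map_tile (reflect_line (apex t) (same t)) t.

Lemma apex_same n t : shape n t -> apex t <> same t.
Proof.
move=> ht e; have /negP[] := area_shape ht; apply/eqP.
by rewrite /area /cross !coordE e; ring.
Qed.

Lemma mirrorE n t : shape n t ->
  mirror t = Tile (small t) (apex t) (same t) (reflect_line (apex t) (same t) (diff t)).
Proof. by move/apex_same/reflect_fix => [e1 e2]; rewrite /mirror /map_tile e1 e2. Qed.

Lemma map_mirror g n t : plane_isometry g -> shape n t ->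
  map_tile g (mirror t) = mirror (map_tile g t).
Proof.
by move=> ig /apex_same h; rewrite /mirror /map_tile /= !reflect_map.
Qed.

(** The edge from the apex to [same u] is on a wall, or it is an edge of the
    same kind of another tile. That tile is then of the same size and attached
    to the edge in the same orientation, hence the mirror image. *)
Lemma mirror_tiling z t : tiling z 0 t -> tiling z 0 (mirror t).
Proof.
move=> [g [u [hg hu ->]]]; have hs := inside_shape hu.
rewrite -(map_mirror (refl_group_isometry hg) hs).
have nu := apex_same hs.
pose e := ((if small u then 2 else 1)%N, apex u, same u).
have he : e \in edges 0 u by rewrite /edges /e /=; case: (small u); rewrite inE eqxx.
have [[t' [ht' tu he']]|hw] := inside_edge hu he; last first.
  exists (g \o reflect_line (apex u) (same u)), u; split=> //.
  elim: hg => [|p q {}g hpq hg IH]; last first.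
    exact: refl_group_comp hpq IH.
  exact: (refl_group_comp hw (@refl_group_id _ z)).
exists g, t'; split=> //; congr (map_tile g _).
have [s1 s2] : small t' = small u /\ [/\ apex t' = apex u & same t' = same u].
  move: he'; rewrite /e /edges /=; case: (small u); case: (small t');
   by rewrite !inE => /or3P[] /eqP // => -[-> ->].
have hs' := inside_shape ht'; rewrite (mirrorE hs) [t']tile_eta s1 s2.1 s2.2.
case: hs (hs') => h1 h2 h3; rewrite /shape s1 /isosceles s2.1 s2.2 => -[_ h2' h3'].
have [e2|-> //] : diff t' = diff u \/ diff t' = reflect_line (apex u) (same u) (diff u).
  apply: circles_meet => //; first by rewrite h2 h2'.
  have E v : dot (v - same u) (v - same u) = dot (v - apex u) (v - apex u)
     + dot (same u - apex u) (same u - apex u) - 2 * dot (same u - apex u) (v - apex u).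
    by rewrite /dot !coordE; ring.
  by rewrite !E h2 h3 h2' h3'.
by case: tu; rewrite [t']tile_eta [u]tile_eta s1 s2.1 s2.2 e2.
Qed.

End Mirror.

Section Kites.
Variable R : realType.
Local Notation point := (R * R)%type.
Local Notation tau := (tau R).
Local Notation tile := (tile R).
Implicit Types (p q x y w v : point) (a b c l : R) (f g : point -> point).
Implicit Types (t T L S s : tile) (n : nat) (h : bool).

Lemma same_color_edgeP p q t : same_color_edge p q t ->
  (p = apex t /\ q = same t) \/ (p = same t /\ q = apex t).
Proof.
move=> [pq [c [hp hq]]]; rewrite /colored_vertices in hp hq.
set c0 := (if small t then White else Black) in hp hq.
have ne : swap c0 <> c0 by rewrite /c0; case: (small t).
case: hp => [[[ep ec]|[ep ec]]|[ep ec]]; case: hq => [[[eq ec']|[eq ec']]|[eq ec']];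
  subst; try (by left); try (by right); try (by case: pq).
all: by case: ne; congruence.
Qed.

Lemma same_color_edge_apex n t : shape n t -> same_color_edge (apex t) (same t) t.
Proof.
move/apex_same => h; split=> //.
by exists (if small t then White else Black); split; left; [left|right].
Qed.

Lemma leg0 (s : bool) : leg R 0 s ^+ 2 = if s then 1 else tau + 1.
Proof. by rewrite /leg expr0 mul1r; case: s => /=; rewrite ?expr1n ?tau2. Qed.

Lemma cos_apex_lt1 h : cos_apex R h < 1.
Proof. have := tau_gt1 R; have := tau_lt2 R; rewrite /cos_apex; case: h; lra. Qed.
Lemma cos_apex_gtN1 h : -1 < cos_apex R h.
Proof. have := tau_gt1 R; have := tau_lt2 R; rewrite /cos_apex; case: h; lra. Qed.

(** Two tiles of a level 0 tiling that share an edge with endpoints of the same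
    color are mirror images: turning one of them around would make it overlap
    the other one or its mirror image. *)
Lemma mate_mirror z (F : point -> point) t t' p q : folding z F -> tiling z 0 t -> tiling z 0 t' ->
  t <> t' -> same_color_edge p q t -> same_color_edge p q t' -> t' = mirror t.
Proof.
move=> hF ht ht' tt' /same_color_edgeP pt /same_color_edgeP pt'.
have [st st'] := (tiling_shape ht, tiling_shape ht').
have P : (apex t' = apex t /\ same t' = same t) \/
         (apex t' = same t /\ same t' = apex t).
  by case: pt => -[-> ->] in pt' *; case: pt' => -[-> ->]; [left|right|right|left].
have sz : small t' = small t.
  have : leg R 0 (small t') ^+ 2 = leg R 0 (small t) ^+ 2.
    case: st st' => <- _ _ [<- _ _]; case: P => -[-> ->] //.
    by rewrite /dot !coordE; ring.
  by rewrite !leg0; have := tau_gt1 R; clear tt' pt pt' P;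
    case: (small t); case: (small t') => // *; lra.
have nt := apex_same st; have nt' : same t <> apex t by move/esym.
rewrite (mirrorE st) [t']tile_eta sz.
have := st; have := st'; rewrite /shape sz /isosceles; set l := leg _ _ _ ^+ 2.
set k := cos_apex _ _.
case: P => -[Pa Ps]; rewrite Pa Ps => -[h1' h2' h3'] [h1 h2 h3].
  have [e|-> //] : diff t' = diff t \/ diff t' = reflect_line (apex t) (same t) (diff t).
    apply: circles_meet => //; first by rewrite h2 h2'.
    have E v : dot (v - same t) (v - same t) = dot (v - apex t) (v - apex t)
       + dot (same t - apex t) (same t - apex t) - 2 * dot (same t - apex t) (v - apex t).
      by rewrite /dot !coordE; ring.
    by rewrite !E h2 h3 h2' h3'.
  have /= E := tile_eta t'; rewrite sz Pa Ps e in E.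
  by case: tt'; rewrite E; case: (t).
pose P := apex t; pose Q := same t; pose D := diff t.
pose m := 1 - 2 * k; pose E := D + m *: (Q - P).
(* u is t turned around: E is the mirror image of D in the perpendicular bisector
   of P and Q. X is an interior point of both t and u. *)
have [m1 m2] : -3 < m /\ m < 3.
  by rewrite /m; have := cos_apex_lt1 (small t == odd 0); have := cos_apex_gtN1 (small t == odd 0); rewrite -/k; lra.
pose u := Tile (small t) Q P E.
pose X := (3 / 8 - m / 8) *: P + (3 / 8 + m / 8) *: Q + (1 / 4) *: D.
have iX : intr t X by exists (3 / 8 - m / 8), (3 / 8 + m / 8), (1 / 4); split=> //; lra.
have iX' : intr u X.
  exists (3 / 8 - m / 8), (3 / 8 + m / 8), (1 / 4); split; [lra|lra|lra|lra|].
  by rewrite /X /= /E; apply: point_ext; rewrite !coordE; field.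
have G v w a : dot (w + a *: v) (w + a *: v) =
    dot w w + 2 * a * dot v w + a ^+ 2 * dot v v by rewrite /dot !coordE; ring.
have [e|e] : diff t' = E \/ diff t' = reflect_line Q P E.
  apply: circles_meet; first by [].
    rewrite h2'; have -> : E - Q = (D - P) + (- (2 * k)) *: (Q - P).
      by apply: point_ext; rewrite !coordE /m; ring.
    by rewrite G h1 h2 h3; ring.
  have -> : E - P = (D - P) + m *: (Q - P).
    by apply: point_ext; rewrite !coordE; ring.
  have -> : diff t' - P = (diff t' - Q) + (-1) *: (P - Q).
    by apply: point_ext; rewrite !coordE; ring.
  have h1'' : dot (P - Q) (P - Q) = l by rewrite -h1 /dot !coordE; ring.
  by rewrite !G h1 h2 h3 h1'' h2' h3' /m; ring.
- have /= Et := tile_eta t'; rewrite sz Pa Ps e -/Q -/P -/u in Et.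
  by case: tt'; apply: (tiling_disjoint hF (x := X) ht ht'); rewrite // Et.
have ir := isometry_reflect nt'.
have Et : t' = map_tile (reflect_line Q P) u.
  have [r1 r2] := reflect_fix nt'.
  by rewrite [LHS]tile_eta sz Pa Ps e /map_tile /= r1 r2.
have e' : reflect_line Q P = reflect_line P Q.
  apply/funext => x; rewrite /reflect_line; have d0 := dot_neq0 nt.
  have d0' := dot_neq0 nt'; move: d0 d0'; rewrite -/P -/Q /dot => d0 d0'.
  by apply: point_ext; rewrite !mulr2n !coordE in d0 d0' *; field; rewrite d0.
have : t' = mirror t.
  apply: (tiling_disjoint hF (x := reflect_line Q P X) ht' (mirror_tiling ht)).
    by rewrite Et; apply: map_intr => //; exact: isometry_affine.
  rewrite e' /mirror; apply: map_intr iX; apply: isometry_affine.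
  exact: isometry_reflect.
by rewrite (mirrorE st) => <-; rewrite -sz -Pa -Ps -tile_eta.
Qed.

(** The kite or dart of a level 0 tile *)
Definition kite t : set point := hull t `|` hull (mirror t).

(** Coordinates along the axis of symmetry of the kite or dart and
    perpendicular to it *)
Definition kite_point t a b : point :=
  apex t + a *: (same t - apex t)
  + b *: (diff t - apex t - cos_apex R (small t == false) *: (same t - apex t)).

Lemma mirror_diff t : shape 0 t ->
  diff (mirror t) = apex t *+ 2
    + (2 * cos_apex R (small t == false)) *: (same t - apex t) - diff t.
Proof.
move=> st; have d0 := dot_neq0 (apex_same st).
rewrite /mirror /= /reflect_line; case: st => h1 h2; rewrite dotC => h3.
rewrite h3 h1 mulfK; last by rewrite -h1.
by apply: point_ext; rewrite !mulr2n !coordE /=; ring.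
Qed.

Lemma kite_point_inj t a b a' b' : area t != 0 ->
  kite_point t a b = kite_point t a' b' -> a = a' /\ b = b'.
Proof.
move=> t0; set k := cos_apex R (small t == false).
have E a0 b0 : [/\ bary_apex t (kite_point t a0 b0) = 1 - (a0 - k * b0) - b0,
    bary_same t (kite_point t a0 b0) = a0 - k * b0 &
    bary_diff t (kite_point t a0 b0) = b0].
  apply: baryE => //; first by ring.
  by apply: point_ext; rewrite /kite_point -/k !coordE; ring.
have [_ e1 e2] := E a b; have [_ e1' e2'] := E a' b'.
by move=> e; rewrite e e1' in e1; rewrite e e2' in e2; split=> //; rewrite -e2 in e1; lra.
Qed.

Lemma kiteP t x : shape 0 t -> let k := cos_apex R (small t == false) in
  kite t x <-> exists a b, [/\ x = kite_point t a b, k * `|b| <= a &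
     a <= 1 - (1 - k) * `|b|].
Proof.
move=> st k; have md := mirror_diff st; rewrite -/k in md.
have mE : mirror t = Tile (small t) (apex t) (same t) (diff (mirror t)).
  by rewrite (mirrorE st).
split.
  rewrite /kite => -[|]; last rewrite mE md.
    move=> [a [b [c [a0 b0 c0 s ->]]]]; exists (b + k * c), c.
    rewrite (ger0_norm c0); split; [|lra|nra].
    have -> : a = 1 - b - c by lra.
    by apply: point_ext; rewrite /kite_point -/k !coordE; ring.
  move=> [a [b [c [a0 b0 c0 s /= ->]]]]; exists (b + k * c), (- c).
  rewrite normrN (ger0_norm c0); split; [|lra|nra].
  have -> : a = 1 - b - c by lra.
  by apply: point_ext; rewrite /kite_point -/k mulr2n !coordE; ring.
move=> [a [b [-> h1 h2]]]; have [b0|b0] := lerP 0 b.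
  rewrite ger0_norm // in h1 h2; left.
  exists (1 - (a - k * b) - b), (a - k * b), b; split; [by lra|by lra|by []|by ring|].
  by apply: point_ext; rewrite /kite_point -/k !coordE; ring.
rewrite ltr0_norm // in h1 h2; right; rewrite mE md.
exists (1 - (a + k * b) + b), (a + k * b), (- b); split => /=; [by lra|by lra|by lra|by ring|].
by apply: point_ext; rewrite /kite_point -/k mulr2n !coordE; ring.
Qed.

End Kites.

Section Extreme.
Variable R : realType.
Local Notation point := (R * R)%type.
Local Notation tau := (tau R).
Local Notation tile := (tile R).
Implicit Types (p q x y w v : point) (a b c l : R) (f g : point -> point).
Implicit Types (t T L S s : tile) (n : nat) (h : bool).

Definition extreme (K : set point) x :=
  K x /\ forall v, K (x + v) -> K (x - v) -> v = 0.

(** The kite or dart in the coordinates of [kite_point], see [kiteP]; [k] is the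
    cosine of the angle at the apex. *)
Definition kite_region k a b := k * `|b| <= a /\ a <= 1 - (1 - k) * `|b|.

(** The quadrangle with vertices (0, 0), (k, 1), (1, 0) and (k, -1), whose angle
    at the origin is reflex for [k < 0]. From any other point one can move a
    little both ways along a segment. *)
Lemma kite_region_extreme k a b : -1 < k -> k < 1 -> kite_region k a b ->
  (forall a' b', kite_region k (a + a') (b + b') ->
     kite_region k (a - a') (b - b') -> a' = 0 /\ b' = 0) <->
  [\/ 0 < k /\ (a = 0 /\ b = 0), a = 1 /\ b = 0, a = k /\ b = 1 | a = k /\ b = -1].
Proof.
move=> k0 k1 hr; split; last first.
  move=> H a' b' [h1 h2] [h3 h4].
  have N0 (r : R) : r <= `|r| /\ - r <= `|r|.
    by rewrite ler_norm -normrN ler_norm.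
  have [n1 n2] := N0 (b + b'); have [n3 n4] := N0 (b - b').
  move: h1 h2 h3 h4 n1 n2 n3 n4; set u := `|b + b'|; set w := `|b - b'|.
  move=> h1 h2 h3 h4 n1 n2 n3 n4; have u0 : 0 <= u := normr_ge0 _.
  have w0 : 0 <= w := normr_ge0 _.
  case: H => [[kp [a0 b0]]|[a0 b0]|[a0 b0]|[a0 b0]]; subst a b.
  - have uw : k * (u + w) <= 0 by lra.
    rewrite pmulr_rle0 // in uw; have u00 : u = 0 by lra.
    have w00 : w = 0 by lra.
    by rewrite u00 w00 in h1 h2 h3 h4 n1 n2 n3 n4; split; lra.
  - have uw : (1 - k) * (u + w) <= 0 by lra.
    rewrite pmulr_rle0 ?subr_gt0 // in uw; have u00 : u = 0 by lra.
    have w00 : w = 0 by lra.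
    by rewrite u00 w00 in h1 h2 h3 h4 n1 n2 n3 n4; split; lra.
  - have u1 : u <= 1 by lra.
    have w1 : w <= 1 by lra.
    have b'0 : b' = 0 by lra.
    have u1' : u = 1 by lra.
    have w1' : w = 1 by lra.
    by rewrite u1' w1' in h1 h2 h3 h4; split; lra.
  - have u1 : u <= 1 by lra.
    have w1 : w <= 1 by lra.
    have b'0 : b' = 0 by lra.
    have u1' : u = 1 by lra.
    have w1' : w = 1 by lra.
    by rewrite u1' w1' in h1 h2 h3 h4; split; lra.
have [sg [bt [bt0 [eb esg]]]] : exists sg bt : R, 0 <= bt /\ (b = sg * bt /\ (sg = 1 \/ sg = -1)).
  have [b0|b0] := lerP 0 b; [exists 1, b|exists (-1), (- b)].
    by split=> //; split; [rewrite mul1r|left].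
  by split; [rewrite oppr_ge0 ltW|split; [ring|right]].
have nsg (r : R) : 0 <= r -> `|sg * r| = r.
  by move=> r0; case: esg => ->; rewrite ?mulN1r ?normrN ?mul1r ger0_norm.
have sg0 (r : R) : sg * r = 0 -> r = 0 by case: esg => ->; lra.
move=> ext; case: hr; rewrite eb nsg // => h1 h2.
have ext' d e : 0 <= bt + e -> 0 <= bt - e -> k * (bt + e) <= a + d ->
    a + d <= 1 - (1 - k) * (bt + e) -> k * (bt - e) <= a - d ->
    a - d <= 1 - (1 - k) * (bt - e) -> d = 0 /\ e = 0.
  move=> p1 p2 r1 r2 r3 r4; have [] := ext d (sg * e).
  - by rewrite /kite_region eb -mulrDr nsg.
  - by rewrite /kite_region eb -mulrBr nsg.
  by move=> -> /sg0.
have bt1 : bt <= 1 by lra.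
have [bt00|btn0] := eqVneq bt 0.
  rewrite bt00 !mulr0 in h1 h2 *; have a1 : a <= 1 by lra.
  have [a0|an0] := eqVneq a 0.
    have [kp|kn] := ltrP 0 k; first by constructor 1; rewrite a0.
    have h12 : 0 <= 1 / 2 :> R by lra.
    have [] := ext 0 (1 / 2); last by lra.
      by rewrite /kite_region eb bt00 mulr0 !add0r (ger0_norm h12); split; lra.
    by rewrite /kite_region eb bt00 mulr0 sub0r subr0 normrN (ger0_norm h12); split; lra.
  have [->|an1] := eqVneq a 1; first by constructor 2.
  pose d := Num.min a (1 - a).
  have d0 : 0 < d by rewrite lt_min subr_gt0 !lt_def an0 h1 eq_sym an1 a1.
  have [da da'] : d <= a /\ d <= 1 - a by rewrite /d !ge_min !lexx orbT.
  have [] := ext' d 0; rewrite ?bt00 ?addr0 ?subr0 ?mulr0 ?subr0; lra.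
have btp : 0 < bt by rewrite lt_def btn0.
have [bt1'|btn1] := eqVneq bt 1.
  have -> : a = k by rewrite bt1' in h1 h2; lra.
  by rewrite bt1' mulr1; case: esg => ->; [constructor 3|constructor 4].
have btl : bt < 1 by rewrite lt_def eq_sym btn1.
have [al|al] := ltrP (k * bt) a.
  pose d := Num.min (a - k * bt) bt.
  have d0 : 0 < d by rewrite lt_min subr_gt0 al btp.
  have [da da'] : d <= a - k * bt /\ d <= bt by rewrite /d !ge_min !lexx orbT.
  have [] := ext' (- (1 - k) * d) d; lra.
have ak : a = k * bt by lra.
pose d := Num.min (1 - bt) bt.
have d0 : 0 < d by rewrite lt_min subr_gt0 btl btp.
have [da da'] : d <= 1 - bt /\ d <= bt by rewrite /d !ge_min !lexx orbT.
have [] := ext' (k * d) d; lra.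
Qed.

Lemma kite_point_vertices t : shape 0 t ->
  [/\ kite_point t 0 0 = apex t, kite_point t 1 0 = same t,
      kite_point t (cos_apex R (small t == false)) 1 = diff t &
      kite_point t (cos_apex R (small t == false)) (-1) = diff (mirror t)].
Proof.
by move=> st; rewrite (mirror_diff st) /kite_point;
  split; apply: point_ext; rewrite ?mulr2n !coordE; ring.
Qed.

Lemma cos_apex_sign (s : bool) : (0 < cos_apex R (s == false)) = ~~ s.
Proof.
have := tau_gt1 R; rewrite /cos_apex; case: s => /= h.
  by apply: negbTE; rewrite -leNgt; lra.
by rewrite divr_gt0 ?tau_gt0.
Qed.

(** The extreme points of a kite are its four vertices. The reflex vertex of a
    dart is not extreme, as two edges of its triangles make an angle of more
    than 180 degrees there. *)
Lemma kite_extreme t x : shape 0 t -> extreme (kite t) x <->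
  [\/ ~~ small t /\ x = apex t, x = same t, x = diff t | x = diff (mirror t)].
Proof.
move=> st; have t0 := area_shape st; set k := cos_apex R (small t == false).
have k1 : k < 1 := cos_apex_lt1 _ _; have kN1 : -1 < k := cos_apex_gtN1 _ _.
have [v1 v2 v3 v4] := kite_point_vertices st; rewrite -/k in v3 v4.
have KP a b : kite t (kite_point t a b) <-> kite_region k a b.
  split=> [/(kiteP _ st)[a' [b' [/(kite_point_inj t0)[-> ->] h1 h2]]]//|[h1 h2]].
  by apply/(kiteP _ st); exists a, b.
have sums a b v a' b' : kite_point t a b + v = kite_point t a' b' ->
    kite_point t a b - v = kite_point t (a - (a' - a)) (b - (b' - b)).
  move=> e; have -> : v = kite_point t a' b' - kite_point t a b by rewrite -e addrC addKr.
  by apply: point_ext; rewrite /kite_point !coordE; ring.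
have key a b : kite_region k a b -> extreme (kite t) (kite_point t a b) <->
   (forall a' b', kite_region k (a + a') (b + b') ->
     kite_region k (a - a') (b - b') -> a' = 0 /\ b' = 0).
  move=> hr; split=> [[_ ext] a' b' h1 h2|ext].
    pose v := kite_point t (a + a') (b + b') - kite_point t a b.
    have e1 : kite_point t a b + v = kite_point t (a + a') (b + b').
      by rewrite addrC subrK.
    have v0 : v = 0.
      apply: ext; first by rewrite e1 KP.
      rewrite (sums _ _ _ _ _ e1) KP.
      have cancel (r r' : R) : r - (r + r' - r) = r - r' by ring.
      by rewrite !cancel.
    move: e1; rewrite v0 addr0 => /(kite_point_inj t0)[]; lra.
  split; first by rewrite KP.
  move=> v h1 h2.
  have /(kiteP _ st)[a' [b' [e1 r1 r2]]] := h1.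
  rewrite (sums _ _ _ _ _ e1) KP in h2.
  have [] := ext (a' - a) (b' - b) _ h2.
    by rewrite ![_ + (_ - _)]addrC !subrK.
  move=> /eqP; rewrite subr_eq0 => /eqP ea /eqP; rewrite subr_eq0 => /eqP eb.
  by move: e1; rewrite ea eb -[RHS]addr0 => /addrI.
split=> [ext|].
  have /(kiteP _ st)[a [b [ex r1 r2]]] := ext.1.
  have hr : kite_region k a b by [].
  move: ext; rewrite ex (key _ _ hr) (kite_region_extreme kN1 k1 hr) -v1 -v2 -v3 -v4.
  rewrite -/k cos_apex_sign.
  by case=> [[-> [-> ->]]|[-> ->]|[-> ->]|[-> ->]];
    [constructor 1|constructor 2|constructor 3|constructor 4].
have hr : [/\ ~~ small t -> kite_region k 0 0, kite_region k 1 0, kite_region k k 1 & kite_region k k (-1)].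
  by rewrite /kite_region normrN normr1 normr0; split; split; lra.
case: hr => r1 r2 r3 r4.
case=> [[hs ->]|->|->|->]; rewrite -?v1 -?v2 -?v3 -?v4 key //;
 try exact: r1; rewrite (kite_region_extreme kN1 k1) //; try exact: r1.
- by constructor 1; rewrite /k cos_apex_sign.
- by constructor 2.
- by constructor 3.
- by constructor 4.
Qed.

End Extreme.

Section Recovery.
Variable R : realType.
Local Notation point := (R * R)%type.
Local Notation tau := (tau R).
Local Notation tile := (tile R).
Implicit Types (p q x y w v : point) (a b c l : R) (f g : point -> point).
Implicit Types (t T L S s : tile) (n : nat) (h : bool).

Definition sqdist p q := dot (p - q) (p - q).

Lemma sqdistC p q : sqdist p q = sqdist q p.
Proof. by rewrite /sqdist /dot !coordE; ring. Qed.
Lemma sqdist0 p : sqdist p p = 0.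
Proof. by rewrite /sqdist /dot !coordE; ring. Qed.

Lemma kite_sqdist t : shape 0 t ->
  let P := apex t in let Q := same t in let D := diff t in
  let D' := diff (mirror t) in let l := if small t then 1 else tau + 1 in
  [/\ [/\ sqdist P Q = l, sqdist P D = l & sqdist P D' = l],
      sqdist Q D = (if small t then tau + 1 else 1),
      sqdist Q D' = (if small t then tau + 1 else 1) &
      sqdist D D' = tau + 2].
Proof.
move=> st; cbv zeta; rewrite (mirror_diff st); have t2 := tau2 R.
have [h1 h2 h3] := st; rewrite leg0 in h1 h2 h3.
have h1' : sqdist (apex t) (same t) = if small t then 1 else tau + 1.
  by rewrite sqdistC.
have h2' : sqdist (apex t) (diff t) = if small t then 1 else tau + 1.
  by rewrite sqdistC.
set k := cos_apex _ _.
have C (P Q D : point) (a b c : R) : 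
  dot (a *: (Q - P) + b *: (D - P)) (a *: (Q - P) + b *: (D - P)) =
  a ^+ 2 * sqdist Q P + b ^+ 2 * sqdist D P + 2 * a * b * dot (Q - P) (D - P).
  by rewrite /sqdist /dot !coordE; ring.
have e1 : sqdist (apex t) (apex t *+ 2 + (2 * k) *: (same t - apex t) - diff t) =
  (2 * k) ^+ 2 * sqdist (same t) (apex t) + sqdist (diff t) (apex t)
   - 4 * k * dot (same t - apex t) (diff t - apex t).
  by rewrite /sqdist /dot mulr2n !coordE; ring.
have e2 : sqdist (same t) (diff t) = sqdist (same t) (apex t) + sqdist (diff t) (apex t)
   - 2 * dot (same t - apex t) (diff t - apex t).
  by rewrite /sqdist /dot !coordE; ring.
have e3 : sqdist (same t) (apex t *+ 2 + (2 * k) *: (same t - apex t) - diff t) =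
  (1 - 2 * k) ^+ 2 * sqdist (same t) (apex t) + sqdist (diff t) (apex t)
   + 2 * (1 - 2 * k) * dot (same t - apex t) (diff t - apex t).
  by rewrite /sqdist /dot mulr2n !coordE; ring.
have e4 : sqdist (diff t) (apex t *+ 2 + (2 * k) *: (same t - apex t) - diff t) =
  (2 * k) ^+ 2 * sqdist (same t) (apex t) + 4 * sqdist (diff t) (apex t)
   - 8 * k * dot (same t - apex t) (diff t - apex t).
  by rewrite /sqdist /dot mulr2n !coordE; ring.
have E : [/\ sqdist (same t) (apex t) = if small t then 1 else tau + 1,
  sqdist (diff t) (apex t) = if small t then 1 else tau + 1 &
  dot (same t - apex t) (diff t - apex t) = k * if small t then 1 else tau + 1] by [].
case: E => E1 E2 E3; rewrite e1 e2 e3 e4 h1' h2' E1 E2 E3.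
by rewrite /k /cos_apex; case: (small t); split; try split; rewrite /=; field: t2.
Qed.

Section SameKite.
Variables t s : tile.
Hypotheses (st : shape 0 t) (ss : shape 0 s) (ts : kite t = kite s).

Lemma same_extreme x :
  [\/ ~~ small t /\ x = apex t, x = same t, x = diff t | x = diff (mirror t)] ->
  [\/ ~~ small s /\ x = apex s, x = same s, x = diff s | x = diff (mirror s)].
Proof. by rewrite -!kite_extreme // ts. Qed.

Lemma kite_small : ~~ small t -> ~~ small s.
Proof.
move=> nt; apply/negP => sm.
have [_ QD _ _] := kite_sqdist st; rewrite (negbTE nt) in QD.
have [[PQ PD PD'] QD1 QD1' DD'] := kite_sqdist ss; rewrite sm in PQ PD PD' QD1 QD1' DD'.
have F := (sqdist0, QD1, QD1', DD', etrans (sqdistC _ _) QD1,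
  etrans (sqdistC _ _) QD1', etrans (sqdistC _ _) DD').
have hQ := same_extreme (Or42 _ _ _ erefl); have hD := same_extreme (Or43 _ _ _ erefl).
have h1 := tau_gt1 R; move: QD.
case: hQ => [[]|->|->|->]; rewrite ?sm //; case: hD => [[]|->|->|->];
  rewrite ?sm // !F => *; lra.
Qed.

End SameKite.

Lemma kite_size t s : shape 0 t -> shape 0 s -> kite t = kite s ->
  small s = small t.
Proof.
move=> st ss ts; apply/idP/idP; apply: contraTT; first exact: kite_small.
by apply: kite_small.
Qed.

(** The vertices are told apart by their distances. *)
Lemma kite_eq t s : shape 0 t -> shape 0 s -> kite t = kite s ->
  t = s \/ t = mirror s.
Proof.
move=> st ss ts; have sz := kite_size st ss ts; have h1 := tau_gt1 R.
have [n1 n2 n3 n4] : [/\ (0 : R) <> 1, 0 <> tau + 2, tau + 1 <> 1 &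
    tau + 1 <> tau + 2] by clear ts; split=> ?; lra.
have [[PQt PDt PDt'] QDt QDt' DDt'] := kite_sqdist st.
have [[PQ PD PD'] QD QD' DD'] := kite_sqdist ss.
have E1 := same_extreme st ss ts; have E2 := same_extreme ss st (esym ts).
rewrite sz in PQ PD PD' QD QD' DD' E1 E2.
have DD := etrans (sqdistC _ _) DD'; have DDt := etrans (sqdistC _ _) DDt'.
have hQ := E1 _ (Or42 _ _ _ erefl); have hD := E1 _ (Or43 _ _ _ erefl).
have hD' := E1 _ (Or44 _ _ _ erefl).
have kD := E2 _ (Or43 _ _ _ erefl); have kD' := E2 _ (Or44 _ _ _ erefl).
have QPt := etrans (sqdistC _ _) PQt.
have nQ y : [\/ ~~ small t /\ y = apex t, y = same t, y = diff t | y = diff (mirror t)] ->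
    sqdist (same t) y < tau + 2.
  by case=> [[_ ->]|->|->|->]; rewrite ?sqdist0 ?QPt ?QDt ?QDt'; case: (small t); lra.
have lt_irr : tau + 2 < tau + 2 -> False by rewrite ltxx.
have nQD : same t <> diff s.
  by move=> e; move: (nQ _ kD'); rewrite e DD' => /lt_irr.
have nQD' : same t <> diff (mirror s).
  by move=> e; move: (nQ _ kD); rewrite e DD => /lt_irr.
have ne0 p q (r : R) : sqdist p q = r -> 0 < r -> p <> q.
  by move=> <- h e; move: h; rewrite e sqdist0 ltxx.
have cpos : 0 < (if small t then tau + 1 else 1) by case: ifP => _; lra.
have cpos' : 0 < (if small t then 1 else tau + 1) by case: ifP => _; lra.
have eDs : same t = same s -> apex t = apex s ->
    diff t = diff s \/ diff t = diff (mirror s) -> t = s \/ t = mirror s.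
  move=> eQ eP [eD|eD]; [left|right].
    by rewrite [t]tile_eta [s]tile_eta sz eP eQ eD.
  by rewrite (mirrorE ss) [t]tile_eta sz eP eQ eD (mirrorE ss).
case sm: (small t) PQ PD PD' QD QD' PQt PDt PDt' QDt QDt' hQ hD hD' kD kD' {cpos cpos'}
  => PQ PD PD' QD QD' PQt PDt PDt' QDt QDt' hQ hD hD' kD kD'.
  have eQ : same t = same s by case: hQ => // -[].
  have eD : diff t = diff s \/ diff t = diff (mirror s).
    case: hD => [[] //|e| |]; [|by left|by right].
    by case: (ne0 _ _ _ QDt); [lra|rewrite eQ e].
  have eD' : diff (mirror t) = diff s \/ diff (mirror t) = diff (mirror s).
    case: hD' => [[] //|e| |]; [|by left|by right].
    by case: (ne0 _ _ _ QDt'); [lra|rewrite eQ e].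
  apply: eDs => //.
  have : diff t + diff (mirror t) = diff s + diff (mirror s).
    have nDD : diff t <> diff (mirror t) by apply: (ne0 _ _ _ DDt'); lra.
    by case: eD eD' => e [] e'; rewrite e e' //;
      first [by rewrite addrC | by case: nDD; rewrite e e'].
  rewrite (mirror_diff st) (mirror_diff ss) ![diff _ + _]addrC !subrK eQ sz sm.
  have c1 : 1 - cos_apex R (true == false) != 0.
    by apply: lt0r_neq0; rewrite subr_gt0; exact: cos_apex_lt1.
  move: (cos_apex _ _) c1 => k c1 e; apply: (scalerI c1).
  apply: point_ext; [have := congr1 fst e|have := congr1 snd e];
    rewrite !mulr2n !coordE => ?; lra.
have hP := E1 _ (Or41 _ _ _ (conj (negbT sm) erefl)).
have kP := E2 _ (Or41 _ _ _ (conj (negbT sm) erefl)).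
have DPt := etrans (sqdistC _ _) PDt; have QPs := etrans (sqdistC _ _) PQ.
have nP y : [\/ ~~ false /\ y = apex t, y = same t, y = diff t | y = diff (mirror t)] ->
    sqdist (apex t) y <> 1 /\ sqdist (apex t) y <> tau + 2.
  by case=> [[_ ->]|->|->|->]; rewrite ?sqdist0 ?PQt ?PDt ?PDt'; split.
have eP : apex t = apex s.
  case: hP => [[_ //]|e|e|e].
  - by case: (nP _ kD); rewrite e QD.
  - by case: (nP _ kD'); rewrite e DD'.
  - by case: (nP _ kD); rewrite e DD.
have eQ : same t = same s.
  case: hQ => [[_ e]|//|//|//].
  by case: (ne0 _ _ _ PQt); [lra|rewrite eP e].
apply: eDs => //; case: hD => [[_ e]|e| |]; [| |by left|by right].
  by case: (ne0 _ _ _ PDt); [lra|rewrite eP e].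
by case: (ne0 _ _ _ QDt); [lra|rewrite eQ e].
Qed.

Section Isometry.
Variables (z z' : penrose_seq) (F F' sigma : point -> point).
Hypotheses (hF : folding z F) (hF' : folding z' F').
Hypothesis si : plane_isometry sigma.

Lemma TzE (w : penrose_seq) (G : point -> point) K : folding w G ->
  Tz R w K <-> exists2 t, tiling w 0 t & K = kite t.
Proof.
move=> hG; split=> [[t [t' [ht ht' tt' [p [q [e e']]] ->]]]|[t ht ->]].
  rewrite A_tilingE in ht ht'.
  exists t => //; by rewrite (mate_mirror hG ht ht' tt' e e').
have st := tiling_shape ht; have st' := tiling_shape (mirror_tiling ht).
exists t, (mirror t); rewrite !A_tilingE; split=> //; first exact: mirror_tiling.
  have [_ _ _ DD'] := kite_sqdist st => e; move: DD'; rewrite -e sqdist0.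
  by have := tau_gt1 R; lra.
exists (apex t), (same t); split; first exact: same_color_edge_apex st.
have := same_color_edge_apex st'; by rewrite (mirrorE st).
Qed.

Lemma map_kite t : shape 0 t -> sigma @` kite t = kite (map_tile sigma t).
Proof.
move=> st; have as_ := isometry_affine si.
by rewrite /kite image_setU !map_hull // (map_mirror si st).
Qed.

Hypothesis sT : [set sigma @` K | K in Tz R z] = Tz R z'.

(** The level 0 tiles can be read off from the set of kites and darts. *)
Lemma map_tiling0 : map_tile sigma @` tiling z 0 = tiling z' 0.
Proof.
apply/seteqP; split=> [_ [t ht <-]|t ht].
  have st := tiling_shape ht.
  have : Tz R z' (sigma @` kite t).
    by rewrite -sT; exists (kite t) => //; apply/(TzE _ hF); exists t.
  move=> /(TzE _ hF')[u hu]; rewrite (map_kite st) => e.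
  have [->|->//] := kite_eq ((shape_map 0 t si).2 st) (tiling_shape hu) e => //.
  exact: mirror_tiling.
have st := tiling_shape ht.
have : Tz R z' (kite t) by apply/(TzE _ hF'); exists t.
rewrite -sT => -[_ /(TzE _ hF)[u hu ->]]; have su := tiling_shape hu.
rewrite (map_kite su) => e.
have [->|->] := kite_eq st ((shape_map 0 u si).2 su) (esym e).
  by exists u.
by exists (mirror u); [exact: mirror_tiling|exact: map_mirror si su].
Qed.

Lemma isometric_tail_eq : tail_eq z z'.
Proof. exact: tail_eq_isometry hF hF' si map_tiling0. Qed.

End Isometry.
End Recovery.

(** * Congruence of tilings with a common tail *)

Section Transport.
Variable R : realType.
Local Notation point := (R * R)%type.
Local Notation tau := (tau R).
Local Notation tile := (tile R).
Implicit Types (p q x y w v : point) (a b c l : R) (f g : point -> point).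
Implicit Types (t T L S s : tile) (n : nat) (h : bool).

Lemma isometry_nbhs f x (A : set point) : plane_isometry f ->
  nbhs (f x) A -> nbhs x (f @^-1` A).
Proof.
move=> /isometryP fi /nbhs_ballP[r /= r0 hA]; apply/nbhs_ballP.
exists (r / 2) => /=; first lra.
move=> y [/= h1 h3]; apply: hA; have e := fi x y; rewrite /dot /= in e.
have bE (u v d : R) : ball u d v <-> `|u - v| < d by rewrite -ball_normE.
move: h1 h3 => /bE; rewrite ltr_norml => /andP[h1 h2] /bE.
rewrite ltr_norml => /andP[h3 h4].
have s1 : (x.1 - y.1) ^+ 2 < (r / 2) ^+ 2 by nra.
have s2 : (x.2 - y.2) ^+ 2 < (r / 2) ^+ 2 by nra.
have s : (f x - f y).1 ^+ 2 + (f x - f y).2 ^+ 2 < r ^+ 2.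
  by have := mulr_gt0 r0 r0; rewrite !expr2 e ?coordE; lra.
have sq (u v : R) : u ^+ 2 + v ^+ 2 < r ^+ 2 -> `|u| < r.
  by move=> huv; rewrite ltr_norml; apply/andP; split; nra.
have [b1 b2] : ball (f x).1 r (f y).1 /\ ball (f x).2 r (f y).2.
  split; apply/bE; first exact: sq s.
  by apply: (sq _ (f x - f y).1); rewrite addrC.
by split.
Qed.

Lemma affine_fix f t x : affine f -> area t != 0 -> map_tile f t = t -> f x = x.
Proof.
move=> af t0 e; have e1 := congr1 (@apex R) e; have e2 := congr1 (@same R) e.
have e3 := congr1 (@diff R) e; rewrite /= in e1 e2 e3.
by rewrite [in LHS](bary_point x t0) af ?bary_sum // e1 e2 e3 -bary_point.
Qed.

Lemma segment_map f p q : affine f -> f @` segment p q = segment (f p) (f q).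
Proof.
move=> af; apply/seteqP; split=> [_ [_ [a ha <-] <-]|_ [a ha <-]].
  by exists a => //; rewrite affine2.
by exists (p + a *: (q - p)); [exists a|rewrite affine2].
Qed.

Lemma level0_partsS (z : penrose_seq) n k t :
  level0_parts n (tz R z n) t -> level0_parts (n + k) (tz R z (n + k)) t.
Proof.
move=> h; elim: k => [|k IH]; rewrite ?addn0 // addnS.
by exists (tz R z (n + k)) => //; exact: parts_tz.
Qed.

Lemma map_level0_parts f n T t : affine f ->
  level0_parts n T t -> level0_parts n (map_tile f T) (map_tile f t).
Proof.
move=> af; elim: n T => [|n IH] T; first by move=> ->.
by move=> [u pu hu]; exists (map_tile f u); [exact: map_parts|exact: IH].
Qed.

Section Maps.
Variables (z z' : penrose_seq) (m : nat) (f g : point -> point).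
Hypotheses (fi : plane_isometry f) (gi : plane_isometry g) (fK : cancel f g).
Hypothesis fz : forall n, (m <= n)%N -> map_tile f (tz R z n) = tz R z' n.
Let af : affine f := isometry_affine fi.

Lemma map_Uz x : Uz z x -> Uz z' (f x).
Proof.
move=> [n _ hx]; exists (n + m)%N => //.
rewrite -fz ?leq_addl // -map_hull //; exists x => //.
elim: m => [|k IH]; rewrite ?addn0 // addnS.
exact: parts_hull (parts_tz R z _) _ IH.
Qed.

Hypothesis gU : forall x, Uz z' x -> Uz z (g x).

Lemma map_frontier x : Defs.frontier (@Uz R z) x -> Defs.frontier (@Uz R z') (f x).
Proof.
move=> [hc hi]; split.
  move=> A /(isometry_nbhs fi) /hc[y [Uy Ay]].
  by exists (f y); split=> //; exact: map_Uz.
move=> /(isometry_nbhs fi) hn; apply: hi.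
by apply: filterS hn => y /gU; rewrite fK.
Qed.

Lemma map_A_tiling t : A_tiling z t -> A_tiling z' (map_tile f t).
Proof.
elim=> [n {}t ht|p q {}t pq seg _ IH].
  apply: (A_tiling_inside (n := n + m)).
  rewrite -fz ?leq_addl //; apply: map_level0_parts => //.
  exact: level0_partsS.
have -> : map_tile f (map_tile (reflect_line p q) t) =
    map_tile (reflect_line (f p) (f q)) (map_tile f t).
  by rewrite /map_tile /= !reflect_map.
apply: A_tiling_reflect => //; first by move/(isometry_inj fi).
by rewrite -segment_map // => _ [x /seg hx <-]; exact: map_frontier.
Qed.

Lemma map_same_color_edge p q t : same_color_edge p q t ->
  same_color_edge (f p) (f q) (map_tile f t).
Proof.
move=> [pq [c [hp hq]]]; split; first by move/(isometry_inj fi).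
exists c; rewrite /colored_vertices /=.
split; [move: hp|move: hq]; rewrite /colored_vertices => -[[]|];
  by [move=> [-> ->]; left; left | move=> [-> ->]; left; right | move=> [-> ->]; right].
Qed.

Lemma map_Tz K : Tz R z K -> Tz R z' (f @` K).
Proof.
move=> [t [t' [ht ht' tt' [p [q [e e']]] ->]]].
exists (map_tile f t), (map_tile f t'); split.
- exact: map_A_tiling.
- exact: map_A_tiling.
- by move/(map_tile_inj (isometry_inj fi)).
- by exists (f p), (f q); split; exact: map_same_color_edge.
- by rewrite image_setU !map_hull.
Qed.

End Maps.

(** Sequences that agree from level [m] on have congruent level [m] tiles, from
    which the same tilings are built. *)
Lemma tail_eq_isometric (z z' : penrose_seq) : tail_eq z z' ->
  exists sigma : point -> point,
    plane_isometry sigma /\ [set sigma @` K | K in Tz R z] = Tz R z'.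
Proof.
move=> [m zz'].
have sm : small (tz R z m) = small (tz R z' m) by rewrite !small_tz zz'.
have l0 : 0 < leg R m (z m) ^+ 2 by rewrite exprn_gt0 // leg_gt0.
have s1 := shape_tz R z m; have s2 := shape_tz R z' m.
rewrite /shape -sm !small_tz in s1 s2.
have [f fi ef] := congruent_tiles l0 sm s1 s2.
have [g gi eg] := congruent_tiles l0 (esym sm) s2 s1.
have af := isometry_affine fi; have ag := isometry_affine gi.
have fK : cancel f g.
  move=> x; apply: (affine_fix (f := g \o f) (t := tz R z m)).
  - exact/isometry_affine/isometry_comp.
  - exact: area_isosceles s1.
  - by rewrite map_tile_comp ef eg.
have gK : cancel g f.
  move=> x; apply: (affine_fix (f := f \o g) (t := tz R z' m)).
  - exact/isometry_affine/isometry_comp.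
  - exact: area_isosceles s2.
  - by rewrite map_tile_comp eg ef.
have fz n : (m <= n)%N -> map_tile f (tz R z n) = tz R z' n.
  move=> /subnKC <-; elim: (n - m)%N => [|k IH]; rewrite ?addn0 // addnS /=.
  by rewrite map_compose // IH zz' // -addnS leq_addr.
have gz n : (m <= n)%N -> map_tile g (tz R z' n) = tz R z n.
  move=> /subnKC <-; elim: (n - m)%N => [|k IH]; rewrite ?addn0 // addnS /=.
  by rewrite map_compose // IH zz' // -addnS leq_addr.
have fU := @map_Uz z z' m f fi fz; have gU := @map_Uz z' z m g gi gz.
exists f; split=> //; apply/seteqP; split=> [_ [K hK <-]|K hK].
  exact: (map_Tz fi fK fz gU).
exists (g @` K); first exact: (map_Tz gi gK gz fU).
rewrite image_comp; apply/seteqP; split=> [_ [x hx <-]|x hx].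
  by rewrite /= gK.
by exists x => //=; rewrite gK.
Qed.

End Transport.

(** * Supporting lines of the region U_z *)

Section Walls.
Variable R : realType.
Local Notation point := (R * R)%type.
Local Notation tau := (tau R).
Local Notation tile := (tile R).
Implicit Types (p q x y w v e : point) (a b c l : R) (f g : point -> point).
Implicit Types (t T L S s : tile) (n : nat) (h : bool).

Lemma ballE (x y d : R) : ball x d y <-> `|x - y| < d.
Proof. by rewrite -ball_normE. Qed.

Lemma affine_gt0_nbhs (F : point -> R) x v : 
  (forall y, F y = F x + dot v (y - x)) -> 0 < F x -> nbhs x [set y | 0 < F y].
Proof.
move=> FE F0; apply/nbhs_ballP.
have k0 : 0 < 1 + `|v.1| + `|v.2| by rewrite -addrA ltr_pwDl // addr_ge0.
exists (F x / (1 + `|v.1| + `|v.2|)); first exact: divr_gt0.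
set d := _ / _ => y [/= /ballE h1 /ballE h2].
rewrite FE /dot !coordE.
have d0 : 0 <= d by rewrite divr_ge0 ?ltW.
have m1 : - (`|v.1| * d) <= v.1 * (y.1 - x.1).
  rewrite lerNl -mulrN opprB (le_trans (ler_norm _)) // normrM.
  by rewrite ler_wpM2l // ltW.
have m2 : - (`|v.2| * d) <= v.2 * (y.2 - x.2).
  rewrite lerNl -mulrN opprB (le_trans (ler_norm _)) // normrM.
  by rewrite ler_wpM2l // ltW.
have e : d * (1 + `|v.1| + `|v.2|) = F x by rewrite /d divfK // gt_eqF.
have dp : 0 < d by rewrite divr_gt0.
lra.
Qed.

Lemma intr_nbhs t x : area t != 0 -> intr t x -> nbhs x (intr t).
Proof.
move=> t0 /(intrP _ t0)[h1 h2 h3].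
have dE (w : point) y : cross (y - x) w / area t = dot (w.2 / area t, - w.1 / area t) (y - x).
  by rewrite /cross /dot !coordE /=; ring.
have n1 := @affine_gt0_nbhs (bary_apex t) x _ (fun y =>
  let: And3 e _ _ := bary_move t x y in etrans e (congr1 (+%R _) (dE _ y))) h1.
have n2 := @affine_gt0_nbhs (bary_same t) x _ (fun y =>
  let: And3 _ e _ := bary_move t x y in etrans e (congr1 (+%R _) (dE _ y))) h2.
have n3 := @affine_gt0_nbhs (bary_diff t) x _ (fun y =>
  let: And3 _ _ e := bary_move t x y in etrans e (congr1 (+%R _) (dE _ y))) h3.
apply: filterS (filterI n1 (filterI n2 n3)) => y [/= ? [? ?]].
by apply/intrP.
Qed.

(** For a unit vector [e], the signed distance to the line through [o] in the
    direction [e] *)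
Definition height e o x : R := cross e (x - o).

Section Region.
Variable z : penrose_seq.
Local Notation tz := (tz R z).
Local Notation Uz := (@Uz R z).

Lemma hull_tz_mono n k : (n <= k)%N -> hull (tz n) `<=` hull (tz k).
Proof.
move=> /subnKC <-; elim: (k - n)%N => [|m IH]; rewrite ?addn0 // addnS.
exact: subset_trans IH (parts_hull (parts_tz R z _)).
Qed.

Definition directed v := exists l e, [/\ 0 < l, e \in directions R & v = l *: e].

Lemma directedN v : directed v -> directed (- v).
Proof.
move=> [l [e [l0 de ->]]]; exists l, (- e); split=> //; first exact: directionsN.
by rewrite scalerN.
Qed.

Lemma tz_directed n : [/\ directed (same (tz n) - apex (tz n)),
  directed (diff (tz n) - apex (tz n)) & directed (diff (tz n) - same (tz n))].
Proof.
have t2 := tau2 R; have [h [e [de [e1 e2]]]] := tz_frame R z n.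
move: e1 e2; set l := leg _ _ _ => e1 e2.
have l0 : 0 < l := leg_gt0 R _ _.
set w := turn h e in e2; have dw : w \in directions R by exact: directions_turn.
have d3 : tau *: (w - e) \in directions R.
  have <- : turn h (turn h w) = tau *: (w - e).
    by rewrite !(turn_sqr, turnD, turnZ, turnN) -/w; apply: point_ext; rewrite !coordE; ring: t2.
  by do 2 apply: directions_turn.
have e3 : diff (tz n) - same (tz n) = (diff (tz n) - apex (tz n)) - (same (tz n) - apex (tz n)).
  by apply: point_ext; rewrite !coordE; ring.
split.
- by exists l, e.
- by case: ifP e2 => _ e2; exists l; [exists w|exists (tau *: (w - e))].
rewrite e3 e1 e2; case: ifP => _.
  exists (l * tau^-1), (tau *: (w - e)); split=> //.
    by rewrite mulr_gt0 ?invr_gt0 ?tau_gt0.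
  by apply: point_ext; rewrite !coordE tauV; ring: t2.
exists (l * tau), (- turn (~~ h) e); split.
- by rewrite mulr_gt0 ?tau_gt0.
- exact/directionsN/directions_turn.
by rewrite turnNE -/w; apply: point_ext; rewrite !coordE; ring: t2.
Qed.

(** A barycentric coordinate of [m] is not positive, and the edges have one of
    the ten directions. *)
Lemma tz_separation n m : ~ intr (tz n) m ->
  exists2 e, e \in directions R & forall x, hull (tz n) x -> 0 <= height e m x.
Proof.
set t := tz n; have t0 : area t != 0 := area_shape (shape_tz R z n).
have [d1 d2 d3] := tz_directed n; rewrite -/t in d1 d2 d3.
have key (F : point -> R) v : directed v ->
    (forall y, F y = F m + cross (y - m) v / area t) -> F m <= 0 ->
    (forall x, hull t x -> 0 <= F x) ->
    exists2 e, e \in directions R & forall x, hull t x -> 0 <= height e m x.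
  move=> [l [e [l0 de ->]]] FE Fm Fx.
  have P x : hull t x -> 0 <= - (l * height e m x) / area t.
    move=> /Fx; rewrite FE.
    have -> : cross (x - m) (l *: e) = - (l * height e m x).
      by rewrite /height /cross !coordE; ring.
    lra.
  have [ap|an] := ltrP 0 (area t).
    exists (- e); first exact: directionsN.
    move=> x /P; rewrite pmulr_lge0 ?invr_gt0 // -mulrN pmulr_rge0 //.
    by rewrite /height /cross !coordE => ?; lra.
  exists e => // x /P; have an' : area t < 0 by rewrite lt_def eq_sym t0.
  move=> h; have : 0 <= l * height e m x; last by rewrite pmulr_rge0.
  have -> : l * height e m x = - (- (l * height e m x) / area t * area t).
    by rewrite divfK // opprK.
  by rewrite oppr_ge0 mulr_ge0_le0 // ltW.
move=> ni.
have H x : hull t x -> [/\ 0 <= bary_apex t x, 0 <= bary_same t x & 0 <= bary_diff t x].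
  by move/(hullP _ t0).
have [h1|h1] := lerP (bary_apex t m) 0.
  apply: (key (bary_apex t) (same t - diff t)) => //.
  - by rewrite -opprB; exact: directedN.
  - by move=> y; case: (bary_move t m y).
  - by move=> x /H[].
have [h2|h2] := lerP (bary_same t m) 0.
  apply: (key (bary_same t) (diff t - apex t)) => //.
  - by move=> y; case: (bary_move t m y).
  - by move=> x /H[].
have [h3|h3] := lerP (bary_diff t m) 0.
  apply: (key (bary_diff t) (apex t - same t)) => //.
  - by rewrite -opprB; exact: directedN.
  - by move=> y; case: (bary_move t m y).
  - by move=> x /H[].
by case: ni; apply/intrP.
Qed.

(** The union of the [tz n] has supporting lines in the directions of the edges
    of the [tz n], as these directions are finitely many. *)
Lemma supporting_line m : Defs.frontier Uz m ->
  exists2 e, e \in directions R & forall x, Uz x -> 0 <= height e m x.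
Proof.
move=> [_ ni]; apply: contrapT => none.
have [N hN] : exists N, forall e, e \in directions R ->
    exists2 x, hull (tz N) x & height e m x < 0.
  have : {subset directions R <= directions R} by [].
  elim: {1 3}(directions R) => [|e s IH] sub; first by exists 0%N.
  have [N hN] : exists N, forall e, e \in s -> exists2 x, hull (tz N) x & height e m x < 0.
    by apply: IH => e' he'; apply: sub; rewrite inE he' orbT.
  have [n hn] : exists n, exists2 x, hull (tz n) x & height e m x < 0.
    apply: contrapT => h; apply: none; exists e; first by rewrite sub // inE eqxx.
    move=> x [n _ hx]; rewrite leNgt; apply/negP => hlt; apply: h.
    by exists n, x.
  exists (maxn N n) => e'; rewrite inE => /predU1P[->|/hN[x hx hh]].
    by case: hn => x hx hh; exists x => //; apply: hull_tz_mono hx; rewrite leq_maxr.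
  by exists x => //; apply: hull_tz_mono hx; rewrite leq_maxl.
have [i|] := pselect (intr (tz N) m).
  apply: ni; have := intr_nbhs (area_shape (shape_tz R z N)) i.
  by apply: filterS => y /intr_hull hy; exists N.
move=> /tz_separation[e de he]; have [x hx] := hN e de.
by rewrite ltNge he.
Qed.

End Region.
End Walls.

Section WallLines.
Variable R : realType.
Local Notation point := (R * R)%type.
Local Notation tau := (tau R).
Local Notation tile := (tile R).
Implicit Types (p q x y w v e o : point) (a b c l : R) (f g : point -> point).
Implicit Types (t T L S : tile) (n : nat) (h : bool).

Lemma dot_abs_le1 e v : dot e e = 1 -> dot v v = 1 -> `|dot e v| <= 1.
Proof.
move=> he hv; have : dot e v ^+ 2 <= 1.
  have : dot e v ^+ 2 + cross e v ^+ 2 = 1.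
    by rewrite -[1]mulr1 -{1}he -hv /dot /cross; ring.
  by have := sqr_ge0 (cross e v); lra.
by move=> h1; rewrite ler_norml; apply/andP; split; nra.
Qed.

(** Only finitely many slopes occur, so the nonzero ones are bounded away from
    zero. *)
Lemma slope_gap (s : seq R) : exists2 c : R, 0 < c &
  forall a, a \in s -> a != 0 -> c <= `|a|.
Proof.
elim: s => [|a s [c c0 IH]]; first by exists 1.
have [->|a0] := eqVneq a 0.
  by exists c => // b; rewrite inE => /predU1P[->|]; [rewrite eqxx|exact: IH].
exists (Num.min c `|a|); first by rewrite lt_min c0 normr_gt0.
move=> b; rewrite inE => /predU1P[->|/IH h] b0; rewrite ge_min.
  by rewrite lexx orbT.
by rewrite h.
Qed.

Lemma directions_slope e : exists2 c : R, 0 < c &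
  forall v, v \in directions R -> cross e v != 0 -> c <= `|cross e v|.
Proof.
have [c c0 hc] := slope_gap [seq cross e v | v <- directions R].
by exists c => // v hv; apply: hc; rewrite map_f.
Qed.

(** In a corner whose two sides rise from its lowest point, the points of small
    height are close to that point. *)
Lemma corner_close e o c p q x a1 a2 y : dot e e = 1 -> 0 < c ->
  (forall v, v \in directions R -> cross e v != 0 -> c <= `|cross e v|) ->
  directed (q - p) -> directed (x - p) ->
  0 <= height e o p -> height e o p < height e o q -> height e o p < height e o x ->
  0 <= a1 -> 0 <= a2 -> y = p + a1 *: (q - p) + a2 *: (x - p) ->
  c * `|dot e (y - p)| <= height e o y.
Proof.
move=> e1 c0 hc [l1 [v1 [l10 dv1 q1]]] [l2 [v2 [l20 dv2 q2]]] p0 pq px a10 a20 ->.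
have H w : height e o (p + w) = height e o p + cross e w.
  by rewrite /height /cross !coordE; ring.
have crossZ (a : R) w : cross e (a *: w) = a * cross e w.
  by rewrite /cross !coordE; ring.
have crossD v w : cross e (v + w) = cross e v + cross e w.
  by rewrite /cross !coordE; ring.
have c1 : c <= cross e v1.
  have : 0 < cross e v1.
    move: pq; rewrite -[in X in _ < X](subrK p q) addrC H q1 crossZ.
    by rewrite ltrDl pmulr_rgt0.
  by move=> h; rewrite -(gtr0_norm h); apply: hc => //; rewrite gt_eqF.
have c2 : c <= cross e v2.
  have : 0 < cross e v2.
    move: px; rewrite -[in X in _ < X](subrK p x) addrC H q2 crossZ.
    by rewrite ltrDl pmulr_rgt0.
  by move=> h; rewrite -(gtr0_norm h); apply: hc => //; rewrite gt_eqF.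
set w := a1 *: (q - p) + a2 *: (x - p).
have -> : p + a1 *: (q - p) + a2 *: (x - p) = p + w by rewrite /w addrA.
rewrite H addrAC subrr add0r /w q1 q2 !scalerA crossD !crossZ dotDr !dotZr.
have d1 := dot_abs_le1 e1 (dot_direction dv1).
have d2 := dot_abs_le1 e1 (dot_direction dv2).
have m1 : 0 <= a1 * l1 by rewrite mulr_ge0 // ltW.
have m2 : 0 <= a2 * l2 by rewrite mulr_ge0 // ltW.
apply: (@le_trans _ _ (c * (a1 * l1 + a2 * l2))).
  rewrite ler_wpM2l ?(ltW c0) // (le_trans (ler_normD _ _)) //.
  rewrite [X in X + _]normrM [X in _ + X]normrM.
  by rewrite (ger0_norm m1) (ger0_norm m2) lerD // ler_piMr.
nra.
Qed.

Section Region.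
Variable z : penrose_seq.
Local Notation tz := (tz R z).
Local Notation Uz := (@Uz R z).

Definition two_at (F : point -> R) a t :=
  [\/ F (apex t) = a /\ F (same t) = a, F (apex t) = a /\ F (diff t) = a |
      F (same t) = a /\ F (diff t) = a].

Definition vertex t p := [\/ p = apex t, p = same t | p = diff t].

Lemma vertex_hull t p : vertex t p -> hull t p.
Proof. by have [? ? ?] := vertices_hull t => -[] ->. Qed.

(** Since two vertices are kept, one of any two vertices of the larger tile is
    kept; if these two are its lowest ones, the minimal height is the same as
    before or greater. *)
Lemma compose_vertices n s t : let T := compose n s t in
  [\/ vertex t (apex T) /\ vertex t (same T),
      vertex t (apex T) /\ vertex t (diff T) |
      vertex t (same T) /\ vertex t (diff T)].
Proof.
rewrite /compose /vertex; case: s => /=.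
  by constructor 1; split; [constructor 1|constructor 2].
rewrite /glue /partner; case: (odd n); case: (small t) => /=.
- constructor 3; split; [by constructor 3|by constructor 1].
- constructor 2; split; [by constructor 3|by constructor 2].
- constructor 2; split; [by constructor 3|by constructor 2].
- constructor 1; split; [by constructor 2|by constructor 1].
Qed.

Lemma lowest_pair (r1 r2 r3 : R) : ~ (r1 < r2 /\ r1 < r3) ->
  ~ (r2 < r1 /\ r2 < r3) -> ~ (r3 < r1 /\ r3 < r2) -> exists a : R,
  [\/ r1 = a /\ r2 = a, r1 = a /\ r3 = a | r2 = a /\ r3 = a] /\
  [/\ a <= r1, a <= r2 & a <= r3].
Proof.
move=> h1 h2 h3; have [l12|l21|e12] := ltrgtP r1 r2.
- have e : r1 = r3.
    by have [l|l|//] := ltrgtP r1 r3; [case: h1|case: h3; split=> //; lra].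
  by exists r1; split; [constructor 2|split; lra].
- have e : r2 = r3.
    by have [l|l|//] := ltrgtP r2 r3; [case: h2|case: h3; split=> //; lra].
  by exists r2; split; [constructor 3|split; lra].
exists r1; split; first by constructor 1.
split; [by []|by rewrite e12|].
by rewrite leNgt; apply/negP => l; case: h3; split=> //; rewrite -e12.
Qed.

(** If a half-plane contains [Uz] and its boundary line contains two limit
    points of [Uz], then that line contains two vertices of [tz n] for large
    [n]: otherwise a single vertex would be lowest, and by the bound on the
    slopes [tz n] would be far from one of the two points. *)
Lemma two_on_line e o p q : e \in directions R ->
  (forall x, Uz x -> 0 <= height e o x) ->
  closure Uz p -> closure Uz q -> p <> q -> height e o p = 0 -> height e o q = 0 ->
  exists N, forall n, (N <= n)%N -> two_at (height e o) 0 (tz n).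
Proof.
move=> de hU cp cq pq hp hq; have e1 := dot_direction de.
have [c c0 hc] := directions_slope e.
have dpq : dot e (p - q) != 0.
  apply/eqP => d0; apply: pq; apply/eqP; rewrite -subr_eq0; apply/eqP.
  apply: dot0; have c1 : cross e (p - q) = 0.
    transitivity (height e o p - height e o q); last by rewrite hp hq subrr.
    by rewrite /height /cross !coordE; ring.
  have : dot (p - q) (p - q) * dot e e = dot e (p - q) ^+ 2 + cross e (p - q) ^+ 2.
    by rewrite /dot /cross; ring.
  by rewrite e1 d0 c1 mulr1 expr0n /= addr0.
pose d : R := `|dot e (p - q)|; have d0 : 0 < d by rewrite normr_gt0.
(* If x and y are r-close to p and q, and a corner of slope c at P contains both,
   then d is at most 2 r + 2 r / c, which is d / 2 for this r. *)
pose r := d * c / (4 * (c + 1)).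
have c40 : 0 < 4 * (c + 1) by lra.
have r0 : 0 < r by rewrite divr_gt0 // mulr_gt0.
have rE : 4 * r * (c + 1) = d * c by rewrite /r; field; rewrite gt_eqF //; lra.
(* points of Uz near a limit point on the line *)
have near p0 r1 : 0 < r1 -> closure Uz p0 -> height e o p0 = 0 ->
    exists2 x, Uz x & `|dot e (x - p0)| < r1 /\ height e o x < r1.
  move=> {}r0 cl h0.
  have n1 : nbhs p0 [set y | 0 < r1 - dot e (y - p0)].
    apply: (affine_gt0_nbhs (v := - e)); last by rewrite subrr /dot !coordE; lra.
    by move=> y; rewrite /dot !coordE; ring.
  have n2 : nbhs p0 [set y | 0 < r1 + dot e (y - p0)].
    apply: (affine_gt0_nbhs (v := e)); last by rewrite subrr /dot !coordE; lra.
    by move=> y; rewrite /dot !coordE; ring.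
  have n3 : nbhs p0 [set y | 0 < r1 - height e o y].
    apply: (affine_gt0_nbhs (v := (e.2, - e.1))); last by rewrite h0 subr0.
    by move=> y; rewrite /height /cross /dot !coordE /=; ring.
  have [x [Ux [/= h1 [h2 h3]]]] := cl _ (filterI n1 (filterI n2 n3)).
  exists x => //; split; last by rewrite -subr_gt0.
  by rewrite ltr_norml; apply/andP; split; lra.
have [x [nx _ hx] [x1 x2]] := near p r r0 cp hp.
have [y [ny _ hy] [y1 y2]] := near q r r0 cq hq.
have nocorner n (P Q X : point) : (maxn nx ny <= n)%N -> vertex (tz n) P ->
    (forall w, hull (tz n) w -> exists a1 a2, [/\ 0 <= a1, 0 <= a2 &
       w = P + a1 *: (Q - P) + a2 *: (X - P)]) ->
    directed (Q - P) -> directed (X - P) ->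
    ~ (height e o P < height e o Q /\ height e o P < height e o X).
  rewrite geq_max => /andP[hn1 hn2] vP hw dQ dX [lQ lX].
  have P0 : 0 <= height e o P by apply: hU; exists n => //; exact: vertex_hull.
  have [a1 [a2 [a10 a20 ex]]] := hw x (hull_tz_mono hn1 hx).
  have [b1 [b2 [b10 b20 ey]]] := hw y (hull_tz_mono hn2 hy).
  have := corner_close e1 c0 hc dQ dX P0 lQ lX a10 a20 ex.
  have := corner_close e1 c0 hc dQ dX P0 lQ lX b10 b20 ey.
  move=> k1 k2.
  have tri : d <= `|dot e (x - p)| + `|dot e (x - P)| + `|dot e (y - P)| + `|dot e (y - q)|.
    have -> : d = `| - dot e (x - p) + dot e (x - P) - dot e (y - P) + dot e (y - q)|.
      by rewrite /d; congr (`|_|); rewrite /dot !coordE; ring.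
    apply: le_trans (ler_normD _ _) _; rewrite lerD2r.
    apply: le_trans (ler_normB _ _) _; rewrite lerD2r.
    by apply: le_trans (ler_normD _ _) _; rewrite normrN.
  have : c * d <= c * (2 * r) + 2 * r by nra.
  by have cr := mulr_gt0 c0 r0; lra.
have low n : (maxn nx ny <= n)%N -> exists2 a : R,
    two_at (height e o) a (tz n) & forall v, vertex (tz n) v -> a <= height e o v.
  move=> hn; have [d1 d2 d3] := tz_directed R z n.
  have na : ~ (height e o (apex (tz n)) < height e o (same (tz n)) /\
      height e o (apex (tz n)) < height e o (diff (tz n))).
    apply: (nocorner n) => //; first by constructor 1.
    move=> w [a1 [a2 [a3 [p1 p2 p3 s ->]]]]; exists a2, a3; split=> //.
    have -> : a1 = 1 - a2 - a3 by lra.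
    by apply: point_ext; rewrite !coordE; ring.
  have ns : ~ (height e o (same (tz n)) < height e o (apex (tz n)) /\
      height e o (same (tz n)) < height e o (diff (tz n))).
    apply: (nocorner n) => //; [by constructor 2| |by rewrite -opprB; exact: directedN].
    move=> w [a1 [a2 [a3 [p1 p2 p3 s ->]]]]; exists a1, a3; split=> //.
    have -> : a2 = 1 - a1 - a3 by lra.
    by apply: point_ext; rewrite !coordE; ring.
  have nd : ~ (height e o (diff (tz n)) < height e o (apex (tz n)) /\
      height e o (diff (tz n)) < height e o (same (tz n))).
    apply: (nocorner n) => //; [by constructor 3| |by rewrite -opprB; exact: directedN
      |by rewrite -opprB; exact: directedN].
    move=> w [a1 [a2 [a3 [p1 p2 p3 s ->]]]]; exists a1, a2; split=> //.
    have -> : a3 = 1 - a1 - a2 by lra.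
    by apply: point_ext; rewrite !coordE; ring.
  have [a [ta [la ls ld]]] := lowest_pair na ns nd.
  by exists a => // v [] ->.
have [//|] := pselect (exists N, forall n, (N <= n)%N -> two_at (height e o) 0 (tz n)).
move=> none; exfalso.
have [n hn [a ta la]] : exists2 n, (maxn nx ny <= n)%N & exists2 a : R,
    two_at (height e o) a (tz n) & 0 < a /\ forall v, vertex (tz n) v -> a <= height e o v.
  apply: contrapT => h; apply: none; exists (maxn nx ny) => n hn.
  have [a ta la] := low n hn.
  have [a0|a0] := ltrP 0 a; first by case: h; exists n => //; exists a.
  suff -> : 0 = a by [].
  apply/eqP; rewrite eq_le a0 andbT.
  have aU v : vertex (tz n) v -> 0 <= height e o v.
    by move=> hv; apply: hU; exists n => //; exact: vertex_hull.
  by case: ta => -[<- _]; apply: aU; [constructor 1|constructor 1|constructor 2].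
case: la => a0 la.
have la' k v : vertex (tz (n + k)) v -> a <= height e o v.
  elim: k v => [|k IH] v; first by rewrite addn0; exact: la.
  have [b tb lb] := low (n + k.+1)%N (leq_trans hn (leq_addr _ _)).
  move=> /lb; apply: le_trans; move: tb; rewrite addnS /=.
  have := compose_vertices (n + k) (z (n + k).+1) (tz (n + k)).
  set T := compose _ _ _ => /= hv; rewrite /two_at.
  by case: hv => -[/IH h1 /IH h2] [] [e2 e3]; rewrite -?e2 -?e3 //; move: h1 h2; rewrite ?e2 ?e3.
have [x' [m _ hx'] [_ hlt]] := near p a a0 cp hp.
have hm : hull (tz (n + m)) x' by apply: hull_tz_mono hx'; rewrite leq_addl.
move: hlt; apply/negP; rewrite -leNgt.
case: hm => a1 [a2 [a3 [p1 p2 p3 s ->]]].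
have := la' m (apex (tz (n + m))) (Or31 _ _ erefl).
have := la' m (same (tz (n + m))) (Or32 _ _ erefl).
have := la' m (diff (tz (n + m))) (Or33 _ _ erefl).
have -> : height e o (a1 *: apex (tz (n + m)) + a2 *: same (tz (n + m)) + a3 *: diff (tz (n + m)))
  = a1 * height e o (apex (tz (n + m))) + a2 * height e o (same (tz (n + m))) + a3 * height e o (diff (tz (n + m))).
  have -> : a1 = 1 - a2 - a3 by lra.
  by rewrite /height /cross !coordE; ring.
by move=> *; nra.
Qed.
End Region.

End WallLines.

(** * Boundary lines and their common vertices *)

Section BoundaryLines.
Variable R : realType.
Local Notation point := (R * R)%type.
Local Notation tau := (tau R).
Local Notation tile := (tile R).
Implicit Types (p q x y w v e o : point) (a b c l : R) (f g : point -> point).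
Implicit Types (t T L S : tile) (n : nat) (h : bool).

(** For a unit vector [e], the reflection in the line through [o] in the
    direction [e] *)
Definition line_reflection e o x : point :=
  x - (2 * height e o x) *: (- e.2, e.1).

Lemma reflect_lineE e o p q x : dot e e = 1 -> p <> q ->
  height e o p = 0 -> height e o q = 0 ->
  reflect_line p q x = line_reflection e o x.
Proof.
move=> e1 pq hp hq; pose l := dot e (q - p).
have qp : q - p = l *: e.
  have c0 : cross e (q - p) = 0.
    transitivity (height e o q - height e o p); last by rewrite hp hq subrr.
    by rewrite /height /cross !coordE; ring.
  have E w : w = dot e w *: e + cross e w *: (- e.2, e.1).
    have k (r : R) : r = r * dot e e by rewrite e1 mulr1.
    by apply: point_ext; rewrite [LHS]k /dot /cross !coordE /=; ring.
  by rewrite [LHS]E c0 scale0r addr0.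
have l0 : l != 0.
  by apply/eqP => l0; apply: pq; apply/eqP; rewrite eq_sym -subr_eq0 qp l0 scale0r.
have xE : x = p + dot e (x - p) *: e + height e o x *: (- e.2, e.1).
  have k (r : R) : r = r * dot e e by rewrite e1 mulr1.
  have -> : height e o x = cross e (x - p).
    have : height e o x - height e o p = cross e (x - p).
      by rewrite /height /cross !coordE; ring.
    by rewrite hp subr0.
  apply/eqP; rewrite -addrA addrC -subr_eq; apply/eqP.
  by apply: point_ext; rewrite [LHS]k /dot /cross !coordE /=; ring.
rewrite /reflect_line /line_reflection qp.
have -> : dot (x - p) (l *: e) / dot (l *: e) (l *: e) *: (l *: e) =
    dot e (x - p) *: e.
  by rewrite !(dotZr, dotZl) e1 scalerA dotC; congr (_ *: _); field.
move: (height e o x) (dot e (x - p)) xE => u v ->.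
by apply: point_ext; rewrite mulr2n !coordE /=; ring.
Qed.

Section Region.
Variable z : penrose_seq.
Local Notation tz := (tz R z).
Local Notation Uz := (@Uz R z).

Definition boundary_line e o := [/\ e \in directions R,
  forall x, Uz x -> 0 <= height e o x &
  exists N, forall n, (N <= n)%N -> two_at (height e o) 0 (tz n)].

(** The supporting line at the midpoint of a wall contains the wall. *)
Lemma wall_line p q : wall z p q -> exists e o, boundary_line e o /\
  forall x, reflect_line p q x = line_reflection e o x.
Proof.
move=> [pq seg]; pose o : point := p + (1 / 2) *: (q - p).
have so : segment p q o by exists (1 / 2) => //=; apply/andP; split; lra.
have sp : segment p q p by exists 0; rewrite /= ?lexx ?ler01 // scale0r addr0.
have sq : segment p q q by exists 1; rewrite /= ?lexx ?ler01 // scale1r addrC subrK.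
have [e de hU] := supporting_line (seg _ so).
have cl x : closure Uz x -> 0 <= height e o x.
  move=> cx; rewrite leNgt; apply/negP => hx.
  have nx : nbhs x [set y | 0 < - height e o y].
    apply: (affine_gt0_nbhs (v := (e.2, - e.1))); last by rewrite oppr_gt0.
    by move=> y; rewrite /height /cross /dot !coordE /=; ring.
  have [y [Uy /=]] := cx _ nx.
  by rewrite oppr_gt0 ltNge hU.
have [cp cq] : closure Uz p /\ closure Uz q by split; [case: (seg _ sp)|case: (seg _ sq)].
have e0 : height e o p + height e o q = 0.
  by rewrite /height /cross /o !coordE; field.
have := cl _ cp; have := cl _ cq => h1 h2.
have hp : height e o p = 0 by lra.
have hq : height e o q = 0 by lra.
exists e, o; split; last by move=> x; apply: reflect_lineE => //; exact: dot_direction.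
split=> //; exact: two_on_line hU cp cq pq hp hq.
Qed.

Definition same_line e o e' o' := cross e e' = 0 /\ height e o o' = 0.

Lemma unit_parallel e e' : dot e e = 1 -> dot e' e' = 1 -> cross e e' = 0 ->
  e' = e \/ e' = - e.
Proof.
move=> h1 h2 h3; have d1 : dot e e' ^+ 2 = 1.
  have : dot e e' ^+ 2 + cross e e' ^+ 2 = dot e e * dot e' e'.
    by rewrite /dot /cross; ring.
  by rewrite h1 h2 h3 mulr1 expr0n /= addr0.
have E : e' = dot e e' *: e.
  have k (r : R) : r = r * dot e e by rewrite h1 mulr1.
  have : e' = dot e e' *: e + cross e e' *: (- e.2, e.1).
    by apply: point_ext; rewrite [LHS]k /dot /cross !coordE /=; ring.
  by rewrite h3 scale0r addr0.
move/eqP: d1; rewrite sqrf_eq1 => /orP[] /eqP d; rewrite E d; [left|right].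
  by rewrite scale1r.
by rewrite scaleN1r.
Qed.

Lemma same_line_reflection e o e' o' x :
  e \in directions R -> e' \in directions R -> same_line e o e' o' ->
  line_reflection e' o' x = line_reflection e o x.
Proof.
move=> de de' [h1 h2].
have E : height e o x = cross e (x - o').
  have : height e o x = height e o o' + cross e (x - o').
    by rewrite /height /cross !coordE; ring.
  by rewrite h2 add0r.
rewrite /line_reflection E.
have [->|->] := unit_parallel (dot_direction de) (dot_direction de') h1; first by [].
by rewrite /height /cross; apply: point_ext; rewrite !coordE /=; ring.
Qed.

Lemma two_points_line e o e' o' p q : dot e e = 1 -> dot e' e' = 1 -> p <> q ->
  height e o p = 0 -> height e o q = 0 -> height e' o' p = 0 -> height e' o' q = 0 ->
  same_line e o e' o'.
Proof.
move=> e1 e1' pq h1 h2 h3 h4.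
have c1 : cross e (q - p) = 0.
  transitivity (height e o q - height e o p); last by rewrite h1 h2 subrr.
  by rewrite /height /cross !coordE; ring.
have c2 : cross e' (q - p) = 0.
  transitivity (height e' o' q - height e' o' p); last by rewrite h3 h4 subrr.
  by rewrite /height /cross !coordE; ring.
have c3 : cross e' (p - o') = 0 by [].
have w0 : q - p <> 0 by move/eqP; rewrite subr_eq0 => /eqP /esym.
have c4 : cross e e' = 0.
  apply: contrapT => /eqP c0; apply: w0.
  have : cross e e' *: (q - p) = cross e (q - p) *: e' - cross e' (q - p) *: e.
    by apply: point_ext; rewrite /cross !coordE; ring.
  rewrite c1 c2 !scale0r subrr => /eqP; rewrite scaler_eq0 (negbTE c0) /=.
  by move/eqP.
split=> //; have : height e o o' = height e o p - cross e (p - o').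
  by rewrite /height /cross !coordE; ring.
rewrite h1 sub0r => ->; apply/eqP; rewrite oppr_eq0; apply/eqP.
have [ee|ee] := unit_parallel e1 e1' c4; rewrite ee in c3; first by [].
by apply/eqP; rewrite -oppr_eq0; apply/eqP; rewrite -[RHS]c3 /cross !coordE; ring.
Qed.

Lemma area_vertices t : area t != 0 ->
  [/\ apex t <> same t, apex t <> diff t & same t <> diff t].
Proof.
move=> t0; split=> e; move/eqP: t0; case; rewrite /area /cross !coordE e; ring.
Qed.

(** The transitions between the roles of a point that is a vertex of a tile and
    of the next larger one *)
Lemma vertex_compose n s t p : area t != 0 -> ~~ (small t && s) ->
  vertex t p -> vertex (compose n s t) p ->
  if s then [\/ p = apex t /\ p = apex (compose n s t),
       p = same t /\ p = same (compose n s t) |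
       p = diff t /\ p = diff (compose n s t)]
  else if odd n then
    if small t then (p = diff t /\ p = same (compose n s t)) \/
                    (p = apex t /\ p = diff (compose n s t))
    else (p = diff t /\ p = apex (compose n s t)) \/
         (p = same t /\ p = diff (compose n s t))
  else
    if small t then (p = diff t /\ p = apex (compose n s t)) \/
                    (p = same t /\ p = diff (compose n s t))
    else (p = apex t /\ p = same (compose n s t)) \/
         (p = same t /\ p = apex (compose n s t)).
Proof.
move=> t0; have [n1 n2 n3] := area_vertices t0.
have out (r : R) : 0 < r -> [/\ ~ hull t (diff t + r *: (diff t - apex t)),
    ~ hull t (apex t + r *: (apex t - same t)),
    ~ hull t (apex t + r *: (apex t - diff t)) &
    ~ hull t (same t + r *: (same t - diff t))].
  move=> r0; split=> /(hullP _ t0)[]; rewrite leNgt => /negP b1;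
    rewrite leNgt => /negP b2; rewrite leNgt => /negP b3.
  - have [e _ _] : [/\ bary_apex t (diff t + r *: (diff t - apex t)) = - r,
      bary_same t (diff t + r *: (diff t - apex t)) = 0 &
      bary_diff t (diff t + r *: (diff t - apex t)) = 1 + r].
      by apply: baryE => //; [ring|apply: point_ext; rewrite !coordE; ring].
    by apply: b1; rewrite e oppr_lt0.
  - have [_ e _] : [/\ bary_apex t (apex t + r *: (apex t - same t)) = 1 + r,
      bary_same t (apex t + r *: (apex t - same t)) = - r &
      bary_diff t (apex t + r *: (apex t - same t)) = 0].
      by apply: baryE => //; [ring|apply: point_ext; rewrite !coordE; ring].
    by apply: b2; rewrite e oppr_lt0.
  - have [_ _ e] : [/\ bary_apex t (apex t + r *: (apex t - diff t)) = 1 + r,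
      bary_same t (apex t + r *: (apex t - diff t)) = 0 &
      bary_diff t (apex t + r *: (apex t - diff t)) = - r].
      by apply: baryE => //; [ring|apply: point_ext; rewrite !coordE; ring].
    by apply: b3; rewrite e oppr_lt0.
  - have [_ _ e] : [/\ bary_apex t (same t + r *: (same t - diff t)) = 0,
      bary_same t (same t + r *: (same t - diff t)) = 1 + r &
      bary_diff t (same t + r *: (same t - diff t)) = - r].
      by apply: baryE => //; [ring|apply: point_ext; rewrite !coordE; ring].
    by apply: b3; rewrite e oppr_lt0.
have [o1 _ o3 _] := out _ (tauV_gt0 R); have [_ o2 _ o4] := out _ (tau_gt0 R).
move=> st vp; have := vertex_hull vp; move: vp.
move: st; rewrite /compose /glue /partner /vertex; case: s => /=.
  by move=> _ [] -> _ _; [constructor 1|constructor 2|constructor 3].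
case: (odd n); case: (small t) => _ /= hp hh hp'.
- case: hp' => e'; first by case: o4; rewrite -e'.
    by left.
  by right.
- case: hp' => e'; [by left|by case: o3; rewrite -e'|by right].
- case: hp' => e'; [by left|by case: o2; rewrite -e'|by right].
- case: hp' => e'; [by right|by left|by case: o1; rewrite -e'].
Qed.

Arguments Defs.tz : simpl never.

Section CommonVertex.
Variables (N : nat) (p : point).
Hypothesis pN : forall n, (N <= n)%N -> vertex (tz n) p.

Lemma common_step n : (N <= n)%N ->
  if z n.+1 then [\/ p = apex (tz n) /\ p = apex (tz n.+1),
       p = same (tz n) /\ p = same (tz n.+1) |
       p = diff (tz n) /\ p = diff (tz n.+1)]
  else if odd n then
    if z n then (p = diff (tz n) /\ p = same (tz n.+1)) \/
                (p = apex (tz n) /\ p = diff (tz n.+1))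
    else (p = diff (tz n) /\ p = apex (tz n.+1)) \/
         (p = same (tz n) /\ p = diff (tz n.+1))
  else
    if z n then (p = diff (tz n) /\ p = apex (tz n.+1)) \/
                (p = same (tz n) /\ p = diff (tz n.+1))
    else (p = apex (tz n) /\ p = same (tz n.+1)) \/
         (p = same (tz n) /\ p = apex (tz n.+1)).
Proof.
move=> hn; rewrite -(small_tz R z n); apply: vertex_compose.
- exact: area_shape (shape_tz R z n).
- by rewrite small_tz no_11.
- exact: pN.
- by apply: (pN (n := n.+1)); exact: leqW.
Qed.

Lemma common_excl n : [/\ p = apex (tz n) -> p <> same (tz n),
  p = apex (tz n) -> p <> diff (tz n) & p = same (tz n) -> p <> diff (tz n)].
Proof.
have [n1 n2 n3] := area_vertices (area_shape (shape_tz R z n)).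
by split=> -> //; apply/nesym.
Qed.

Lemma common_next n : (N <= n)%N ->
  [/\ p = apex (tz n) ->
        if z n.+1 then p = apex (tz n.+1)
        else if odd n then z n /\ p = diff (tz n.+1)
        else ~~ z n /\ p = same (tz n.+1),
      p = same (tz n) ->
        if z n.+1 then p = same (tz n.+1)
        else if odd n then ~~ z n /\ p = diff (tz n.+1)
        else if z n then p = diff (tz n.+1) else p = apex (tz n.+1) &
      p = diff (tz n) ->
        if z n.+1 then p = diff (tz n.+1)
        else if odd n then
          (if z n then p = same (tz n.+1) else p = apex (tz n.+1))
        else z n /\ p = apex (tz n.+1)].
Proof.
move=> hn; have := common_step hn; have [x1 x2 x3] := common_excl n.
case: (z n.+1); first by case=> -[e e']; split=> e2 //;
  first [by case: (x1 e) | by case: (x2 e) | by case: (x3 e)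
        | by case: (x1 e2) | by case: (x2 e2) | by case: (x3 e2)].
by case: (odd n); case: (z n); case=> -[e e']; split=> e2 //;
  first [by case: (x1 e) | by case: (x2 e) | by case: (x3 e)
        | by case: (x1 e2) | by case: (x2 e2) | by case: (x3 e2)].
Qed.

Lemma next0 n : z n -> z n.+1 = false.
Proof. by move=> zn; have := no_11 z n; rewrite zn => /negbTE. Qed.

(** In each of the next lemmas, following the transitions for a few levels from
    the excluded state leads to a contradiction. *)
Lemma even_apex0 n : (N <= n)%N -> ~~ odd n -> p = apex (tz n) -> z n = false.
Proof.
move=> hn on e; apply/negP => zn; have [h _ _] := common_next hn.
by have := h e; rewrite (next0 zn) (negbTE on) zn => -[].
Qed.

Lemma odd_apex1 n : (N <= n)%N -> odd n -> p = apex (tz n) -> z n.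
Proof.
move=> hn on e; have [h _ _] := common_next hn; have := h e; rewrite on.
case zn: (z n.+1); last by case.
move=> e'; have := even_apex0 (leqW hn) _ e'.
by rewrite /= on zn => /(_ isT).
Qed.

Lemma even_same1 n : (N <= n)%N -> ~~ odd n -> p = same (tz n) -> z n.
Proof.
move=> hn on e; apply/negPn/negP => zn; have [_ h _] := common_next hn.
have := h e; rewrite (negbTE on) (negbTE zn).
case zn1: (z n.+1) => e'; last first.
  by have := odd_apex1 (leqW hn) on e'; rewrite zn1.
have [_ h' _] := common_next (leqW hn); have := h' e'.
by rewrite (next0 zn1) /= on zn1 => -[].
Qed.

Lemma even_diff1 n : (N <= n)%N -> ~~ odd n -> p = diff (tz n) -> z n.
Proof.
move=> hn on e; have [_ _ h] := common_next hn; have := h e; rewrite (negbTE on).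
case zn1: (z n.+1); last by case.
move=> e'; have [_ _ h'] := common_next (leqW hn).
have := h' e'; rewrite (next0 zn1) /= on zn1 => e2.
have := even_same1 (leqW (leqW hn)) _ e2; rewrite /= negbK (next0 zn1).
by move=> /(_ on).
Qed.

Lemma odd_apex_dead n : (N <= n)%N -> odd n -> p <> apex (tz n).
Proof.
move=> hn on e; have zn := odd_apex1 hn on e; have [h _ _] := common_next hn.
have := h e; rewrite (next0 zn) on => -[_ e'].
have := even_diff1 (leqW hn) _ e'; rewrite /= on (next0 zn).
by move=> /(_ isT).
Qed.

Lemma even_diff_dead n : (N <= n)%N -> ~~ odd n -> p <> diff (tz n).
Proof.
move=> hn on e; have zn := even_diff1 hn on e; have [_ _ h] := common_next hn.
have := h e; rewrite (next0 zn) (negbTE on) => -[_ e'].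
exact: odd_apex_dead (leqW hn) on e'.
Qed.

Lemma odd_same_next n : (N <= n)%N -> odd n -> p = same (tz n) ->
  z n.+1 /\ p = same (tz n.+1).
Proof.
move=> hn on e; have [_ h _] := common_next hn; have := h e; rewrite on.
case: (z n.+1) => // -[_ e']; case: (even_diff_dead (leqW hn) _ e').
by rewrite /= on.
Qed.

Lemma odd_diff_next n : (N <= n)%N -> odd n -> p = diff (tz n) ->
  p = apex (tz n.+1).
Proof.
move=> hn on e; have [_ _ h] := common_next hn; have := h e; rewrite on.
case zn1: (z n.+1); first move=> e'.
  by case: (even_diff_dead (leqW hn) _ e'); rewrite /= on.
case: (z n) => // e'; have := even_same1 (leqW hn) _ e'.
by rewrite zn1 /= on => /(_ isT).
Qed.

Lemma even_same_next n : (N <= n)%N -> ~~ odd n -> p = same (tz n) ->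
  p = apex (tz n.+2).
Proof.
move=> hn on e; have zn := even_same1 hn on e; have [_ h _] := common_next hn.
have := h e; rewrite (next0 zn) (negbTE on) zn => e'.
exact: odd_diff_next (leqW hn) on e'.
Qed.

(** The states that are left form one cycle, which runs through the apex and
    [same] at even levels while the sequence repeats 0010. *)
Lemma common_apex : exists n, [/\ (N <= n)%N, ~~ odd n, p = apex (tz n) &
  [/\ z n = false, z n.+1 = false & z n.+2]].
Proof.
have [n [hn on e]] : exists n, [/\ (N <= n)%N, ~~ odd n & p = apex (tz n)].
  have hN := leqnn N; have := pN hN; case oN: (odd N) => -[] e.
  - by case: (odd_apex_dead hN oN e).
  - have [_ e'] := odd_same_next hN oN e; exists N.+3; split.
    + by do 3 apply: leqW.
    + by rewrite /= oN.
    + by apply: (even_same_next (n := N.+1)) e'; [exact: leqW|rewrite /= oN].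
  - exists N.+1; split; [exact: leqW|by rewrite /= oN|exact: odd_diff_next].
  - by exists N; split; rewrite ?oN.
  - exists N.+2; split; [by do 2 apply: leqW|by rewrite /= oN|].
    by apply: even_same_next => //; rewrite oN.
  - by case: (even_diff_dead hN _ e); rewrite oN.
exists n; split=> //; have z0 := even_apex0 hn on e.
have [h _ _] := common_next hn; have := h e; rewrite (negbTE on) z0.
case zn1: (z n.+1) => e'; first by case: (odd_apex_dead (leqW hn) _ e').
have [] := odd_same_next (leqW hn) _ (proj2 e') => //.
Qed.

End CommonVertex.

(** At the level given by [common_apex] for [p], no other vertex of the tile is
    in a possible state. *)
Lemma common_unique N p q : (forall n, (N <= n)%N -> vertex (tz n) p) ->
  (forall n, (N <= n)%N -> vertex (tz n) q) -> p = q.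
Proof.
move=> hp hq; have [n [hn on -> [z0 _ _]]] := common_apex hp.
case: (hq n hn) => e //.
  by have := even_same1 hq hn on e; rewrite z0.
by case: (even_diff_dead hq hn on e).
Qed.

End Region.
End BoundaryLines.

(** * Foldings of a half-plane and of a sector *)

Section Fold.
Variable R : realType.
Local Notation point := (R * R)%type.
Local Notation tau := (tau R).
Local Notation tile := (tile R).
Implicit Types (p q x y w v e o : point) (a b c l : R) (f g : point -> point).
Implicit Types (t T L S : tile) (n : nat) (h : bool).

(** The real and imaginary parts of (x + i y) ^ 5 *)
Definition re5 (x y : R) := x ^+ 5 - 10 * x ^+ 3 * y ^+ 2 + 5 * x * y ^+ 4.
Definition im5 (x y : R) := 5 * x ^+ 4 * y - 10 * x ^+ 2 * y ^+ 3 + y ^+ 5.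

(** With c + i s in the role of w0, the reflection is w |-> w0 * conj w, and the
    fifth power of the image is w0 ^ 5 * conj (w ^ 5). *)
Lemma re5_reflection (c s x y : R) : re5 (c * x + s * y) (s * x - c * y) =
  re5 c s * re5 x y + im5 c s * im5 x y.
Proof. by rewrite /re5 /im5; ring. Qed.

(** The coordinates of the fifth root of unity of angle 72 degrees *)
Lemma root5 : let c := (tau - 1) / 2 in let s := tau * sin (pi / 5) in
  [/\ c ^+ 2 + s ^+ 2 = 1, re5 c s = 1 & im5 c s = 0].
Proof.
move=> c s; have t2 := tau2 R.
have c2 : c ^+ 2 = (2 - tau) / 4 by rewrite /c; field: t2.
have s2 : s ^+ 2 = (tau + 2) / 4.
  by rewrite /s exprMn sin_pi5_sqr; field: t2.
have c4 : c ^+ 4 = (5 - 3 * tau) / 16.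
  by rewrite (exprM c 2 2) c2; field: t2.
have s4 : s ^+ 4 = (5 * tau + 5) / 16.
  by rewrite (exprM s 2 2) s2; field: t2.
split; first by rewrite c2 s2; field.
  have -> : re5 c s = c * (c ^+ 4 - 10 * c ^+ 2 * s ^+ 2 + 5 * s ^+ 4).
    by rewrite /re5; ring.
  by rewrite c4 s4 c2 s2 /c; field: t2.
have -> : im5 c s = s * (5 * c ^+ 4 - 10 * c ^+ 2 * s ^+ 2 + s ^+ 4).
  by rewrite /im5; ring.
rewrite c4 s4 c2 s2; apply/eqP; rewrite mulf_eq0; apply/orP; right; apply/eqP.
by field: t2.
Qed.

(** In the sector of angle 36 degrees, [w ^ 5] runs through the upper half
    plane, so that [w] is determined by its norm and the real part of
    [w ^ 5]. *)
Lemma sector_inj (x y x' y' : R) :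
  0 <= y -> 0 <= sin (pi / 5) * x - tau / 2 * y ->
  0 <= y' -> 0 <= sin (pi / 5) * x' - tau / 2 * y' ->
  x ^+ 2 + y ^+ 2 = x' ^+ 2 + y' ^+ 2 -> re5 x y = re5 x' y' -> x = x' /\ y = y'.
Proof.
have t2 := tau2 R; have t1 := tau_gt1 R.
have s0 := sin_pi5_gt0 R; have s2 := sin_pi5_sqr R.
set c := tau / 2; move: s0 s2; set s := sin (pi / 5) => s0 s2.
have c0 : 0 < c by rewrite /c; lra.
have cs : c ^+ 2 + s ^+ 2 = 1 by rewrite s2 /c; field: t2.
have c2 : c ^+ 2 = (tau + 1) / 4 by rewrite /c; field: t2.
move=> y0 w0 y0' w0' nE rE; clearbody c s.
pose r := Num.sqrt (x ^+ 2 + y ^+ 2).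
have r2 : r ^+ 2 = x ^+ 2 + y ^+ 2 by rewrite sqr_sqrtr // addr_ge0 ?sqr_ge0.
have r0 : 0 <= r := sqrtr_ge0 _.
have bound (u v : R) : 0 <= v -> 0 <= s * u - c * v -> r ^+ 2 = u ^+ 2 + v ^+ 2 ->
    0 <= u - c * r.
  move=> v0 uv ruv; have u0 : 0 <= u.
    by rewrite -(pmulr_rge0 _ s0); have := mulr_ge0 (ltW c0) v0; lra.
  rewrite subr_ge0 -(@ler_pXn2r _ 2) ?nnegrE ?mulr_ge0 ?(ltW c0) //.
  rewrite exprMn ruv; have cv := mulr_ge0 (ltW c0) v0.
  have : (c * v) ^+ 2 <= (s * u) ^+ 2.
    by rewrite ler_pXn2r ?nnegrE // ?mulr_ge0 ?(ltW s0) //; lra.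
  have e : u ^+ 2 = c ^+ 2 * u ^+ 2 + s ^+ 2 * u ^+ 2.
    by rewrite -mulrDl cs mul1r.
  by rewrite !exprMn => ?; lra.
have a0 := bound x y y0 w0 r2.
have a0' : 0 <= x' - c * r by apply: bound y0' w0' _; rewrite r2.
have E (u v : R) : r ^+ 2 = u ^+ 2 + v ^+ 2 ->
    re5 u v = 16 * u ^+ 5 - 20 * u ^+ 3 * r ^+ 2 + 5 * u * r ^+ 4.
  by move=> ruv; rewrite (exprM r 2 2) ruv /re5; ring.
have xx : x = x'.
  move: rE; rewrite (E x y) // (E x' y'); last by rewrite r2.
  set a := x - c * r in a0; set a' := x' - c * r in a0' => rE.
  have xa : x = c * r + a by rewrite /a; ring.
  have xa' : x' = c * r + a' by rewrite /a'; ring.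
  apply/eqP; rewrite -subr_eq0; apply/negPn/negP => ne.
  (* the quotient of the difference of the values at x and x' by x - x' *)
  pose q := 5 * (16 * c ^+ 4 - 12 * c ^+ 2 + 1) * r ^+ 4
     + 20 * c * (8 * c ^+ 2 - 3) * r ^+ 3 * (a + a')
     + 20 * (8 * c ^+ 2 - 1) * r ^+ 2 * (a ^+ 2 + a * a' + a' ^+ 2)
     + 80 * c * r * (a ^+ 3 + a ^+ 2 * a' + a * a' ^+ 2 + a' ^+ 3)
     + 16 * (a ^+ 4 + a ^+ 3 * a' + a ^+ 2 * a' ^+ 2 + a * a' ^+ 3 + a' ^+ 4).
  have q0 : (x - x') * q = 0.
    rewrite -[RHS](subrr (16 * x ^+ 5 - 20 * x ^+ 3 * r ^+ 2 + 5 * x * r ^+ 4)).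
    by rewrite {2}rE /q xa xa'; ring.
  move/eqP: q0; rewrite mulf_eq0 (negbTE ne) /= => /eqP q0.
  have c4 : 16 * c ^+ 4 - 12 * c ^+ 2 + 1 = 0.
    by rewrite (exprM c 2 2) c2; field: t2.
  have k1 : 0 <= 8 * c ^+ 2 - 3 by rewrite c2; lra.
  have k2 : 0 <= 8 * c ^+ 2 - 1 by rewrite c2; lra.
  move: q0; rewrite /q c4 mulr0 mul0r add0r.
  set q1 := 20 * c * _ * _ * _; set q2 := 20 * _ * _ * _; set q3 := 80 * c * r * _.
  have s1 : 0 <= a + a' := addr_ge0 a0 a0'.
  have s2' : 0 <= a ^+ 2 + a * a' + a' ^+ 2.
    by rewrite !addr_ge0 ?mulr_ge0 ?exprn_ge0.
  have s3 : 0 <= a ^+ 3 + a ^+ 2 * a' + a * a' ^+ 2 + a' ^+ 3.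
    by rewrite !addr_ge0 ?mulr_ge0 ?exprn_ge0.
  have h1 : 0 <= q1 by rewrite /q1 !mulr_ge0 ?exprn_ge0 ?(ltW c0).
  have h2 : 0 <= q2 by rewrite /q2 !mulr_ge0 ?exprn_ge0.
  have h3 : 0 <= q3 by rewrite /q3 !mulr_ge0 ?(ltW c0).
  have p1 : 0 <= a ^+ 3 * a' by rewrite mulr_ge0 ?exprn_ge0.
  have p2 : 0 <= a ^+ 2 * a' ^+ 2 by rewrite mulr_ge0 ?exprn_ge0.
  have p3 : 0 <= a * a' ^+ 3 by rewrite mulr_ge0 ?exprn_ge0.
  have p4 : 0 <= a ^+ 4 by rewrite exprn_ge0.
  have p5 : 0 <= a' ^+ 4 by rewrite exprn_ge0.
  move=> q0; have a40 : a ^+ 4 = 0 by lra.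
  have a40' : a' ^+ 4 = 0 by lra.
  move/eqP: a40; move/eqP: a40'; rewrite !expf_eq0 /= => /eqP e' /eqP e.
  by case/eqP: ne; rewrite xa xa' e e' subrr.
split=> //; apply/eqP; rewrite -(@eqrXn2 _ 2) //; apply/eqP.
by rewrite xx in nE; lra.
Qed.

End Fold.

Section Folding.
Variable R : realType.
Local Notation point := (R * R)%type.
Local Notation tau := (tau R).
Local Notation tile := (tile R).
Implicit Types (p q x y w v e o : point) (c l : R) (f g : point -> point).
Implicit Types (t T L S : tile) (n : nat) (h : bool).

Lemma two_at_common (F F' : point -> R) t : two_at F 0 t -> two_at F' 0 t ->
  exists p, [/\ vertex t p, F p = 0 & F' p = 0].
Proof.
have [v1 v2 v3] : [/\ vertex t (apex t), vertex t (same t) & vertex t (diff t)].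
  by split; [constructor 1|constructor 2|constructor 3].
by move=> [] [h1 h2] [] [h3 h4];
  first [by exists (apex t) | by exists (same t) | by exists (diff t)].
Qed.

Lemma height_moved e o p x : height e o p = 0 -> height e o x = cross e (x - p).
Proof.
have : height e o x = height e o p + cross e (x - p).
  by rewrite /height /cross !coordE; ring.
by move=> -> ->; rewrite add0r.
Qed.

Lemma orthonormal0 e v : dot e e = 1 -> dot e v = 0 -> cross e v = 0 -> v = 0.
Proof.
move=> e1 h1 h2; have k (r : R) : r = r * dot e e by rewrite e1 mulr1.
have -> : v = dot e v *: e + cross e v *: (- e.2, e.1).
  by apply: point_ext; rewrite [LHS]k /dot /cross !coordE /=; ring.
by rewrite h1 h2 !scale0r addr0.
Qed.

Section Region.
Variable z : penrose_seq.
Local Notation tz := (tz R z).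
Local Notation Uz := (@Uz R z).
Local Notation boundary_line := (@boundary_line R z).

(** Each of the lines contains two of the three vertices of [tz n], so that they
    share one, and different lines share one point at most. *)
Lemma boundary_lines_meet e o e' o' : boundary_line e o -> boundary_line e' o' ->
  ~ same_line e o e' o' -> exists p, [/\ height e o p = 0, height e' o' p = 0 &
    exists N, forall n, (N <= n)%N -> vertex (tz n) p].
Proof.
move=> [de _ [N hN]] [de' _ [N' hN']] ns; pose M := maxn N N'.
have meet n : (M <= n)%N ->
    exists p, [/\ vertex (tz n) p, height e o p = 0 & height e' o' p = 0].
  by rewrite geq_max => /andP[h1 h2]; apply: two_at_common; [exact: hN|exact: hN'].
have [p [_ hp hp']] := meet M (leqnn M).
exists p; split=> //; exists M => n /meet[q [vq hq hq']].
suff -> : p = q by [].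
apply: contrapT => pq; apply: ns.
exact: (two_points_line (dot_direction de) (dot_direction de') pq).
Qed.

(** Three different lines would pass through the only common vertex of all large
    tiles, and each through one of the two other vertices of such a tile. *)
Lemma boundary_lines_two e1 o1 e2 o2 e3 o3 : boundary_line e1 o1 ->
  boundary_line e2 o2 -> boundary_line e3 o3 -> ~ same_line e1 o1 e2 o2 ->
  same_line e1 o1 e3 o3 \/ same_line e2 o2 e3 o3.
Proof.
move=> b1 b2 b3 n12; have [p [p1 p2 [N hN]]] := boundary_lines_meet b1 b2 n12.
apply: contrapT => no.
have [q [q1 q3 [N' hN']]] : exists p, [/\ height e1 o1 p = 0, height e3 o3 p = 0 &
    exists N, forall n, (N <= n)%N -> vertex (tz n) p].
  by apply: boundary_lines_meet => // h; apply: no; left.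
have pq : p = q.
  apply: (@common_unique R z (maxn N N')) => n; rewrite geq_max => /andP[h1 h2].
    exact: hN.
  exact: hN'.
rewrite -pq in q3.
case: b1 b2 b3 => d1 _ [N1 h1] [d2 _ [N2 h2]] [d3 _ [N3 h3]].
have [n [hn _ pa _]] : exists n, [/\ (maxn N (maxn N1 (maxn N2 N3)) <= n)%N, ~~ odd n,
    p = apex (tz n) & [/\ z n = false, z n.+1 = false & z n.+2]].
  apply: common_apex => n; rewrite geq_max => /andP[? _]; exact: hN.
move: hn; rewrite !geq_max => /and4P[g0 g1 g2 g3].
have [a1 a2 a3] := area_vertices (area_shape (shape_tz R z n)).
have D (e o : point) : two_at (height e o) 0 (tz n) ->
    height e o (same (tz n)) = 0 \/ height e o (diff (tz n)) = 0.
  by case=> -[? ?]; [left|right|left].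
have L e o e' o' q' : e \in directions R -> e' \in directions R -> p <> q' ->
    height e o p = 0 -> height e' o' p = 0 -> height e o q' = 0 ->
    height e' o' q' = 0 -> same_line e o e' o'.
  by move=> de de' pq' *; apply: (two_points_line (dot_direction de) (dot_direction de') pq').
have ps : p <> same (tz n) by rewrite pa.
have pd : p <> diff (tz n) by rewrite pa.
have [s3|s3] := D _ _ (h3 n g3); have [s1|s1] := D _ _ (h1 n g1);
  have [s2|s2] := D _ _ (h2 n g2).
- by apply: no; left; apply: (L _ _ _ _ _ d1 d3 ps).
- by apply: no; left; apply: (L _ _ _ _ _ d1 d3 ps).
- by apply: no; right; apply: (L _ _ _ _ _ d2 d3 ps).
- by apply: n12; apply: (L _ _ _ _ _ d1 d2 pd).
- by apply: n12; apply: (L _ _ _ _ _ d1 d2 ps).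
- by apply: no; right; apply: (L _ _ _ _ _ d2 d3 pd).
- by apply: no; left; apply: (L _ _ _ _ _ d1 d3 pd).
- by apply: no; left; apply: (L _ _ _ _ _ d1 d3 pd).
Qed.

(** A point is sent to its coordinate along the line and the square of its
    distance to the line. *)
Lemma half_plane_folding e o : e \in directions R ->
  (forall x, Uz x -> 0 <= height e o x) ->
  exists F : point -> point, (forall x, F (line_reflection e o x) = F x) /\
    forall x y, Uz x -> Uz y -> F x = F y -> x = y.
Proof.
move=> de hU; have e1 := dot_direction de.
exists (fun x => (dot e x, height e o x ^+ 2)); split.
  have J1 : dot e (- e.2, e.1) = 0 by rewrite /dot /=; ring.
  have J2 : cross e (- e.2, e.1) = 1 by rewrite -e1 /cross /dot /=; ring.
  move=> x; rewrite /line_reflection; congr pair.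
    by rewrite -scaleN1r scalerA !(dotDr, dotZr) J1 mulr0 addr0.
  have -> : height e o (x - (2 * height e o x) *: (- e.2, e.1)) =
      height e o x - 2 * height e o x * cross e (- e.2, e.1).
    by rewrite /height /cross !coordE; ring.
  by rewrite J2; ring.
move=> x y /hU hx /hU hy [h1 /eqP].
rewrite eqrXn2 // => /eqP h2.
have h3 : dot e (x - y) = 0.
  by rewrite -[LHS]/(dot e (x + - y)) dotDr h1 -scaleN1r dotZr mulN1r subrr.
have h4 : cross e (x - y) = 0.
  transitivity (height e o x - height e o y); last by rewrite h2 subrr.
  by rewrite /height /cross !coordE; ring.
apply/eqP; rewrite -subr_eq0; apply/eqP.
exact: orthonormal0 e1 h3 h4.
Qed.

(** The folding of a sector of angle 36 degrees: with complex coordinates [w]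
    at its vertex, a point is sent to the norm and the real part of [w ^ 5],
    which are invariant under the reflections in both sides. *)
Lemma sector_folding e o e' o' n : boundary_line e o -> boundary_line e' o' ->
  ~~ odd n -> z n = false ->
  height e o (apex (tz n)) = 0 -> height e o (same (tz n)) = 0 ->
  height e' o' (apex (tz n)) = 0 -> height e' o' (diff (tz n)) = 0 ->
  exists F : point -> point, [/\ forall x, F (line_reflection e o x) = F x,
    forall x, F (line_reflection e' o' x) = F x &
    forall x y, Uz x -> Uz y -> F x = F y -> x = y].
Proof.
move=> [de hU _] [de' hU' _] on zn ha hs ha' hd.
have [h [u [du]]] := tz_frame R z n; rewrite /frame small_tz zn (negbTE on) /=.
set P := apex (tz n) in ha hs ha' hd *; set w := turn h u.
have l0 := leg_gt0 R n false; set l := leg _ _ _ in l0 * => -[eS eD].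
have dw : w \in directions R by exact: directions_turn.
have u1 := dot_direction du.
(* sg is the orientation of the tile *)
pose sg : R := if h then 1 else -1.
pose s := sin (pi / 5) : R; pose c := tau / 2; pose J : point := (- u.2, u.1).
have wE : w = c *: u + (sg * s) *: J.
  by rewrite /w /turn /sg /c /s /J; case: (h); apply: point_ext; rewrite !coordE /=; ring.
have sg2 : sg * sg = 1 by rewrite /sg; case: (h); ring.
have s0 : 0 < s := sin_pi5_gt0 R.
have cs : c ^+ 2 + s ^+ 2 = 1.
  by rewrite /c /s sin_pi5_sqr; field: (tau2 R).
pose X x := dot u (x - P); pose Y x := sg * cross u (x - P).
have wx x : sg * cross w (x - P) = c * Y x - s * X x.
  rewrite wE /X /Y /J.
  transitivity (c * (sg * cross u (x - P)) - (sg * sg) * (s * dot u (x - P))).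
    by rewrite /cross /dot !coordE /=; ring.
  by rewrite sg2 mul1r.
have uw : cross u w = sg * s.
  by rewrite wE -[RHS]mulr1 -u1 /J /cross /dot !coordE /=; ring.
have inU p : vertex (tz n) p -> Uz p by move/vertex_hull => hp; exists n.
have crossZ (a : R) v v' : cross v (a *: v') = a * cross v v'.
  by rewrite /cross !coordE; ring.
have par : cross u e = 0.
  have := height_moved (same (tz n)) ha; rewrite hs eS crossZ => /esym/eqP.
  rewrite mulf_eq0 (gt_eqF l0) /= => /eqP e0.
  by rewrite -[RHS]oppr0 -e0 /cross; ring.
have par' : cross w e' = 0.
  have := height_moved (diff (tz n)) ha'; rewrite hd eD crossZ => /esym/eqP.
  rewrite mulf_eq0 (gt_eqF l0) /= => /eqP e0.
  by rewrite -[RHS]oppr0 -e0 /cross; ring.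
have crossN v v' : cross (- v) v' = - cross v v'.
  by rewrite /cross !coordE; ring.
have Y0 x : Uz x -> 0 <= Y x.
  move=> Ux; have := hU x Ux; have := hU _ (inU _ (Or33 _ _ (erefl (diff (tz n))))).
  rewrite !(height_moved _ ha) eD crossZ pmulr_rge0 // /Y.
  have [->|->] := unit_parallel u1 (dot_direction de) par.
    by rewrite uw /sg; case: (h); rewrite ?mul1r ?mulN1r //; lra.
  by rewrite !crossN uw /sg; case: (h); rewrite ?mul1r ?mulN1r //; lra.
have W0 x : Uz x -> 0 <= s * X x - c * Y x.
  move=> Ux; rewrite -opprB oppr_ge0 -wx.
  have := hU' x Ux; have := hU' _ (inU _ (Or32 _ _ (erefl (same (tz n))))).
  rewrite !(height_moved _ ha') eS crossZ pmulr_rge0 //.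
  have wu : cross w u = - (sg * s) by rewrite -uw /cross; ring.
  have [->|->] := unit_parallel (dot_direction dw) (dot_direction de') par'.
    by rewrite wu /sg; case: (h); rewrite ?mul1r ?mulN1r //; lra.
  by rewrite !crossN wu /sg; case: (h); rewrite ?mul1r ?mulN1r //; lra.
have refl1 x : line_reflection e o x = line_reflection u P x.
  apply: same_line_reflection => //; split=> //.
  have := height_moved o ha; have -> : height e o o = 0 by rewrite /height subrr /cross !coordE; ring.
  rewrite /height; have [->|->] := unit_parallel u1 (dot_direction de) par => //.
  by rewrite crossN => /esym/eqP; rewrite oppr_eq0 => /eqP.
have refl2 x : line_reflection e' o' x = line_reflection w P x.
  apply: same_line_reflection => //; split=> //.
  have := height_moved o' ha'; have -> : height e' o' o' = 0 by rewrite /height subrr /cross !coordE; ring.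
  rewrite /height; have [->|->] := unit_parallel (dot_direction dw) (dot_direction de') par' => //.
  by rewrite crossN => /esym/eqP; rewrite oppr_eq0 => /eqP.
exists (fun x => (X x ^+ 2 + Y x ^+ 2, re5 (X x) (Y x))); split.
- move=> x; rewrite refl1.
  have XE : X (line_reflection u P x) = X x.
    by rewrite /X /line_reflection /dot !coordE /=; ring.
  have YE : Y (line_reflection u P x) = - Y x.
    rewrite /Y /line_reflection /height.
    transitivity (sg * (cross u (x - P) - 2 * cross u (x - P) * dot u u)).
      by rewrite /cross /dot !coordE /=; ring.
    by rewrite u1; ring.
  by rewrite XE YE; congr pair; rewrite /re5; ring.
- move=> x; rewrite refl2.
  have uw' : dot u w = c by rewrite /w dot_turnl u1 mulr1.
  have s2 := sin_pi5_sqr R; rewrite -/s in s2.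
  have XE : X (line_reflection w P x) = (tau - 1) / 2 * X x + tau * s * Y x.
    transitivity (X x + 2 * cross u w * cross w (x - P)).
      by rewrite /X /line_reflection /height /cross /dot !coordE /=; ring.
    rewrite uw; transitivity (X x + 2 * s * (sg * cross w (x - P))); first by ring.
    rewrite wx; transitivity (X x - 2 * s ^+ 2 * X x + 2 * s * c * Y x); first by ring.
    by rewrite s2 /c; field.
  have YE : Y (line_reflection w P x) = tau * s * X x - (tau - 1) / 2 * Y x.
    transitivity (Y x - 2 * dot u w * (sg * cross w (x - P))).
      by rewrite /Y /line_reflection /height /cross /dot !coordE /=; ring.
    rewrite wx uw'; transitivity (Y x - 2 * c ^+ 2 * Y x + 2 * c * s * X x); first by ring.
    have c2 : c ^+ 2 = (tau + 1) / 4 by rewrite /c; field: (tau2 R).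
    by rewrite c2 /c; field.
  have [C1 C2 C3] := root5 R; rewrite XE YE; congr pair.
    transitivity ((((tau - 1) / 2) ^+ 2 + (tau * s) ^+ 2) * (X x ^+ 2 + Y x ^+ 2)).
      by ring.
    by rewrite C1 mul1r.
  by rewrite re5_reflection C2 C3; ring.
move=> x y Ux Uy [nE rE].
have [e1 e2] := sector_inj (Y0 _ Ux) (W0 _ Ux) (Y0 _ Uy) (W0 _ Uy) nE rE.
apply/eqP; rewrite -subr_eq0; apply/eqP; apply: (orthonormal0 u1).
  transitivity (X x - X y); last by rewrite e1 subrr.
  by rewrite /X /dot !coordE; ring.
transitivity (sg * (Y x - Y y)); last by rewrite e2 subrr mulr0.
rewrite -[LHS]mul1r -sg2 /Y; rewrite /cross !coordE; ring.
Qed.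

(** The region [Uz] has no boundary line, or one, or two. In the last case these
    contain two edges of a large tile at its apex, whose angle is 36 degrees. *)
Theorem folding_exists : exists F : point -> point, folding z F.
Proof.
have [[e [o be]]|none] := pselect (exists e o, boundary_line e o); last first.
  exists id; split=> // p q x /wall_line[e [o [be _]]].
  by case: none; exists e, o.
have [de hU _] := be.
have [[e' [o' [be' ns]]]|one] :=
  pselect (exists e' o', boundary_line e' o' /\ ~ same_line e o e' o'); last first.
  have [F [F1 F2]] := half_plane_folding de hU.
  exists F; split=> // p q x /wall_line[e' [o' [be' ->]]].
  have [de' _ _] := be'.
  rewrite (@same_line_reflection _ e o e' o' x de de') //.
  by apply: contrapT => ns; apply: one; exists e', o'.
have [de' hU' _] := be'.
have [p [hp hp' [N hN]]] := boundary_lines_meet be be' ns.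
have [F [F1 F2 F3]] : exists F : point -> point, [/\
    forall x, F (line_reflection e o x) = F x,
    forall x, F (line_reflection e' o' x) = F x &
    forall x y, Uz x -> Uz y -> F x = F y -> x = y].
  case: (be) => _ _ [N1 h1]; case: (be') => _ _ [N2 h2].
  have [n [hn on pa [zn _ _]]] : exists n, [/\ (maxn N (maxn N1 N2) <= n)%N,
      ~~ odd n, p = apex (tz n) & [/\ z n = false, z n.+1 = false & z n.+2]].
    by apply: common_apex => n; rewrite geq_max => /andP[? _]; exact: hN.
  move: hn; rewrite !geq_max => /and3P[_ g1 g2].
  have [a1 a2 a3] := area_vertices (area_shape (shape_tz R z n)).
  rewrite pa in hp hp'.
  have D (v w : point) : two_at (height v w) 0 (tz n) ->
      height v w (same (tz n)) = 0 \/ height v w (diff (tz n)) = 0.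
    by case=> -[? ?]; [left|right|left].
  have [s1|s1] := D _ _ (h1 n g1); have [s2|s2] := D _ _ (h2 n g2).
  - by case: ns; apply: (two_points_line (dot_direction de) (dot_direction de') a1).
  - exact: (sector_folding be be' on zn hp s1 hp' s2).
  - have [F [F1 F2 F3]] := sector_folding be' be on zn hp' s2 hp s1.
    by exists F.
  - by case: ns; apply: (two_points_line (dot_direction de) (dot_direction de') a2).
exists F; split=> // q r x /wall_line[e3 [o3 [b3 ->]]]; have [d3 _ _] := b3.
by have [/(same_line_reflection x de d3)->|/(same_line_reflection x de' d3)->] :=
  boundary_lines_two be be' b3 ns.
Qed.

End Region.
End Folding.

Theorem theorem1p3 (R : realType) (k : fieldType) :
  (forall z : penrose_seq, qsimple (Oz k z)) /\
  (forall z z' : penrose_seq,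
    (qisomorphic (Oz k z) (Oz k z') <-> tail_eq z z') /\
    (tail_eq z z' <->
       exists sigma : R * R -> R * R,
         plane_isometry sigma /\ [set sigma @` K | K in Tz R z] = Tz R z')).
Proof.
split=> [z|z z']; first exact: Oz_simple.
split; split.
- exact: qisomorphic_tail_eq.
- by move=> [m zz']; exact: (tail_eq_qisomorphic k zz').
- exact: tail_eq_isometric.
move=> [sigma [isosigma e]].
have [F hF] := folding_exists R z; have [F' hF'] := folding_exists R z'.
exact: (isometric_tail_eq hF hF' isosigma e).
Qed.
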